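(* Let $B$ be the unit ball in $\mathbb{R}^3$ and let $\eta\in L^3(B)$ (complex-valued) be expanded in the orthonormal basis $\{\psi_\ell^{k,m}\}$ of $L^2(B)$ as $$\eta=\sum_{k\in\mathbb{N}_0}\sum_{\ell\in\mathbb{N}_0}\sum_{m=-\ell}^{\ell}c_\ell^{k,m}\,\psi_\ell^{k,m}$$ for an $\ell^2$-sequence of coefficients $c_\ell^{k,m}\in\mathbb{C}$ (convergence in $L^2(B)$). For $k,\ell,q,s\in\mathbb{N}_0$ with $q+s\le k$ and $m\in\{-\ell,\dots,\ell\}$, define the scalars (independent of $\eta$) $$Q_{\ell,s}^{k,m,q}=(-1)^{m+1}\frac{\sqrt{2\ell+4q+4s+3}\,(k-s+1)\,(k-q-s+1)_q}{(k+1)(\ell+k+1)\,(\ell+k+s+\tfrac52)_q}\,G_{k+1,\ell+k+1,\ell+2s}^{0,-m,m},$$ where $$G_{k+1,\ell+k+1,\ell+2s}^{0,-m,m}=\int_{\partial B}Y_{k+1}^0\,Y_{\ell+k+1}^{-m}\,Y_{\ell+2s}^{m}\,\mathrm{d}S .$$ Then for all $k,\ell\in\mathbb{N}_0$ and all $m\in\{-\ell,\dots,\ell\}$, $$c_\ell^{k,m}=\bigl(Q_{\ell,0}^{k,m,k}\bigr)^{-1}\Bigl(\langle (F\eta)Y_{k+1}^0,\,Y_{\ell+k+1}^m\rangle_{L^2(\partial B)}-\sum_{q=0}^{k-1}\sum_{s=0}^{k-q}Q_{\ell,s}^{k,m,q}\,c_{\ell+2s}^{q,m}\Bigr),$$ where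 the inverse is meaningful, i.e. $Q_{\ell,0}^{k,m,k}\neq 0$.
   Context: All function spaces are complex-valued and inner products are linear in the first argument, e.g. $\langle f,g\rangle_{L^2(\partial B)}=\int_{\partial B}f\overline{g}\,\mathrm{d}S$. $\mathbb{N}_0=\{0,1,2,\dots\}$. $(x)_n=\Gamma(x+n)/\Gamma(x)$ for $x>0$, $n\in\mathbb{N}_0$, is the Pochhammer symbol (rising factorial), so $(x)_0=1$. Linearised data. Let $L^2_\diamond(\partial B)=\{g\in L^2(\partial B):\int_{\partial B}g\,\mathrm{d}S=0\}$. For $f\in L^2_\diamond(\partial B)$ let $u_f\in H^1(B)$ be the harmonic function in $B$ with Neumann trace $\nu\cdot\nabla u_f=f$ on $\partial B$ ($\nu$ the exterior unit normal), normalised by $\int_{\partial B}u_f\,\mathrm{d}S=0$. The operator $F$ is the bounded linear operator from $L^3(B)$ to the bounded linear operators on $L^2_\diamond(\partial B)$ characterised by $$\langle (F\eta)f,g\rangle_{L^2(\partial B)}=-\int_B\eta\,\nabla u_f\cdot\overline{\nabla u_g}\,\mathrm{d}x,\qquad \eta\in L^3(B),\ f,g\in L^2_\diamond(\partial B).$$ (It is the continuous extension from $L^\infty(B)$ to $L^3(B)$ of the Fréchet derivative at $\gamma\equiv1$ of the map sending a conductivity $\gamma$ to its Neumann-to-Dirichlet map.) Spherical harmonics. In spherical coordinates (radial distance $r$, polar angle $\theta$, azimuthal angle $\varphi$), for $\ell\in\mathbb{N}_0$ and $m\in\{-\ell,\dots,\ell\}$, $$Y_\ell^m(\theta,\varphi)=\sqrt{\frac{2\ell+1}{4\pi}\frac{(\ell-m)!}{(\ell+m)!}}\,P_\ell^m(\cos\theta)\,e^{\mathrm{i}m\varphi},$$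 where $P_\ell^m$ is the associated Legendre function with the Condon–Shortley phase, $P_\ell^m(x)=\frac{(-1)^m}{2^\ell\ell!}(1-x^2)^{m/2}\frac{\mathrm{d}^{\ell+m}}{\mathrm{d}x^{\ell+m}}(x^2-1)^\ell$. The family $\{Y_\ell^m\}$ is orthonormal in $L^2(\partial B)$. 3D Zernike basis. For $\ell,k\in\mathbb{N}_0$ the 3D radial Zernike polynomial is $$R_\ell^k(r)=\sqrt{2\ell+4k+3}\sum_{s=0}^k(-1)^s\binom{k}{s}\binom{\ell+2k-s+\tfrac12}{k}r^{\ell+2k-2s},$$ with generalised binomial coefficient $\binom{x}{n}=\frac{\Gamma(x+1)}{n!\,\Gamma(x-n+1)}$ for $x>n-1$, $n\in\mathbb{N}_0$. The functions $$\psi_\ell^{k,m}(r,\theta,\varphi)=R_\ell^k(r)\,Y_\ell^m(\theta,\varphi),\qquad k,\ell\in\mathbb{N}_0,\ m\in\{-\ell,\dots,\ell\},$$ form an orthonormal basis of $L^2(B)$. *)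

(* Defs.v *)
From HB Require Import structures.
From mathcomp Require Import all_boot all_order all_algebra.
From mathcomp Require Import complex.
From mathcomp Require Import all_classical all_reals all_analysis.
From mathcomp Require Import measurable_realfun.
Set Implicit Arguments.
Unset Strict Implicit.
Unset Printing Implicit Defensive.
Import Order.TTheory GRing.Theory Num.Theory numFieldNormedType.Exports.

Local Open Scope classical_set_scope.
Local Open Scope ring_scope.
Local Open Scope complex_scope.

Definition cint d (T : measurableType d) (R : realType)
    (mu : {measure set T -> \bar R}) (D : set T) (f : T -> R[i]) : R[i] :=
  (\int[mu]_(x in D) complex.Re (f x)) +i* (\int[mu]_(x in D) complex.Im (f x)).

Definition inner_L2 d (T : measurableType d) (R : realType)
    (mu : {measure set T -> \bar R}) (D : set T) (f g : T -> R[i]) : R[i] :=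
  cint mu D (fun x => f x * (g x)^*).

Definition norm_Lp d (T : measurableType d) (R : realType)
    (mu : {measure set T -> \bar R}) (D : set T) (p : R) (f : T -> R[i]) :
    \bar R :=
  'N[mu]_(p%:E)[(fun x => (Normc.normc (f x))%:E) \_ D]%E.

(* Elements of L^p(D) are represented by functions whose values outside D
   are irrelevant; identities between them are stated almost everywhere. *)
Definition mem_Lp d (T : measurableType d) (R : realType)
    (mu : {measure set T -> \bar R}) (D : set T) (p : R) (f : T -> R[i]) :
    Prop :=
  [/\ measurable_fun D (fun x => complex.Re (f x)),
      measurable_fun D (fun x => complex.Im (f x)) &
      (norm_Lp mu D p f < +oo)%E].

Definition pt (R : realType) := (R * R * R)%type.

(* [mpt R] is [pt R] with the Borel sigma-algebra on which the Lebesgue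
   measure of the library is defined; the two types are convertible. *)
Definition mpt (R : realType) : measurableType _ :=
  (measurableTypeR R * measurableTypeR R * measurableTypeR R)%type.

Definition leb3 (R : realType) : {measure set mpt R -> \bar R} :=
  (@lebesgue_measure R \x @lebesgue_measure R \x @lebesgue_measure R)%E.

Definition enorm (R : realType) (x : pt R) : R :=
  Num.sqrt (x.1.1 ^+ 2 + x.1.2 ^+ 2 + x.2 ^+ 2).

Definition ball3 (R : realType) : set (pt R) := [set x | enorm x < 1].

Definition sphere (R : realType) : set (pt R) := [set x | enorm x = 1].

Definition angle (R : realType) : measurableType _ :=
  (measurableTypeR R * measurableTypeR R)%type.

Definition leb2 (R : realType) : {measure set angle R -> \bar R} :=
  (@lebesgue_measure R \x @lebesgue_measure R)%E.

Definition angles (R : realType) : set (angle R) :=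
  [set a | 0 <= (a.1 : R) <= pi /\ 0 <= (a.2 : R) <= 2 * pi].

Definition spherical (R : realType) (a : angle R) : mpt R :=
  (sin (a.1 : R) * cos (a.2 : R), sin (a.1 : R) * sin (a.2 : R), cos (a.1 : R)).

(* dS = sin theta dtheta dphi, carried to R^3 by the parametrisation of the
   sphere by spherical coordinates. *)
Definition surface (R : realType) (A : set (mpt R)) : \bar R :=
  (\int[leb2 R]_(a in @angles R `&` @spherical R @^-1` A)
     (sin (a.1 : R))%:E)%E.

Lemma measurable_angles (R : realType) : measurable (@angles R).
Proof.
have -> : @angles R = `[0, pi]%classic `*` `[0, 2 * pi]%classic.
  by apply/seteqP; split=> -[a b] /=; rewrite !in_itv.
by apply: measurableX; exact: measurable_itv.
Qed.

Lemma measurable_spherical (R : realType) : measurable_fun setT (@spherical R).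
Proof.
have ms : measurable_fun setT (@sin R).
  by apply: continuous_measurable_fun; exact: continuous_sin.
have mc : measurable_fun setT (@cos R).
  by apply: continuous_measurable_fun; exact: continuous_cos.
have s1 : measurable_fun setT (fun a : angle R => sin (a.1 : R)).
  exact: (measurableT_comp ms measurable_fst).
have c1 : measurable_fun setT (fun a : angle R => cos (a.1 : R)).
  exact: (measurableT_comp mc measurable_fst).
have s2 : measurable_fun setT (fun a : angle R => sin (a.2 : R)).
  exact: (measurableT_comp ms measurable_snd).
have c2 : measurable_fun setT (fun a : angle R => cos (a.2 : R)).
  exact: (measurableT_comp mc measurable_snd).
apply: measurable_fun_pair; last exact: c1.
by apply: measurable_fun_pair; exact: measurable_funM.
Qed.

Lemma surface0 (R : realType) : surface (@set0 (mpt R)) = 0%E.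
Proof. by rewrite /surface preimage_set0 setI0 integral_set0. Qed.

Lemma sin_angles_ge0 (R : realType) (a : angle R) (A : set (angle R)) :
  (@angles R `&` A) a -> (0 <= (sin (a.1 : R))%:E)%E.
Proof. by move=> [[h _] _]; rewrite lee_fin sin_ge0_pi. Qed.

Lemma surface_ge0 (R : realType) (A : set (mpt R)) : (0 <= surface A)%E.
Proof. by apply: integral_ge0 => a; exact: sin_angles_ge0. Qed.

Lemma surface_semi_sigma_additive (R : realType) :
  semi_sigma_additive (@surface R).
Proof.
move=> F mF tF mUF; rewrite /surface preimage_bigcup setI_bigcupr.
have mG k : measurable (@angles R `&` @spherical R @^-1` F k).
  apply: measurableI; first exact: measurable_angles.
  by rewrite -[X in measurable X]setTI; exact: measurable_spherical.
rewrite ge0_integral_bigcup//=.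
- apply: is_cvg_ereal_nneg_natsum_cond => n _ _.
  by apply: integral_ge0 => a; exact: sin_angles_ge0.
- apply: measurable_funTS; apply/measurable_EFinP.
  apply: (measurableT_comp _ measurable_fst).
  by apply: continuous_measurable_fun; exact: continuous_sin.
- by move=> a [k _]; exact: sin_angles_ge0.
- apply/trivIsetP => i j _ _ ij; rewrite setIACA setIid -preimage_setI.
  by move/trivIsetP : tF => /(_ i j I I ij) ->; rewrite preimage_set0 setI0.
Qed.

HB.instance Definition _ (R : realType) := isMeasure.Build _ (mpt R) R
  (@surface R) (@surface0 R) (@surface_ge0 R) (@surface_semi_sigma_additive R).

Definition dS (R : realType) : {measure set mpt R -> \bar R} := @surface R.

Definition basis3 (R : realType) (i : 'I_3) : pt R :=
  match nat_of_ord i with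
  | 0 => (1, 0, 0)
  | 1 => (0, 1, 0)
  | _ => (0, 0, 1)
  end.

Definition partial (R : realType) (i : 'I_3) (f : pt R -> R) : pt R -> R :=
  fun x => 'D_(basis3 R i) f x.

(* Class C^k in the open set U, through iterated partial derivatives. *)
Fixpoint class_C (R : realType) (U : set (pt R)) (k : nat) (f : pt R -> R) :
    Prop :=
  (forall x, U x -> {for x, continuous f}) /\
  match k with
  | 0 => True
  | k'.+1 => forall i, (forall x, U x -> derivable f x (basis3 R i)) /\
                       class_C U k' (partial i f)
  end.

Definition smooth (R : realType) (f : pt R -> R) : Prop :=
  forall k, class_C setT k f.

Definition csmooth (R : realType) (f : pt R -> R[i]) : Prop :=
  smooth (fun x => complex.Re (f x)) /\ smooth (fun x => complex.Im (f x)).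

Definition test_function (R : realType) (phi : pt R -> R) : Prop :=
  smooth phi /\ closure [set x | phi x != 0] `<=` @ball3 R.

Definition grad (R : realType) (u : pt R -> R[i]) (i : 'I_3) : pt R -> R[i] :=
  fun x => partial i (fun y => complex.Re (u y)) x
           +i* partial i (fun y => complex.Im (u y)) x.

Definition laplacian (R : realType) (f : pt R -> R) (x : pt R) : R :=
  \sum_(i < 3) partial i (partial i f) x.

Definition harmonic_in_ball (R : realType) (u : pt R -> R[i]) : Prop :=
  [/\ class_C (@ball3 R) 2 (fun x => complex.Re (u x)),
      class_C (@ball3 R) 2 (fun x => complex.Im (u x)) &
      forall x, ball3 x ->
        laplacian (fun y => complex.Re (u y)) x = 0 /\
        laplacian (fun y => complex.Im (u y)) x = 0].

(* u is in H^1(B), with weak gradient Du. *)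
Definition H1 (R : realType) (u : pt R -> R[i]) (Du : 'I_3 -> pt R -> R[i]) :
    Prop :=
  [/\ mem_Lp (leb3 R) (@ball3 R) 2 u,
      forall i, mem_Lp (leb3 R) (@ball3 R) 2 (Du i) &
      forall i (phi : pt R -> R), test_function phi ->
        cint (leb3 R) (@ball3 R) (fun x => u x * (partial i phi x)%:C) =
        - cint (leb3 R) (@ball3 R) (fun x => Du i x * (phi x)%:C)].

(* t is the Dirichlet trace of u on the sphere: the trace operator is the
   continuous extension to H^1(B) of the restriction to the sphere of the
   functions that are smooth up to the boundary. *)
Definition trace (R : realType) (u : pt R -> R[i]) (Du : 'I_3 -> pt R -> R[i])
    (t : pt R -> R[i]) : Prop :=
  mem_Lp (dS R) (@sphere R) 2 t /\
  exists v : nat -> pt R -> R[i],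
    [/\ forall n, csmooth (v n),
        (fun n => norm_Lp (leb3 R) (@ball3 R) 2 (fun x => v n x - u x))
          @ \oo --> 0%E,
        forall i, (fun n => norm_Lp (leb3 R) (@ball3 R) 2
                              (fun x => grad (v n) i x - Du i x))
          @ \oo --> 0%E &
        (fun n => norm_Lp (dS R) (@sphere R) 2 (fun x => v n x - t x))
          @ \oo --> 0%E].

Definition L3_ball (R : realType) (eta : pt R -> R[i]) : Prop :=
  mem_Lp (leb3 R) (@ball3 R) 3 eta.

Definition L2_diamond (R : realType) (f : pt R -> R[i]) : Prop :=
  mem_Lp (dS R) (@sphere R) 2 f /\ cint (dS R) (@sphere R) f = 0.

(* For a harmonic u in H^1(B), the Neumann trace nu . grad u = f is understood
   through Green's formula. *)
Definition neumann_trace (R : realType) (u f : pt R -> R[i]) : Prop :=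
  forall (v : pt R -> R[i]) (Dv : 'I_3 -> pt R -> R[i]) (t : pt R -> R[i]),
    H1 v Dv -> trace v Dv t ->
    cint (leb3 R) (@ball3 R) (fun x => \sum_(i < 3) grad u i x * (Dv i x)^*) =
    inner_L2 (dS R) (@sphere R) f t.

Definition neumann_solution (R : realType) (f u : pt R -> R[i]) : Prop :=
  [/\ harmonic_in_ball u,
      neumann_trace u f &
      exists (Du : 'I_3 -> pt R -> R[i]) (t : pt R -> R[i]),
        [/\ H1 u Du, trace u Du t & cint (dS R) (@sphere R) t = 0]].

(* F : L^3(B) -> L(L^2_diamond) is linear, bounded and given by the bilinear
   identity that characterises the derivative at gamma = 1 of the
   Neumann-to-Dirichlet map. *)
Record linearised_data (R : realType)
    (F : (pt R -> R[i]) -> (pt R -> R[i]) -> (pt R -> R[i])) : Prop := {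
  F_L2_diamond : forall eta f, L3_ball eta -> L2_diamond f ->
    L2_diamond (F eta f);
  F_linear_arg : forall eta (a : R[i]) f g,
    L3_ball eta -> L2_diamond f -> L2_diamond g ->
    {ae dS R, forall x, sphere x ->
      F eta (fun y => a * f y + g y) x = a * F eta f x + F eta g x};
  F_linear : forall (a : R[i]) eta zeta f,
    L3_ball eta -> L3_ball zeta -> L2_diamond f ->
    {ae dS R, forall x, sphere x ->
      F (fun y => a * eta y + zeta y) f x = a * F eta f x + F zeta f x};
  F_bounded : exists M : R, forall eta f, L3_ball eta -> L2_diamond f ->
    (norm_Lp (dS R) (@sphere R) 2 (F eta f) <=
       M%:E * norm_Lp (leb3 R) (@ball3 R) 3 eta *
       norm_Lp (dS R) (@sphere R) 2 f)%E;
  F_inner : forall eta f g uf ug,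
    L3_ball eta -> L2_diamond f -> L2_diamond g ->
    neumann_solution f uf -> neumann_solution g ug ->
    inner_L2 (dS R) (@sphere R) (F eta f) g =
    - cint (leb3 R) (@ball3 R)
        (fun x => eta x * \sum_(i < 3) grad uf i x * (grad ug i x)^*) }.

(* For m < 0 the factor (1 - x^2)^(m/2) is given the value 0 at x = 1, -1, as
   powR 0 a = 0 for a != 0; this is the value of P_l^m there. *)
Definition legendre (R : realType) (l : nat) (m : int) (x : R) : R :=
  (-1) ^ m / (2 ^+ l * (l`!)%:R) * (1 - x ^+ 2) `^ (m%:~R / 2) *
  ((('X^2 - 1) ^+ l)^`(absz (l%:Z + m))).[x].

Definition sph_harm (R : realType) (l : nat) (m : int) (theta phi : R) : R[i] :=
  (Num.sqrt ((2 * l%:R + 1) / (4 * pi) *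
             (((absz (l%:Z - m))`!)%:R / ((absz (l%:Z + m))`!)%:R)) *
   legendre l m (cos theta))%:C *
  (cos (m%:~R * phi) +i* sin (m%:~R * phi)).

Definition polar (R : realType) (x : pt R) : R := acos (x.2 / enorm x).

Definition azimuth (R : realType) (x : pt R) : R :=
  let rho := Num.sqrt (x.1.1 ^+ 2 + x.1.2 ^+ 2) in
  if 0 <= x.1.2 then acos (x.1.1 / rho) else 2 * pi - acos (x.1.1 / rho).

Definition Y (R : realType) (l : nat) (m : int) (x : pt R) : R[i] :=
  sph_harm l m (polar x) (azimuth x).

Definition Gamma (R : realType) (x : R) : R :=
  \int[@lebesgue_measure R]_(t in `]0, +oo[) (t `^ (x - 1) * expR (- t)).

Definition pochhammer (R : realType) (x : R) (n : nat) : R :=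
  Gamma (x + n%:R) / Gamma x.

Definition gbinomial (R : realType) (x : R) (n : nat) : R :=
  Gamma (x + 1) / ((n`!)%:R * Gamma (x - n%:R + 1)).

Definition zernike_radial (R : realType) (l k : nat) (r : R) : R :=
  Num.sqrt (2 * l%:R + 4 * k%:R + 3) *
  \sum_(s < k.+1) (-1) ^+ s * gbinomial k%:R s *
    gbinomial (l%:R + 2 * k%:R - s%:R + 2^-1) k * r ^+ (l + 2 * k - 2 * s)%N.

Definition zernike (R : realType) (k l : nat) (m : int) (x : pt R) : R[i] :=
  (zernike_radial l k (enorm x))%:C * Y l m x.

(* The sum over m in {-l, ..., l} is reindexed by j = m + l. *)
Definition zernike_sum (R : realType) (c : nat -> nat -> int -> R[i]) (N : nat)
    (x : pt R) : R[i] :=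
  \sum_(k < N) \sum_(l < N) \sum_(j < (2 * l).+1)
    c k l (j%:Z - l%:Z) * zernike k l (j%:Z - l%:Z) x.

(* c k l m stands for the coefficient c_l^{k,m}. For square-summable
   coefficients over an orthonormal family, the convergence of the square
   partial sums k, l < N is equivalent to unconditional convergence. *)
Definition zernike_expansion (R : realType) (eta : pt R -> R[i])
    (c : nat -> nat -> int -> R[i]) : Prop :=
  (\esum_(i in [set i : nat * nat * int | (`|i.2| <= i.1.2%:Z)%R])
     ((Normc.normc (c i.1.1 i.1.2 i.2)) ^+ 2)%:E < +oo)%E /\
  (fun N => norm_Lp (leb3 R) (@ball3 R) 2 (fun x => eta x - zernike_sum c N x))
    @ \oo --> 0%E.

Definition gaunt (R : realType) (l1 l2 l3 : nat) (m1 m2 m3 : int) : R[i] :=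
  cint (dS R) (@sphere R) (fun x => Y l1 m1 x * Y l2 m2 x * Y l3 m3 x).

(* Argument order: Qcoef R l s k m q is Q_{l,s}^{k,m,q}. *)
Definition Qcoef (R : realType) (l s k : nat) (m : int) (q : nat) : R[i] :=
  ((-1) ^ (m + 1) *
   (Num.sqrt (2 * l%:R + 4 * q%:R + 4 * s%:R + 3) * (k%:R - s%:R + 1) *
    pochhammer (k%:R - q%:R - s%:R + 1) q) /
   ((k%:R + 1) * (l%:R + k%:R + 1) *
    pochhammer (l%:R + k%:R + s%:R + 5 / 2) q))%:C *
  gaunt R (k + 1) (l + k + 1) (l + 2 * s) 0 (- m) m.

(* Main.v *)
Require Import Defs.
From HB Require Import structures.
From mathcomp Require Import all_boot all_order all_algebra.
From mathcomp Require Import complex ring lra zify.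
From mathcomp Require Import all_classical all_reals all_analysis.
From mathcomp Require Import measurable_realfun.

(** For [f = Y_{k+1}^0] and [g = Y_n^m], [n = l+k+1], the solutions [u_f], [u_g]
    are the solid harmonics divided by their degrees, so that
    [grad u_f . conj (grad u_g)] is half the Laplacian of [w = u_f conj u_g], a
    polynomial homogeneous of degree [N = l+2k+2].  A function of the Zernike
    basis is a combination of [r^(2j) h] with [h] a solid harmonic of degree
    [L], and the divergence theorem for [r^(2j) (h grad w - w grad h)] reduces
    its pairing with [lap w] to [(N-L)(N+L+1) / (2j+L+N+1)] times the integral
    over the sphere of the product of three spherical harmonics.  That integral
    vanishes unless the orders agree and [L = l+2s] with [0 <= s <= k+1], by the
    orthogonality and the parity of the Legendre functions; [s = k+1] is killed
    by [N - L], and a partial fraction expansion of the alternating sum over [j]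
    gives [0] if [q+s > k] and the quotient of Pochhammer symbols otherwise.
    Hence the pairing of [eta] with the weight is a finite sum, in which
    [c_l^{k,m}] is the coefficient of top radial index; its factor is nonzero
    because [Y_{k+1}^0 Y_l^m] has degree exactly [l+k+1]. *)

Set Implicit Arguments.
Unset Strict Implicit.
Unset Printing Implicit Defensive.
Import Order.TTheory GRing.Theory Num.Theory numFieldNormedType.Exports.

Local Open Scope classical_set_scope.
Local Open Scope ring_scope.
Local Open Scope complex_scope.

(** The functions of the statement are given by angles, and [polar] and [azimuth] are not smooth;
    whatever has to be differentiated is first replaced by a polynomial, equal to [Y] on the sphere
    and to [zernike] everywhere. [F_inner] holds for every pair of Neumann solutions, so exhibiting
    the polynomial ones is enough, but their Neumann condition is tested against all of H^1(B),
    which takes an approximation argument. The volume is a product of Lebesgue measures while the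
    surface measure is built on angles; the divergence theorem is the bridge between them, and comes
    from integrating along parallels to each axis and reparametrising the ends of the chords. The
    divergence of the field also contains r^(2j-2) h w; Euler's identity turns its integral into the
    same sphere integral, and the two contributions combine into the quotient by 2j+L+N+1. The
    expansion may be integrated termwise because the weight is bounded, so that pairing with it is
    continuous on L^2(B); along N = l+2T the pairing with the partial sums is eventually
    constant. *)

Lemma countable_bigcup_measurable_pred d (T : measurableType d) (I : countType)
    (B : I -> set T) (P : I -> Prop) :
  (forall i, measurable (B i)) -> measurable (\bigcup_(i in P) B i).
Proof.
move=> mB.
have -> : \bigcup_(i in P) B i =
    \bigcup_n (if unpickle n is Some i then if `[< P i >] then B i else set0
               else set0).
  apply/seteqP; split=> [x [i Pi Bx]|x [n _]].
    by exists (pickle i) => //; rewrite pickleK asboolT.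
  by case: unpickle => // i; case: asboolP => // Pi Bx; exists i.
apply: bigcupT_measurable => n; case: unpickle => // i.
by case: ifP.
Qed.

Definition ratbox (R : realType) (p : rat * rat) : set R :=
  `](ratr p.1 : R), (ratr p.2 : R)[%classic.

Lemma ratbox_nbhs (R : realType) (x e : R) : 0 < e ->
  exists p, ratbox p x /\ ratbox p `<=` ball x e.
Proof.
move=> e0.
have [a] := @rat_in_itvoo R (x - e) x ltac:(by rewrite ltrBlDr ltrDl).
have [b] := @rat_in_itvoo R x (x + e) ltac:(by rewrite ltrDl).
rewrite !in_itv/= => /andP[xb be] /andP[ea ax].
exists (a, b); split; first by rewrite /ratbox/= in_itv/= ax xb.
move=> y; rewrite /ratbox/= in_itv/= => /andP[ay yb].
rewrite -ball_normE/= ltr_norml; apply/andP; split; lra.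
Qed.

(** * Continuous functions on the ball and the sphere *)

Section measurability.
Context {R : realType}.

Lemma leb2_setX (A B : set (measurableTypeR R)) : measurable A -> measurable B ->
  leb2 R (A `*` B) = (lebesgue_measure A * lebesgue_measure B)%E.
Proof. by move=> mA mB; exact: product_measure1E. Qed.

Lemma leb3_setX (A B C : set (measurableTypeR R)) :
  measurable A -> measurable B -> measurable C ->
  leb3 R ((A `*` B) `*` C) =
  (lebesgue_measure A * lebesgue_measure B * lebesgue_measure C)%E.
Proof.
move=> mA mB mC; rewrite -leb2_setX//.
by apply: (@product_measure1E _ _ _ _ R (leb2 R)) => //; exact: measurableX.
Qed.

(** The sigma-algebra is generated by rectangles and openness refers to the product topology; the
    two meet because an open set is the union of the countably many rational boxes that it
    contains. *)
Lemma open_measurable2 (U : set (R * R)) :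
  open U -> measurable (U : set (angle R)).
Proof.
move=> oU.
pose B (p : (rat * rat) * (rat * rat)) : set (angle R) :=
  ratbox p.1 `*` ratbox p.2.
have -> : U = \bigcup_(p in [set p | B p `<=` U]) B p.
  apply/seteqP; split=> [x Ux|x [p /= BU] Bx]; last exact: BU.
  have /nbhs_ballP[e e0 eU] : nbhs x U by exact: open_nbhs_nbhs.
  have [p1 [x1 s1]] := @ratbox_nbhs R x.1 e e0.
  have [p2 [x2 s2]] := @ratbox_nbhs R x.2 e e0.
  exists (p1, p2) => // y [y1 y2]; apply: eU; split; [exact: s1|exact: s2].
apply: countable_bigcup_measurable_pred => p.
by apply: measurableX; exact: measurable_itv.
Qed.

Lemma open_measurable3 (U : set (pt R)) :
  open U -> measurable (U : set (mpt R)).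
Proof.
move=> oU.
pose B (p : (rat * rat) * (rat * rat) * (rat * rat)) : set (mpt R) :=
  (ratbox p.1.1 `*` ratbox p.1.2) `*` ratbox p.2.
have -> : U = \bigcup_(p in [set p | B p `<=` U]) B p.
  apply/seteqP; split=> [x Ux|x [p /= BU] Bx]; last exact: BU.
  have /nbhs_ballP[e e0 eU] : nbhs x U by exact: open_nbhs_nbhs.
  have [p1 [x1 s1]] := @ratbox_nbhs R x.1.1 e e0.
  have [p2 [x2 s2]] := @ratbox_nbhs R x.1.2 e e0.
  have [p3 [x3 s3]] := @ratbox_nbhs R x.2 e e0.
  exists (p1, p2, p3) => // y [[y1 y2] y3]; apply: eU; split.
    split; [exact: s1|exact: s2].
  exact: s3.
apply: countable_bigcup_measurable_pred => p.
by apply: measurableX; [apply: measurableX|]; exact: measurable_itv.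
Qed.

Lemma continuous_measurable2 (f : R * R -> R) :
  continuous f -> measurable_fun setT (f : angle R -> R).
Proof.
move=> /continuousP cf; apply: (measurability _ (RGenOpens.measurableE R)).
move=> _ [_ [a [b ->] <-]]; rewrite setTI; apply: open_measurable2.
exact/cf/interval_open.
Qed.

Lemma continuous_measurable3 (f : pt R -> R) :
  continuous f -> measurable_fun setT (f : mpt R -> R).
Proof.
move=> /continuousP cf; apply: (measurability _ (RGenOpens.measurableE R)).
move=> _ [_ [a [b ->] <-]]; rewrite setTI; apply: open_measurable3.
exact/cf/interval_open.
Qed.

Lemma continuous_fst (T U : topologicalType) : continuous (@fst T U).
Proof. by move=> x; exact: cvg_fst. Qed.

Lemma continuous_snd (T U : topologicalType) : continuous (@snd T U).
Proof. by move=> x; exact: cvg_snd. Qed.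

Lemma continuousD_fun (T : topologicalType) (f g : T -> R) :
  continuous f -> continuous g -> continuous (fun x => f x + g x).
Proof. by move=> cf cg x; apply: cvgD; [exact: cf|exact: cg]. Qed.

Lemma continuousM_fun (T : topologicalType) (f g : T -> R) :
  continuous f -> continuous g -> continuous (fun x => f x * g x).
Proof. by move=> cf cg x; apply: cvgM; [exact: cf|exact: cg]. Qed.

Lemma continuousN_fun (T : topologicalType) (f : T -> R) :
  continuous f -> continuous (fun x => - f x).
Proof. by move=> cf x; apply: cvgN; exact: cf. Qed.

Lemma continuousB_fun (T : topologicalType) (f g : T -> R) :
  continuous f -> continuous g -> continuous (fun x => f x - g x).
Proof. by move=> cf cg x; apply: cvgB; [exact: cf|exact: cg]. Qed.

Lemma continuousX_fun (T : topologicalType) (f : T -> R) n :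
  continuous f -> continuous (fun x => f x ^+ n).
Proof.
move=> cf; elim: n => [|n IH]; first by move=> x; exact: cvg_cst.
rewrite (_ : (fun x => _) = fun x => f x * f x ^+ n).
  exact: continuousM_fun.
by apply/funext => x; rewrite exprS.
Qed.

Lemma continuous_compfun (T U V : topologicalType) (f : T -> U) (g : U -> V) :
  continuous f -> continuous g -> continuous (fun x => g (f x)).
Proof. by move=> cf cg x; apply: continuous_comp; [exact: cf|exact: cg]. Qed.

Lemma continuous_pairfun (T U V : topologicalType) (f : T -> U) (g : T -> V) :
  continuous f -> continuous g -> continuous (fun x => (f x, g x)).
Proof. by move=> cf cg x; apply: cvg_pair; [exact: cf|exact: cg]. Qed.

Lemma continuous_x : continuous (fun x : pt R => x.1.1).
Proof. by apply: continuous_compfun; exact: continuous_fst. Qed.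

Lemma continuous_y : continuous (fun x : pt R => x.1.2).
Proof. by apply: continuous_compfun; [exact: continuous_fst|exact: continuous_snd]. Qed.

Lemma continuous_z : continuous (fun x : pt R => x.2).
Proof. exact: continuous_snd. Qed.

Definition nrm2 (x : pt R) : R := x.1.1 ^+ 2 + x.1.2 ^+ 2 + x.2 ^+ 2.

Lemma nrm2_ge0 x : 0 <= nrm2 x.
Proof. by rewrite /nrm2 !addr_ge0// sqr_ge0. Qed.

Lemma continuous_nrm2 : continuous nrm2.
Proof.
apply: continuousD_fun; first apply: continuousD_fun; apply: continuousX_fun.
- exact: continuous_x.
- exact: continuous_y.
- exact: continuous_z.
Qed.

Lemma ball3E : @ball3 R = [set x | nrm2 x < 1].
Proof.
have e x : (Num.sqrt (nrm2 x) < 1) = (nrm2 x < 1) by rewrite -[RHS](ltr_sqrt _ ltr01) sqrtr1.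
by apply/seteqP; split=> x; rewrite /ball3/= /enorm -/(nrm2 x) e.
Qed.

Lemma sphereE : @sphere R = [set x | nrm2 x = 1].
Proof.
apply/seteqP; split=> x; rewrite /sphere/= /enorm -/(nrm2 x).
  by move=> h; rewrite -(sqr_sqrtr (nrm2_ge0 x)) h expr1n.
by move=> ->; rewrite sqrtr1.
Qed.

Lemma measurable_ball3 : measurable (@ball3 R : set (mpt R)).
Proof.
apply: open_measurable3; rewrite ball3E.
rewrite (_ : [set _ | _] = nrm2 @^-1` [set x | x < 1])//.
by apply: open_comp; [move=> x _; exact: continuous_nrm2|exact: open_lt].
Qed.

Lemma measurable_sphere : measurable (@sphere R : set (mpt R)).
Proof.
rewrite sphereE (_ : [set _ | _] = ~` (nrm2 @^-1` [set x | x != 1])).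
  apply: measurableC; apply: open_measurable3.
  by apply: open_comp; [move=> x _; exact: continuous_nrm2|exact: open_neq].
apply/seteqP; split=> x /=; first by move=> ->; rewrite eqxx.
by move/negP; rewrite negbK => /eqP.
Qed.

(** A compact set that contains both the ball and the sphere, so that one bound of a continuous
    function serves for both integrals. *)
Definition cube : set (pt R) := (`[-1, 1] `*` `[-1, 1]) `*` `[-1, 1].

Lemma compact_cube : compact cube.
Proof.
by apply: compact_setX; [apply: compact_setX|]; exact: segment_compact.
Qed.

Lemma sqr_le1_itv (a b c : R) : a ^+ 2 + b ^+ 2 + c ^+ 2 <= 1 ->
  a \in `[-1, 1].
Proof.
move=> h; have := sqr_ge0 b; have := sqr_ge0 c.
move=> b0 c0; have a1 : a ^+ 2 <= 1 by lra.
by rewrite in_itv/=; apply/andP; split; nra.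
Qed.

Lemma nrm2_cube x : nrm2 x <= 1 -> cube x.
Proof.
rewrite /nrm2 => h; split; first split => /=.
- exact: sqr_le1_itv h.
- by apply: (@sqr_le1_itv _ x.1.1 x.2); lra.
- by apply: (@sqr_le1_itv _ x.1.1 x.1.2); lra.
Qed.

Lemma ball3_cube : @ball3 R `<=` cube.
Proof. by rewrite ball3E => x /= /ltW; exact: nrm2_cube. Qed.

Lemma sphere_cube : @sphere R `<=` cube.
Proof. by rewrite sphereE => x /= h; apply: nrm2_cube; rewrite h. Qed.

Lemma continuous_bounded_cube (f : pt R -> R) : continuous f ->
  exists2 M : R, 0 <= M & forall x, cube x -> `|f x| <= M.
Proof.
move=> cf.
have := @continuous_compact _ _ f cube (continuous_subspaceT cf) compact_cube.
move=> /compact_bounded[M [Mr MP]].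
exists (`|M| + 1); first by rewrite addr_ge0.
move=> x cx; apply: (MP (`|M| + 1)).
  by rewrite (le_lt_trans (ler_norm M))// ltrDl.
by exists x.
Qed.

Lemma leb3_ball_fin : (leb3 R (@ball3 R) < +oo)%E.
Proof.
apply: (@le_lt_trans _ _ (leb3 R (cube : set (mpt R)))).
  apply: le_measure; rewrite ?inE; last exact: ball3_cube.
  - exact: measurable_ball3.
  - by apply: measurableX; [apply: measurableX|]; exact: measurable_itv.
rewrite /cube leb3_setX ?lebesgue_measure_itv//=; try exact: measurable_itv.
by case: ifP => _; rewrite ?mule0 -?EFinD -?EFinM ?ltry.
Qed.

Lemma continuous_integrable_ball (f : pt R -> R) : continuous f ->
  (leb3 R).-integrable (@ball3 R) (EFin \o f).
Proof.
move=> cf; apply: measurable_bounded_integrable.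
- exact: measurable_ball3.
- exact: leb3_ball_fin.
- by apply: measurable_funTS; exact: continuous_measurable3.
- have [M M0 MP] := continuous_bounded_cube cf.
  exists M; split=> [|y My x Bx]; first exact: num_real.
  exact: le_trans (MP _ (ball3_cube Bx)) (ltW My).
Qed.

(** The density [sin] is at most 1, so the area is bounded by that of the rectangle of angles. *)
Lemma surface_sphere_fin : (dS R (@sphere R) < +oo)%E.
Proof.
rewrite /dS/= /surface.
have mA : measurable (@angles R `&` @spherical R @^-1` (@sphere R)).
  apply: measurableI; first exact: measurable_angles.
  rewrite -[X in measurable X]setTI; apply: measurable_spherical => //.
  exact: measurable_sphere.
apply: (@le_lt_trans _ _ (leb2 R (@angles R `&` @spherical R @^-1` (@sphere R)))).
  rewrite -[leRHS]mul1e -integral_cst//.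
  apply: ge0_le_integral => //.
  - by move=> a [[a1 _] _]; rewrite lee_fin sin_ge0_pi.
  - apply/measurable_EFinP; apply: measurable_funTS.
    apply: (measurableT_comp _ measurable_fst).
    by apply: continuous_measurable_fun; exact: continuous_sin.
  - by move=> a _; rewrite lee_fin sin_le1.
apply: (@le_lt_trans _ _ (leb2 R (@angles R))).
  by apply: le_measure; rewrite ?inE//; exact: measurable_angles.
have -> : @angles R = `[0, pi]%classic `*` `[0, 2 * pi]%classic.
  by apply/seteqP; split=> -[a b] /=; rewrite !in_itv.
rewrite leb2_setX; try exact: measurable_itv.
by rewrite !lebesgue_measure_itv/=; do 2 case: ifP => _; rewrite ?mul0e ?mule0 -?EFinD -?EFinM ?ltry.
Qed.

Lemma continuous_integrable_sphere (f : pt R -> R) : continuous f ->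
  (dS R).-integrable (@sphere R) (EFin \o f).
Proof.
move=> cf; apply: measurable_bounded_integrable.
- exact: measurable_sphere.
- exact: surface_sphere_fin.
- by apply: measurable_funTS; exact: continuous_measurable3.
- have [M M0 MP] := continuous_bounded_cube cf.
  exists M; split=> [|y My x Bx]; first exact: num_real.
  exact: le_trans (MP _ (sphere_cube Bx)) (ltW My).
Qed.

End measurability.

(** * One-dimensional integrals *)

Section calculus1.
Context {R : realType}.
Local Notation mu := (@lebesgue_measure R).

Lemma continuous_integrable_itv (f : R -> R) (a b : R) : continuous f ->
  mu.-integrable `[a, b] (EFin \o f).
Proof.
move=> cf; apply: continuous_compact_integrable; first exact: segment_compact.
exact: continuous_subspaceT.
Qed.

Lemma integral_EFin_itv (f : R -> R) (a b : R) : continuous f ->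
  (\int[mu]_(x in `[a, b]) (f x)%:E)%E = (\int[mu]_(x in `[a, b]) f x)%:E.
Proof.
move=> cf; rewrite fineK//; apply: integrable_fin_num => //.
exact: continuous_integrable_itv.
Qed.

Lemma integral_derive_itv (F f : R -> R) (a b : R) : a <= b -> continuous f ->
  (forall x, a <= x <= b -> is_derive x 1 F (f x)) ->
  \int[mu]_(x in `[a, b]) f x = F b - F a.
Proof.
rewrite le_eqVlt => /predU1P[-> _ _|ab cf dF].
  by rewrite set_itv1 Rintegral_set1 subrr.
have cF x : a <= x <= b -> {for x, continuous F}.
  move=> axb; apply: differentiable_continuous; apply/derivable1_diffP.
  by have [] := dF _ axb.
rewrite /Rintegral (@continuous_FTC2 _ f F)//.
- exact: continuous_subspaceT.
- split.
  + move=> x; rewrite in_itv/= => /andP[ax xb].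
    by have [] := dF x; rewrite ?(ltW ax) ?(ltW xb).
  + by apply: cvg_at_right_filter; apply: cF; rewrite lexx ltW.
  + by apply: cvg_at_left_filter; apply: cF; rewrite lexx ltW.
- move=> x; rewrite in_itv/= => /andP[ax xb].
  have h : a <= x <= b by rewrite (ltW ax) (ltW xb).
  by rewrite derive1E; have [_ ->] := dF x h.
Qed.

(** The derivative is obtained strictly to the right of [a], so [a] is taken to the left of the
    interval of interest; this is the origin of the bounds [a - 1], [- pi] and [- s - 1] below. *)
Lemma antiderivative (f : R -> R) (a : R) : continuous f ->
  exists F : R -> R, forall x, a < x -> is_derive x 1 F (f x).
Proof.
move=> cf; exists (fun x => \int[mu]_(t in `[a, x]) f t) => x ax.
have [] := @continuous_FTC1_closed R f a x (x + 1) _ _ ax (cf x).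
- by rewrite ltrDl.
- exact: continuous_integrable_itv.
- move=> dF dFE; exact: (DeriveDef dF (etrans (esym (derive1E _ _)) dFE)).
Qed.

(** [F \o G] is a primitive of the integrand whether [G] increases or decreases; orientation enters
    only when the increment of [F] is read back as an integral. *)
Lemma integral_comp_itv (K G g : R -> R) (A a b : R) :
  continuous K -> continuous g -> (forall t : R, is_derive t 1 G (g t)) ->
  (forall t, A < G t) -> a <= b ->
  exists F : R -> R, (forall x, A < x -> is_derive x 1 F (K x)) /\
    \int[mu]_(t in `[a, b]) (K (G t) * g t) = F (G b) - F (G a).
Proof.
move=> cK cg dG AG ab; have [F dF] := antiderivative A cK.
have cG : continuous G.
  move=> t; apply: differentiable_continuous; apply/derivable1_diffP.
  by have [] := dG t.
have cKG : continuous (fun t => K (G t) * g t).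
  by apply: continuousM_fun => //; exact: continuous_compfun.
have dFG t : a <= t <= b -> is_derive t 1 (F \o G) (K (G t) * g t).
  move=> _; have d2 := dF (G t) (AG t).
  exact: (@is_derive1_comp _ F G t _ _ d2 (dG t)).
by exists F; split=> //; rewrite (integral_derive_itv ab cKG dFG).
Qed.

Lemma integral_derive_gt (F f : R -> R) (A a b : R) : continuous f ->
  (forall x, A < x -> is_derive x 1 F (f x)) -> A < a -> a <= b ->
  \int[mu]_(x in `[a, b]) f x = F b - F a.
Proof.
move=> cf dF Aa ab; have dF' x : a <= x <= b -> is_derive x 1 F (f x).
  by move=> /andP[ax _]; apply: dF; exact: lt_le_trans ax.
exact: (integral_derive_itv ab cf dF').
Qed.

Lemma integral_comp_incr (K G g : R -> R) (A a b : R) :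
  continuous K -> continuous g -> (forall t : R, is_derive t 1 G (g t)) ->
  (forall t, A < G t) -> a <= b -> G a <= G b ->
  \int[mu]_(t in `[a, b]) (K (G t) * g t) = \int[mu]_(x in `[G a, G b]) K x.
Proof.
move=> cK cg dG AG ab Gab.
have [F [dF ->]] := integral_comp_itv cK cg dG AG ab.
by rewrite (integral_derive_gt cK dF (AG a) Gab).
Qed.

Lemma integral_comp_decr (K G g : R -> R) (A a b : R) :
  continuous K -> continuous g -> (forall t : R, is_derive t 1 G (g t)) ->
  (forall t, A < G t) -> a <= b -> G b <= G a ->
  \int[mu]_(t in `[a, b]) (K (G t) * g t) = - \int[mu]_(x in `[G b, G a]) K x.
Proof.
move=> cK cg dG AG ab Gab.
have [F [dF ->]] := integral_comp_itv cK cg dG AG ab.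
by rewrite (integral_derive_gt cK dF (AG b) Gab) opprB.
Qed.

Lemma Rintegral_itv_split (f : R -> R) (a b c : R) : continuous f ->
  a <= b -> b <= c ->
  \int[mu]_(x in `[a, c]) f x =
  \int[mu]_(x in `[a, b]) f x + \int[mu]_(x in `[b, c]) f x.
Proof.
move=> cf ab bc; have [F dF] := antiderivative (a - 1) cf.
have a1 : a - 1 < a by rewrite ltrBlDr ltrDl.
rewrite (integral_derive_gt cf dF a1 (le_trans ab bc)).
rewrite (integral_derive_gt cf dF a1 ab).
rewrite (integral_derive_gt cf dF (lt_le_trans a1 ab) bc).
lra.
Qed.

Lemma Rintegral_shift (f : R -> R) (a b c : R) : continuous f -> a <= b ->
  \int[mu]_(x in `[a, b]) f (x + c) = \int[mu]_(x in `[a + c, b + c]) f x.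
Proof.
move=> cf ab; have [F dF] := antiderivative (a + c - 1) cf.
have cfc : continuous (fun x => f (x + c)).
  apply: continuous_compfun cf => x.
  by apply: cvgD; [exact: cvg_id|exact: cvg_cst].
have dFc x : a <= x <= b -> is_derive x 1 (F \o (fun x => x + c)) (f (x + c)).
  move=> /andP[ax _]; have dF' := dF (x + c) ltac:(lra).
  have d1 : is_derive x 1 (fun x : R => x + c) 1.
    by apply: is_derive_eq; rewrite addr0.
  rewrite -[f _]mulr1.
  exact: (@is_derive1_comp _ F (fun x => x + c) x _ _ dF' d1).
rewrite (integral_derive_itv ab cfc dFc) (integral_derive_gt cf dF)//=.
- by rewrite ltrBlDr ltrDl.
- by rewrite lerD2r.
Qed.

Lemma Rintegral_reflect (f : R -> R) (a b c : R) : continuous f -> a <= b ->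
  \int[mu]_(x in `[a, b]) f (c - x) = \int[mu]_(x in `[c - b, c - a]) f x.
Proof.
move=> cf ab; have [F dF] := antiderivative (c - b - 1) cf.
have cfc : continuous (fun x => f (c - x)).
  apply: continuous_compfun cf => x.
  by apply: cvgB; [exact: cvg_cst|exact: cvg_id].
have dFc x : a <= x <= b ->
    is_derive x 1 (- (F \o (fun x => c - x))) (f (c - x)).
  move=> /andP[_ ax]; have dF' := dF (c - x) ltac:(lra).
  have d1 : is_derive x 1 (fun x : R => c - x) (-1).
    by apply: is_derive_eq; rewrite add0r mul1r.
  have dd : is_derive x 1 (F \o (fun x => c - x)) (f (c - x) * -1).
    exact: (@is_derive1_comp _ F (fun x => c - x) x _ _ dF' d1).
  by have := is_deriveN dd; rewrite mulrN1 opprK.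
rewrite (integral_derive_itv ab cfc dFc) (integral_derive_gt cf dF)//=.
- by rewrite opprK addrC.
- by rewrite ltrBlDr ltrDl.
- by rewrite lerD2l lerN2.
Qed.

Lemma RintegralD_itv (f g : R -> R) (a b : R) : continuous f -> continuous g ->
  \int[mu]_(x in `[a, b]) (f x + g x) =
  \int[mu]_(x in `[a, b]) f x + \int[mu]_(x in `[a, b]) g x.
Proof.
by move=> cf cg; rewrite RintegralD//; exact: continuous_integrable_itv.
Qed.

(* Slicing the disc by horizontal chords pairs phi with pi - phi. *)
Lemma Rintegral_period_chordx (h : R -> R) : continuous h ->
  (forall t, h (t + 2 * pi) = h t) ->
  \int[mu]_(t in `[0, 2 * pi]) h t =
  \int[mu]_(t in `[- (pi / 2), pi / 2]) (h t + h (pi - t)).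
Proof.
move=> ch per; have p0 := @pi_gt0 R.
have cs : continuous (fun t => h (pi - t)).
  by apply: continuous_compfun ch => x; apply: cvgB; [exact: cvg_cst|exact: cvg_id].
rewrite RintegralD_itv// Rintegral_reflect//; try lra.
rewrite (_ : pi - pi / 2 = pi / 2); last by lra.
rewrite -Rintegral_itv_split//; try lra.
rewrite (@Rintegral_itv_split h (- (pi / 2)) 0 (pi - - (pi / 2)))//; try lra.
rewrite (@Rintegral_itv_split h 0 (pi - - (pi / 2)) (2 * pi))//; try lra.
rewrite [LHS]addrC; congr (_ + _).
under [RHS]eq_Rintegral do rewrite -per.
rewrite Rintegral_shift//; try lra.
rewrite add0r (_ : - (pi / 2) + 2 * pi = pi - - (pi / 2))//; lra.
Qed.

(** Vertical chords of the disc join the angles phi and 2 pi - phi. *)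
Lemma Rintegral_period_chordy (h : R -> R) : continuous h ->
  \int[mu]_(t in `[0, 2 * pi]) h t =
  \int[mu]_(t in `[0, pi]) (h t + h (2 * pi - t)).
Proof.
move=> ch; have p0 := @pi_gt0 R.
have cs : continuous (fun t => h (2 * pi - t)).
  by apply: continuous_compfun ch => x; apply: cvgB; [exact: cvg_cst|exact: cvg_id].
rewrite RintegralD_itv// Rintegral_reflect//; try lra.
rewrite (@Rintegral_itv_split h 0 pi (2 * pi))//; try lra.
rewrite subr0 (_ : 2 * pi - pi = pi)//; lra.
Qed.

(** The set [x^2 < c] is a chord of the ball. For c <= 0 it is empty, and [Num.sqrt c = 0] makes the
    increment of [F] vanish as well. *)
Lemma integral_sqr_lt (F f : R -> R) (c : R) : continuous f ->
  (forall x : R, is_derive x 1 F (f x)) ->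
  (\int[mu]_(x in [set x | (x ^+ 2 < c)%R]) (f x)%:E)%E =
  (F (Num.sqrt c) - F (- Num.sqrt c))%:E.
Proof.
move=> cf dF; have [c0|c0] := leP c 0.
  rewrite (ler0_sqrtr c0) oppr0 subrr.
  rewrite (_ : [set x | _] = set0) ?integral_set0//.
  by apply/seteqP; split=> // x /=; have := sqr_ge0 x; lra.
set s := Num.sqrt c; have s0 : 0 < s by rewrite sqrtr_gt0.
have sc : s ^+ 2 = c by rewrite sqr_sqrtr// ltW.
have mf : measurable_fun setT (fun x => (f x)%:E).
  by apply/measurable_EFinP; exact: continuous_measurable_fun.
rewrite (_ : [set x | _] = `](- s), s[%classic); last first.
  apply/seteqP; split=> x /=; rewrite in_itv/= -sc.
    by move=> h; apply/andP; split; nra.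
  by move=> /andP[h1 h2]; nra.
rewrite integral_itv_obnd_cbnd; last exact: measurable_funTS.
rewrite integral_itv_bndo_bndc; last exact: measurable_funTS.
rewrite integral_EFin_itv//; congr EFin.
have ss : - s <= s by rewrite -subr_ge0 opprK addr_ge0// ltW.
exact: (integral_derive_itv ss cf (fun x _ => dF x)).
Qed.

Lemma continuous_sqrt_fun (T : topologicalType) (f : T -> R) :
  continuous f -> continuous (fun x => Num.sqrt (f x)).
Proof. by move=> cf; apply: continuous_compfun cf _; exact: sqrt_continuous. Qed.

Lemma continuous_cst_fun (T U : topologicalType) (c : U) :
  continuous (fun _ : T => c).
Proof. by move=> x; exact: cvg_cst. Qed.

Lemma continuous_id_fun (T : topologicalType) : continuous (fun x : T => x).
Proof. by move=> x; exact: cvg_id. Qed.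

Lemma integral_setT_itv (f : R -> R) (s : R) :
  (forall x, s < `|x| -> f x = 0) ->
  (\int[mu]_x (f x)%:E)%E = (\int[mu]_(x in `[(- s)%R, s]) (f x)%:E)%E.
Proof.
move=> fs; rewrite [RHS]integral_mkcond; apply: eq_integral => x _.
rewrite patchE; case: ifPn => //; rewrite notin_setE/= in_itv/= -ler_norml.
by move/negP; rewrite -ltNge => /fs ->.
Qed.

End calculus1.

(** * Polar coordinates in the disc *)

Section fubini_setX.
Local Open Scope ereal_scope.
Context d1 d2 (T1 : measurableType d1) (T2 : measurableType d2) {R : realType}.
Variables (m1 : {sigma_finite_measure set T1 -> \bar R})
  (m2 : {sigma_finite_measure set T2 -> \bar R}).
Variables (A : set T1) (B : set T2) (f : T1 * T2 -> \bar R).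
Hypotheses (mA : measurable A) (mB : measurable B).

Let patch1 x : \int[m2]_y (f \_ (A `*` B)) (x, y) =
  ((fun x => \int[m2]_(y in B) f (x, y)) \_ A) x.
Proof.
rewrite patchE; case: ifPn => xA.
  rewrite [RHS]integral_mkcond; apply: eq_integral => y _.
  by rewrite !patchE in_setX/= xA.
apply: integral0_eq => y _.
by rewrite patchE in_setX/= (negbTE xA).
Qed.

Let patch2 y : \int[m1]_x (f \_ (A `*` B)) (x, y) =
  ((fun y => \int[m1]_(x in A) f (x, y)) \_ B) y.
Proof.
rewrite patchE; case: ifPn => yB.
  rewrite [RHS]integral_mkcond; apply: eq_integral => x _.
  by rewrite !patchE in_setX/= yB andbT.
apply: integral0_eq => x _.
by rewrite patchE in_setX/= (negbTE yB) andbF.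
Qed.

Lemma ge0_fubini_setX : measurable_fun setT f -> (forall p, 0 <= f p) ->
  \int[m1]_(x in A) \int[m2]_(y in B) f (x, y) =
  \int[m2]_(y in B) \int[m1]_(x in A) f (x, y).
Proof.
move=> mf f0; have mAB := measurableX mA mB.
rewrite integral_mkcond [RHS]integral_mkcond.
under eq_integral do rewrite -patch1.
under [RHS]eq_integral do rewrite -patch2.
apply: fubini_tonelli.
  by apply/(measurable_restrictT _ _).1 => //; exact: measurable_funTS.
by move=> p; apply: erestrict_ge0 => q _; exact: f0.
Qed.

Lemma fubini_setX1 : (m1 \x m2).-integrable (A `*` B) f ->
  \int[m1 \x m2]_(p in A `*` B) f p = \int[m1]_(x in A) \int[m2]_(y in B) f (x, y).
Proof.
move=> /(integrable_mkcond _ (measurableX mA mB)) fi.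
rewrite integral_mkcond [RHS]integral_mkcond.
under [RHS]eq_integral do rewrite -patch1.
exact/esym/integral12_prod_meas1.
Qed.

Lemma fubini_setX2 : (m1 \x m2).-integrable (A `*` B) f ->
  \int[m1 \x m2]_(p in A `*` B) f p = \int[m2]_(y in B) \int[m1]_(x in A) f (x, y).
Proof.
move=> /(integrable_mkcond _ (measurableX mA mB)) fi.
rewrite integral_mkcond [RHS]integral_mkcond.
under [RHS]eq_integral do rewrite -patch2.
exact/esym/integral21_prod_meas1.
Qed.

End fubini_setX.

Section polar.
Context {R : realType}.
Local Notation mu := (@lebesgue_measure R).

Lemma is_derive_scale_sin (s t : R) :
  is_derive t 1 (fun t => s * sin t) (s * cos t).
Proof. by apply: is_derive_eq. Qed.

Lemma is_derive_scale_cos (s t : R) :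
  is_derive t 1 (fun t => s * cos t) (- (s * sin t)).
Proof. by apply: is_derive_eq; rewrite -mulrN. Qed.

Lemma continuous_scale_sin (s : R) : continuous (fun t => s * sin t).
Proof.
by apply: continuousM_fun; [exact: continuous_cst_fun|exact: continuous_sin].
Qed.

Lemma continuous_scale_cos (s : R) : continuous (fun t => s * cos t).
Proof.
by apply: continuousM_fun; [exact: continuous_cst_fun|exact: continuous_cos].
Qed.

Lemma scale_sin_gt (s t : R) : 0 <= s -> - s - 1 < s * sin t.
Proof. by move=> s0; have := sin_geN1 t; nra. Qed.

Lemma scale_cos_gt (s t : R) : 0 <= s -> - s - 1 < s * cos t.
Proof. by move=> s0; have := cos_geN1 t; nra. Qed.

Lemma cos_piB (t : R) : cos (pi - t) = - cos t.
Proof. by rewrite cosB cospi sinpi mulN1r mul0r addr0. Qed.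

Lemma sin_piB (t : R) : sin (pi - t) = sin t.
Proof. by rewrite sinB cospi sinpi mulN1r mul0r sub0r opprK. Qed.

Lemma pi2E : 2 * pi = pi *+ 2 :> R.
Proof. by rewrite mulr_natl. Qed.

Lemma cos_2piB (t : R) : cos (2 * pi - t) = cos t.
Proof. by rewrite pi2E addrC cosD2pi cosN. Qed.

Lemma sin_2piB (t : R) : sin (2 * pi - t) = - sin t.
Proof. by rewrite pi2E addrC sinD2pi sinN. Qed.

Lemma cos_2piD (t : R) : cos (t + 2 * pi) = cos t.
Proof. by rewrite pi2E cosD2pi. Qed.

Lemma sin_2piD (t : R) : sin (t + 2 * pi) = sin t.
Proof. by rewrite pi2E sinD2pi. Qed.

Lemma sqrt_lt_norm (c y : R) : Num.sqrt c < `|y| -> Num.sqrt (c - y ^+ 2) = 0.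
Proof.
move=> h; apply: ler0_sqrtr; have [c0|c0] := leP c 0.
  by have := sqr_ge0 y; lra.
have sc := sqr_sqrtr (ltW c0); have s0 := sqrtr_ge0 c.
have := real_normK (num_real y); nra.
Qed.

(** Half the length of a chord of the circle of radius [Num.sqrt c]; for c <= 0 both sides are 0. *)
Lemma sqrt_sub_sqr (c x y : R) : 0 <= y -> x ^+ 2 + y ^+ 2 = 1 ->
  Num.sqrt (c - (Num.sqrt c * x) ^+ 2) = Num.sqrt c * y.
Proof.
move=> y0 xy; have [c0|c0] := leP c 0.
  rewrite (ler0_sqrtr c0) !mul0r expr0n/= subr0; exact: ler0_sqrtr.
have sc := sqr_sqrtr (ltW c0); have s0 := sqrtr_ge0 c.
have -> : c - (Num.sqrt c * x) ^+ 2 = (Num.sqrt c * y) ^+ 2.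
  by rewrite !exprMn sc; nra.
by rewrite sqrtr_sqr ger0_norm// mulr_ge0.
Qed.

Section chords.
Variables (k : R * R -> R) (c : R).
Hypothesis ck : continuous k.
Let s := Num.sqrt c.
Let s0 : 0 <= s. Proof. exact: sqrtr_ge0. Qed.

Let ch (w : R -> R) : continuous w -> 
  continuous (fun t => k (s * cos t, s * sin t) * w t).
Proof.
move=> cw; apply: continuousM_fun => //.
apply: continuous_compfun ck; apply: continuous_pairfun.
  exact: continuous_scale_cos.
exact: continuous_scale_sin.
Qed.

Let cq : continuous (fun y : R => Num.sqrt (c - y ^+ 2)).
Proof.
apply: continuous_sqrt_fun; apply: continuousB_fun.
  exact: continuous_cst_fun.
by apply: continuousX_fun; exact: continuous_id_fun.
Qed.

(** Both sides are the integral of k dy around the circle of radius [s], with y = s sin t and dy = s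
    cos t dt. The angles t in [- pi/2, pi/2] describe the right ends of the horizontal chords, and
    pi - t the left ends, where the cosine changes sign. *)
Lemma integral_chordx :
  (\int[mu]_y (k (Num.sqrt (c - y ^+ 2), y) - k (- Num.sqrt (c - y ^+ 2), y))%:E)%E =
  (\int[mu]_(t in `[0%R, (2 * pi)%R]) (k (s * cos t, s * sin t) * (s * cos t))%:E)%E.
Proof.
pose D y := k (Num.sqrt (c - y ^+ 2), y) - k (- Num.sqrt (c - y ^+ 2), y).
rewrite -[LHS]/(\int[mu]_y (D y)%:E)%E.
have cD : continuous D.
  apply: continuousB_fun; apply: continuous_compfun ck; apply: continuous_pairfun => //;
    try exact: continuous_id_fun.
  exact: continuousN_fun.
rewrite (@integral_setT_itv _ D s); last first.
  by move=> y /sqrt_lt_norm h; rewrite /D h oppr0 subrr.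
have p0 := @pi_gt0 R.
have cc := @continuous_scale_cos s.
rewrite !integral_EFin_itv//; last exact: ch.
congr EFin; rewrite Rintegral_period_chordx; [|exact: ch|]; last first.
  by move=> t; rewrite cos_2piD sin_2piD.
have := @integral_comp_incr _ D (fun t => s * sin t) (fun t => s * cos t)
  (- s - 1) (- (pi / 2)) (pi / 2) cD cc (is_derive_scale_sin s).
rewrite sinN sin_pihalf mulrN mulr1 => <-//; last 3 first.
- by move=> t; exact: scale_sin_gt.
- by lra.
- by rewrite -subr_ge0 opprK addr_ge0.
apply: eq_Rintegral => t; rewrite inE/= in_itv/= => tpi.
have ct := cos_ge0_pihalf tpi.
rewrite /D (sqrt_sub_sqr _ ct) ?(addrC (sin t ^+ 2)) ?cos2Dsin2//.
by rewrite -/s cos_piB sin_piB mulrBl !mulrN.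
Qed.

(** The upper ends of the vertical chords correspond to t in [0, pi], the lower ones to 2 pi - t. As
    x = s cos t decreases on [0, pi], the substitution reverses the orientation, hence the sign in
    [e]. *)
Lemma integral_chordy :
  (\int[mu]_x (k (x, Num.sqrt (c - x ^+ 2)) - k (x, - Num.sqrt (c - x ^+ 2)))%:E)%E =
  (\int[mu]_(t in `[0%R, (2 * pi)%R]) (k (s * cos t, s * sin t) * (s * sin t))%:E)%E.
Proof.
pose D x := k (x, Num.sqrt (c - x ^+ 2)) - k (x, - Num.sqrt (c - x ^+ 2)).
rewrite -[LHS]/(\int[mu]_x (D x)%:E)%E.
have cD : continuous D.
  apply: continuousB_fun; apply: continuous_compfun ck; apply: continuous_pairfun => //;
    try exact: continuous_id_fun.
  exact: continuousN_fun.
rewrite (@integral_setT_itv _ D s); last first.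
  by move=> y /sqrt_lt_norm h; rewrite /D h oppr0 subrr.
have p0 := @pi_gt0 R.
have cs := @continuous_scale_sin s.
rewrite !integral_EFin_itv//; last exact: ch.
congr EFin; rewrite Rintegral_period_chordy; last exact: ch.
have e : \int[mu]_(t in `[0, pi]) (D (s * cos t) * - (s * sin t)) =
    - \int[mu]_(x in `[- s, s]) D x.
  have := @integral_comp_decr _ D (fun t => s * cos t) (fun t => - (s * sin t))
    (- s - 1) 0 pi cD (continuousN_fun cs) (is_derive_scale_cos s).
  rewrite cos0 cospi mulrN mulr1; apply => //.
  - by move=> t; exact: scale_cos_gt.
  - by lra.
  - by rewrite -subr_ge0 opprK addr_ge0.
rewrite -[LHS]opprK -e.
rewrite -[LHS]mulN1r -RintegralZl//; last first.
  apply: continuous_integrable_itv; apply: continuousM_fun.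
    by apply: continuous_compfun cD; exact: continuous_scale_cos.
  exact: continuousN_fun.
apply: eq_Rintegral => t; rewrite inE/= in_itv/= => tpi.
have st := sin_ge0_pi tpi.
rewrite /D (sqrt_sub_sqr _ st) ?cos2Dsin2//.
by rewrite -/s cos_2piB sin_2piB !mulrN; ring.
Qed.

End chords.

Lemma ge0_integral_reflect (f : R -> R) : continuous f -> (forall x, 0 <= f x) ->
  (\int[mu]_x (f x)%:E =
   \int[mu]_(x in `[0%R, +oo[) (f x)%:E + \int[mu]_(x in `[0%R, +oo[) (f (- x))%:E)%E.
Proof.
move=> cf f0.
have mf := continuous_measurable_fun cf.
rewrite -(setUv `[0%R, +oo[%classic) ge0_integral_setU//=; last 4 first.
- exact: measurableC.
- by apply/measurable_EFinP; rewrite setUv.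
- by move=> x _; rewrite lee_fin.
- exact/disj_setPCl.
congr (_ + _)%E; rewrite setCitvr.
rewrite integral_itv_bndo_bndc; last by apply/measurable_EFinP/measurable_funTS.
rewrite -{1}oppr0 ge0_integration_by_substitutionNy//.
exact: continuous_subspaceT.
Qed.

(** The fundamental theorem is applied on each half-line to [F \o atan], whose limit at infinity is
    [F (pi / 2)]. In polar coordinates the angle will be atan (y / x). *)
Lemma ge0_integral_atan (h : R -> R) : continuous h -> (forall x, 0 <= h x) ->
  (\int[mu]_t (h (atan t) / (1 + t ^+ 2))%:E =
   \int[mu]_(t in `[(- (pi / 2))%R, (pi / 2)%R]) (h t)%:E)%E.
Proof.
have pos (t : R) : 0 < 1 + t ^+ 2 by have := sqr_ge0 t; lra.
have half (g : R -> R) : continuous g -> (forall x, 0 <= g x) ->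
  (\int[mu]_(t in `[0%R, +oo[) (g (atan t) / (1 + t ^+ 2))%:E =
   \int[mu]_(t in `[0%R, (pi / 2)%R]) (g t)%:E)%E.
  move=> cg g0; have [F dF] := antiderivative (- pi) cg.
  have p0 := @pi_gt0 R.
  have pi2 : 0 <= pi / 2 :> R by lra.
  have Npi0 : - pi < 0 :> R by lra.
  rewrite integral_EFin_itv// (integral_derive_gt cg dF Npi0 pi2).
  have dFa (t : R) : is_derive t 1 (F \o atan) (g (atan t) * (1 + t ^+ 2)^-1).
    have d1 := dF (atan t) ltac:(have := atan_gtNpi2 t; lra).
    have d2 : is_derive t 1 atan (1 + t ^+ 2)^-1.
      apply: DeriveDef; first exact: derivable_atan.
      by rewrite -derive1E derive1_atan.
    exact: (@is_derive1_comp _ F atan t _ _ d1 d2).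
  have cF (t : R) : {for t, continuous (F \o atan)}.
    apply: differentiable_continuous; apply/derivable1_diffP.
    by have [] := dFa t.
  rewrite (@ge0_continuous_FTC2y _ _ (F \o atan) 0 (F (pi / 2)))//.
  - by rewrite /= atan0.
  - by move=> x _; rewrite divr_ge0// ltW.
  - apply: continuous_subspaceT; apply: continuousM_fun.
      by apply: continuous_compfun cg => x; exact: continuous_atan.
    exact: continuous_oneDsqrV.
  - apply: (@cvg_comp _ _ _ atan F _ (nbhs (pi / 2))); first exact: cvgy_atan.
    have [dF1 _] := dF (pi / 2) ltac:(lra).
    by move/derivable1_diffP : dF1 => /differentiable_continuous.
  - by apply: cvg_at_right_filter; exact: cF.
  - by move=> x _; rewrite derive1E; have [_ ->] := dFa x.
move=> ch h0; have p0 := @pi_gt0 R.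
have cNh : continuous (fun t => h (- t)).
  by apply: continuous_compfun ch; apply: continuousN_fun; exact: continuous_id_fun.
rewrite ge0_integral_reflect; last 2 first.
- apply: continuousM_fun.
    by apply: continuous_compfun ch => x; exact: continuous_atan.
  exact: continuous_oneDsqrV.
- by move=> x; rewrite divr_ge0// ltW.
under [in X in (_ + X)%E]eq_integral do rewrite atanN sqrrN.
rewrite half// (half (fun t => h (- t)))// !integral_EFin_itv// -EFinD; congr EFin.
have -> : \int[mu]_(x in `[0, pi / 2]) h (- x) = \int[mu]_(x in `[- (pi / 2), 0]) h x.
  under eq_Rintegral do rewrite -sub0r.
  by rewrite Rintegral_reflect ?sub0r ?subr0 ?oppr0//; lra.
by rewrite addrC -Rintegral_itv_split//; lra.
Qed.

Lemma ge0_integral_scale (h : R -> R) (c : R) : 0 < c -> continuous h ->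
  (forall x, 0 <= x -> 0 <= h x) ->
  (\int[mu]_(x in `[0%R, +oo[) (h x)%:E =
   \int[mu]_(x in `[0%R, +oo[) (h (c * x) * c)%:E)%E.
Proof.
move=> c0 ch h0.
have dc (x : R) : is_derive x 1 ( *%R c) c.
  by apply: is_derive_eq; rewrite /GRing.scale/= mulr1.
have dcE : derive1 ( *%R c : R -> R) = cst c.
  by apply/funext => x; rewrite derive1E; have [_ ->] := dc x.
have := @increasing_ge0_integration_by_substitutiony R ( *%R c) h 0.
rewrite mulr0 dcE; apply.
- by move=> x y _ _ xy; rewrite ltr_pM2l.
- by move=> x _; exact: cvg_cst.
- exact: is_cvg_cst.
- exact: is_cvg_cst.
- split; first by move=> x _; have [] := dc x.
  apply: cvg_at_right_filter.
  by apply: (@continuousM_fun R R (fun=> c) id); [exact: continuous_cst_fun|exact: continuous_id_fun].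
- exact: gt0_cvgMry.
- exact: continuous_subspaceT.
- by move=> x; rewrite in_itv/= andbT => /ltW; exact: h0.
Qed.

Lemma ge0_integral_scaleT (h : R -> R) (c : R) : 0 < c -> continuous h ->
  (forall x, 0 <= h x) ->
  (\int[mu]_x (h x)%:E = \int[mu]_x (h (c * x) * c)%:E)%E.
Proof.
move=> c0 ch h0.
have cNh : continuous (fun t => h (- t)).
  by apply: continuous_compfun ch; apply: continuousN_fun; exact: continuous_id_fun.
rewrite ge0_integral_reflect// (ge0_integral_scale c0 ch)//.
rewrite (ge0_integral_scale c0 cNh)//.
rewrite [RHS]ge0_integral_reflect//.
- by congr (_ + _)%E; apply: eq_integral => x _; rewrite mulrN.
- apply: continuousM_fun; last exact: continuous_cst_fun.
  apply: continuous_compfun ch; apply: continuousM_fun; last exact: continuous_id_fun.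
  exact: continuous_cst_fun.
- by move=> x; rewrite mulr_ge0// ltW.
Qed.

Lemma continuous_section1 (G : R * R -> R) (x : R) : continuous G ->
  continuous (fun y => G (x, y)).
Proof.
move=> cG; apply: continuous_compfun cG; apply: continuous_pairfun.
  exact: continuous_cst_fun.
exact: continuous_id_fun.
Qed.

Lemma continuous_section2 (G : R * R -> R) (y : R) : continuous G ->
  continuous (fun x => G (x, y)).
Proof.
move=> cG; apply: continuous_compfun cG; apply: continuous_pairfun.
  exact: continuous_id_fun.
exact: continuous_cst_fun.
Qed.

Lemma continuous_measurable2E (G : R * R -> R) : continuous G ->
  measurable_fun setT (fun p : angle R => (G p)%:E).
Proof. by move=> cG; apply/measurable_EFinP; exact: continuous_measurable2. Qed.

Lemma sin_atan (t : R) : sin (atan t) = cos (atan t) * t.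
Proof.
rewrite -[X in _ * X](atanK t) /tan mulrC divfK//.
rewrite gt_eqF// cos_atan invr_gt0 sqrtr_gt0.
by have := sqr_ge0 t; lra.
Qed.

Lemma sqr_cos_atan (t : R) : cos (atan t) ^+ 2 = (1 + t ^+ 2)^-1.
Proof.
by rewrite cos_atan exprVn sqr_sqrtr// addr_ge0// sqr_ge0.
Qed.

Lemma cos_atan_gt0 (t : R) : 0 < cos (atan t).
Proof.
rewrite cos_atan invr_gt0 sqrtr_gt0.
by have := sqr_ge0 t; lra.
Qed.

(** Polar coordinates in a half-plane from substitutions in one variable, with Tonelli in between: y
    = x t at fixed x, then x = r cos (atan t) at fixed t, and finally atan t as the angle. *)
Lemma ge0_polar_half (G : R * R -> R) : continuous G -> (forall p, 0 <= G p) ->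
  (\int[mu]_(x in `]0%R, +oo[) \int[mu]_y (G (x, y))%:E =
   \int[mu]_(r in `]0%R, +oo[) \int[mu]_(t in `[(- (pi / 2))%R, (pi / 2)%R])
      (G (r * cos t, r * sin t) * r)%:E)%E.
Proof.
move=> cG G0.
(* The positive part of x: it makes the integrands continuous and nonnegative on the whole plane, as
   Tonelli asks, and changes nothing for x > 0. *)
pose N (x : R) := (`|x| + x) / 2.
have N0 x : 0 <= N x by rewrite /N; have := ler_norm (- x); rewrite normrN; lra.
have NE x : 0 <= x -> N x = x by move=> x0; rewrite /N ger0_norm//; lra.
have cN : continuous (fun p : R * R => N p.1).
  apply: continuousM_fun; last exact: continuous_cst_fun.
  apply: continuousD_fun; last exact: continuous_fst.
  by move=> p; apply: cvg_norm; exact: cvg_fst.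
have cs : continuous (fun p : R * R => p.2) by exact: continuous_snd.
pose H (p : R * R) := G (N p.1, N p.1 * p.2) * N p.1.
have cH : continuous H.
  apply: continuousM_fun => //; apply: continuous_compfun cG.
  by apply: continuous_pairfun => //; exact: continuousM_fun.
pose w t : R := cos (atan t).
have cw : continuous (fun p : R * R => w p.2).
  apply: continuous_compfun (@continuous_cos R).
  by apply: continuous_compfun cs _ => x; exact: continuous_atan.
pose M (p : R * R) := G (w p.2 * N p.1, w p.2 * N p.1 * p.2) * (w p.2 * N p.1) * w p.2.
have cM : continuous M.
  have cwN : continuous (fun p : R * R => w p.2 * N p.1) by exact: continuousM_fun.
  apply: continuousM_fun => //; apply: continuousM_fun => //.
  apply: continuous_compfun cG.
  by apply: continuous_pairfun => //; exact: continuousM_fun.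
transitivity (\int[mu]_(x in `]0%R, +oo[) \int[mu]_t (H (x, t))%:E)%E.
  apply: eq_integral => x; rewrite inE/= in_itv/= andbT => x0.
  rewrite (ge0_integral_scaleT x0)//; last exact: continuous_section1.
  by apply: eq_integral => t _; rewrite /H/= NE// ltW.
have mpos : measurable (`]0%R, +oo[%classic : set (measurableTypeR R)).
  exact: measurable_itv.
have H0 p : (0 <= (H p)%:E)%E by rewrite lee_fin mulr_ge0.
etransitivity.
  exact: (@ge0_fubini_setX _ _ (measurableTypeR R) (measurableTypeR R) _ mu mu _ _
    _ mpos measurableT (continuous_measurable2E cH) H0).
clear H0.
transitivity (\int[mu]_t \int[mu]_(r in `]0%R, +oo[) (M (r, t))%:E)%E.
  apply: eq_integral => t _.
  pose K x := G (x, x * t) * x.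
  have cid : continuous (fun x : R => x) by exact: continuous_id_fun.
  have cK : continuous K.
    apply: continuousM_fun => //; apply: continuous_compfun cG.
    apply: continuous_pairfun => //.
    by apply: continuousM_fun => //; exact: continuous_cst_fun.
  transitivity (\int[mu]_(x in `]0%R, +oo[) (K x)%:E)%E.
    apply: eq_integral => x; rewrite inE/= in_itv/= andbT => x0.
    by rewrite /H /K/= NE// ltW.
  rewrite integral_itv_obnd_cbnd; last first.
    by apply/measurable_EFinP; apply: measurable_funTS; exact: continuous_measurable_fun.
  rewrite (@ge0_integral_scale K (w t))//; [|exact: cos_atan_gt0|]; last first.
    by move=> x x0; rewrite /K mulr_ge0.
  have cKw : continuous (fun x => K (w t * x) * w t).
    apply: continuousM_fun; last exact: continuous_cst_fun.
    apply: continuous_compfun cK.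
    by apply: continuousM_fun => //; exact: continuous_cst_fun.
  rewrite -integral_itv_obnd_cbnd; last first.
    by apply/measurable_EFinP; apply: measurable_funTS; exact: continuous_measurable_fun.
  apply: eq_integral => x; rewrite inE/= in_itv/= andbT => x0.
  by rewrite /K /M/= NE// ltW.
have M0 p : (0 <= (M p)%:E)%E.
  have := cos_atan_gt0 p.2; rewrite -/(w p.2) => /ltW w0.
  rewrite lee_fin /M; apply: mulr_ge0 => //; apply: mulr_ge0 => //.
  exact: mulr_ge0.
etransitivity.
  exact/esym/(@ge0_fubini_setX _ _ (measurableTypeR R) (measurableTypeR R) _ mu mu _ _
    _ mpos measurableT (continuous_measurable2E cM) M0).
clear M0.
apply: eq_integral => r; rewrite inE/= in_itv/= andbT => /ltW r0.
rewrite -ge0_integral_atan; last 2 first.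
- apply: continuousM_fun; last exact: continuous_cst_fun.
  apply: continuous_compfun cG; apply: continuous_pairfun.
    exact: continuous_scale_cos.
  exact: continuous_scale_sin.
- by move=> x; rewrite mulr_ge0.
apply: eq_integral => t _; congr EFin.
rewrite /M/= NE// sin_atan -sqr_cos_atan -/(w t) (mulrC (w t) r) -(mulrA r).
by rewrite expr2 !mulrA.
Qed.

Lemma ge0_polar (G : R * R -> R) : continuous G -> (forall p, 0 <= G p) ->
  (\int[mu]_x \int[mu]_y (G (x, y))%:E =
   \int[mu]_(r in `]0%R, +oo[) \int[mu]_(t in `[0%R, (2 * pi)%R])
      (G (r * cos t, r * sin t) * r)%:E)%E.
Proof.
move=> cG G0.
(* Folds the left half-plane onto the right one; on angles this is t -> pi - t. *)
pose G2 (p : R * R) := G p + G (- p.1, p.2).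
have cGN : continuous (fun p : R * R => G (- p.1, p.2)).
  apply: continuous_compfun cG; apply: continuous_pairfun.
    by apply: continuousN_fun; exact: continuous_fst.
  exact: continuous_snd.
have cG2 : continuous G2 by exact: continuousD_fun.
have mc (h : R -> R) D : measurable D -> continuous h ->
    measurable_fun D (fun x => (h x)%:E).
  move=> mD ch; apply/measurable_EFinP; apply: measurable_funTS.
  exact: continuous_measurable_fun.
transitivity (\int[mu]_(x in `]0%R, +oo[) \int[mu]_y (G2 (x, y))%:E)%E.
  have mpos : measurable (`]0%R, +oo[%classic : set (measurableTypeR R)).
    exact: measurable_itv.
  have G20 p : (0 <= (G2 p)%:E)%E by rewrite lee_fin addr_ge0.
  have G0' p : (0 <= (G p)%:E)%E by rewrite lee_fin.
  etransitivity.
    exact: (@fubini_tonelli _ _ (measurableTypeR R) (measurableTypeR R) _ mu mu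
      _ (continuous_measurable2E cG) G0').
  apply/esym; etransitivity.
    exact: (@ge0_fubini_setX _ _ (measurableTypeR R) (measurableTypeR R) _ mu mu
      _ _ _ mpos measurableT (continuous_measurable2E cG2) G20).
  apply/esym; clear G20 G0'.
  apply: eq_integral => y _.
  have c1 := @continuous_section2 G y cG.
  have c2 := @continuous_section2 _ y cGN.
  rewrite ge0_integral_reflect// -!integral_itv_obnd_cbnd; [|exact: mc|exact: mc].
  have mp : measurable (`]0%R, +oo[%classic : set (measurableTypeR R)).
    exact: measurable_itv.
  rewrite -(ge0_integralD _ mp)//.
  - by move=> x _; rewrite lee_fin.
  - exact: mc mp c1.
  - by move=> x _; rewrite lee_fin.
  - exact: mc mp c2.
rewrite (ge0_polar_half cG2); last by move=> p; exact: addr_ge0.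
apply: eq_integral => r; rewrite inE/= in_itv/= andbT => /ltW r0.
pose h t := G (r * cos t, r * sin t) * r.
have ch : continuous h.
  apply: continuousM_fun; last exact: continuous_cst_fun.
  apply: continuous_compfun cG; apply: continuous_pairfun.
    exact: continuous_scale_cos.
  exact: continuous_scale_sin.
have chN : continuous (fun t => h t + h (pi - t)).
  apply: continuousD_fun => //; apply: continuous_compfun ch.
  by apply: continuousB_fun; [exact: continuous_cst_fun|exact: continuous_id_fun].
rewrite -[RHS]/(\int[mu]_(t in _) (h t)%:E)%E [RHS](integral_EFin_itv _ _ ch).
rewrite Rintegral_period_chordx//; last first.
  by move=> t; rewrite /h cos_2piD sin_2piD.
rewrite -(integral_EFin_itv _ _ chN); apply: eq_integral => t _.
by rewrite /G2 /h/= cos_piB sin_piB mulrN mulrDl.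
Qed.

End polar.

(** * Surface integrals and the divergence theorem *)

Section sphere_integral.
Context {R : realType}.
Local Notation mu := (@lebesgue_measure R).

Lemma spherical_sphere (a : angle R) : sphere (spherical a).
Proof.
rewrite sphereE/= /nrm2/= !exprMn -mulrDr cos2Dsin2 mulr1 addrC.
exact: cos2Dsin2.
Qed.

Lemma anglesE : @angles R = `[0, pi]%classic `*` `[0, 2 * pi]%classic.
Proof. by apply/seteqP; split=> -[a b] /=; rewrite !in_itv. Qed.

Lemma leb2_rect_fin (a b c d : R) : (leb2 R (`[a, b] `*` `[c, d]) < +oo)%E.
Proof.
rewrite leb2_setX; try exact: measurable_itv.
by rewrite !lebesgue_measure_itv/=; do 2 case: ifP => _;
  rewrite ?mul0e ?mule0 -?EFinD -?EFinM ?ltry.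
Qed.

Lemma measurable_rect (a b c d : R) :
  measurable (`[a, b] `*` `[c, d] : set (angle R)).
Proof. by apply: measurableX; exact: measurable_itv. Qed.

Lemma bounded_rect (g : R * R -> R) (a b c d : R) : continuous g ->
  exists2 M : R, 0 <= M & forall x, (`[a, b] `*` `[c, d])%classic x -> `|g x| <= M.
Proof.
move=> cg.
have cr : compact (`[a, b] `*` `[c, d] : set (R * R)).
  by apply: compact_setX; exact: segment_compact.
have := @continuous_compact _ _ g _ (continuous_subspaceT cg) cr.
move=> /compact_bounded[M [Mr MP]].
exists (`|M| + 1); first by rewrite addr_ge0.
move=> x cx; apply: (MP (`|M| + 1)).
  by rewrite (le_lt_trans (ler_norm M))// ltrDl.
by exists x.
Qed.

Lemma integrable_rect (g : R * R -> R) (a b c d : R) : continuous g ->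
  (leb2 R).-integrable (`[a, b] `*` `[c, d]) (EFin \o g).
Proof.
move=> cg; apply: measurable_bounded_integrable.
- exact: measurable_rect.
- exact: leb2_rect_fin.
- by apply: measurable_funTS; exact: continuous_measurable2.
- have [M M0 MP] := @bounded_rect g a b c d cg.
  exists M; split=> [|y My x Bx]; first exact: num_real.
  exact: le_trans (MP _ Bx) (ltW My).
Qed.

Lemma integral_rect1 (g : R * R -> R) (a b c d : R) : continuous g ->
  (\int[leb2 R]_(p in `[a, b] `*` `[c, d]) (g p)%:E =
   \int[mu]_(x in `[a, b]) \int[mu]_(y in `[c, d]) (g (x, y))%:E)%E.
Proof.
move=> cg; exact: (@fubini_setX1 _ _ (measurableTypeR R) (measurableTypeR R) R
  mu mu _ _ (EFin \o g) (measurable_itv _) (measurable_itv _) (integrable_rect _ _ _ _ cg)).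
Qed.

Lemma integral_rect2 (g : R * R -> R) (a b c d : R) : continuous g ->
  (\int[leb2 R]_(p in `[a, b] `*` `[c, d]) (g p)%:E =
   \int[mu]_(y in `[c, d]) \int[mu]_(x in `[a, b]) (g (x, y))%:E)%E.
Proof.
move=> cg; exact: (@fubini_setX2 _ _ (measurableTypeR R) (measurableTypeR R) R
  mu mu _ _ (EFin \o g) (measurable_itv _) (measurable_itv _) (integrable_rect _ _ _ _ cg)).
Qed.

Import HBNNSimple.

Let msin : measurable_fun setT (fun a : angle R => sin (a.1 : R)).
Proof.
apply: (measurableT_comp _ measurable_fst).
by apply: continuous_measurable_fun; exact: continuous_sin.
Qed.

Let mpre (A : set (mpt R)) : measurable A -> measurable (@spherical R @^-1` A).
Proof.
by move=> mA; rewrite -[X in measurable X]setTI; exact: measurable_spherical.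
Qed.

Let surface_indic (A : set (mpt R)) : measurable A ->
  (dS R A = \int[leb2 R]_(a in @angles R) (\1_A (spherical a) * sin (a.1 : R))%:E)%E.
Proof.
move=> mA; rewrite [LHS]integral_mkcondr; apply: eq_integral => a _.
rewrite patchE indicE (_ : (a \in _ @^-1` A) = (spherical a \in A)).
  by case: ifP => _; rewrite ?mul1r ?mul0r.
by apply/idP/idP; rewrite !inE.
Qed.

Let integrable_indic_sin (A : set (mpt R)) : measurable A ->
  (leb2 R).-integrable (@angles R) (fun a => (\1_A (spherical a) * sin (a.1 : R))%:E).
Proof.
move=> mA; apply: measurable_bounded_integrable.
- exact: measurable_angles.
- by rewrite anglesE; exact: leb2_rect_fin.
- apply: measurable_funTS; apply: measurable_funM => //.
  apply: (measurableT_comp _ (@measurable_spherical R)).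
  exact: measurable_indic.
- exists 1; split=> [|y y1 x _]; first exact: num_real.
  rewrite /= normrM (le_trans _ (ltW y1))// mulr_ile1//; last exact: sin_max.
  by rewrite indicE; case: (_ \in _); rewrite ?normr1 ?normr0.
Qed.

(** [dS R] is given by its values on sets, so the passage to angles climbs from indicators to simple
    functions and then, by monotone convergence, to nonnegative functions. *)
Let integral_surface_nnsfun (h : {nnsfun mpt R >-> R}) :
  (\int[dS R]_x (h x)%:E =
   \int[leb2 R]_(a in @angles R) (h (spherical a) * sin (a.1 : R))%:E)%E.
Proof.
have mh k : measurable (h @^-1` [set k]) by [].
have hE x : h x = \sum_(k <- finmap.enum_fset (fset_set (range h))) k * \1_(h @^-1` [set k]) x.
  by rewrite [LHS]fimfunE fsbig_finite.
have i1 k : (dS R).-integrable setT (fun x => (k * \1_(h @^-1` [set k]) x)%:E).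
  apply: measurable_bounded_integrable => //.
  - rewrite (@surface_indic setT)//; apply: integrable_lty => //.
      exact: measurable_angles.
    exact: integrable_indic_sin.
  - by apply: measurable_funM => //; exact: measurable_indic.
  - exists `|k|; split=> [|y y1 x _]; first exact: num_real.
    rewrite /= normrM (le_trans _ (ltW y1))// ler_piMr//.
    by rewrite indicE; case: (_ \in _); rewrite ?normr1 ?normr0.
under eq_integral do rewrite hE -sumEFin.
rewrite integral_sum//.
under [RHS]eq_integral.
  move=> a _; rewrite hE mulr_suml -sumEFin.
  under eq_bigr do rewrite -mulrA EFinM.
  over.
rewrite integral_sum//; last 2 first.
- exact: measurable_angles.
- by move=> k; apply: integrableZl; [exact: measurable_angles|exact: integrable_indic_sin].
apply: eq_bigr => k _.
rewrite integralZl//; [|exact: measurable_angles|exact: integrable_indic_sin].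
rewrite -surface_indic//; under eq_integral do rewrite EFinM.
rewrite integralZl//; last first.
  apply: measurable_bounded_integrable => //.
  - rewrite (@surface_indic setT)//; apply: integrable_lty => //.
      exact: measurable_angles.
    exact: integrable_indic_sin.
  - exists 1; split=> [|y y1 x _]; first exact: num_real.
    rewrite /= (le_trans _ (ltW y1))//.
    by rewrite indicE; case: (_ \in _); rewrite ?normr1 ?normr0.
by rewrite integral_indic// setIT.
Qed.

Lemma ge0_integral_surface (f : mpt R -> \bar R) : measurable_fun setT f ->
  (forall x, 0 <= f x)%E ->
  (\int[dS R]_x f x =
   \int[leb2 R]_(a in @angles R) (f (spherical a) * (sin (a.1 : R))%:E))%E.
Proof.
move=> mf f0; pose f_ := nnsfun_approx measurableT mf.
have cf x : (f_ n x)%:E @[n --> \oo] --> f x by exact: cvg_nnsfun_approx.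
transitivity (limn (fun n => \int[dS R]_x (f_ n x)%:E)%E).
  rewrite -monotone_convergence//.
  - by apply: eq_integral => x _; apply/esym/cvg_lim.
  - by move=> n; apply/measurable_EFinP.
  - by move=> n x _; rewrite lee_fin.
  - by move=> x _ a b ab; rewrite lee_fin; exact/lefP/nd_nnsfun_approx.
under eq_fun do rewrite integral_surface_nnsfun.
rewrite -monotone_convergence//=.
- apply: eq_integral => a; rewrite inE => aA; apply/cvg_lim => //.
  under eq_fun do rewrite EFinM.
  apply: cvgeZr => //; exact: cf.
- exact: measurable_angles.
- move=> n; apply/measurable_EFinP; apply: measurable_funTS.
  apply: measurable_funM => //.
  by apply: measurableT_comp => //; exact: measurable_spherical.
- move=> n a [/sin_ge0_pi sa _]; rewrite lee_fin mulr_ge0//.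
- move=> x [/sin_ge0_pi sa _] a b ab; rewrite lee_fin ler_wpM2r//.
  exact/lefP/nd_nnsfun_approx.
Qed.

Lemma integral_sphere (f : pt R -> R) : continuous f ->
  (\int[dS R]_(x in @sphere R) (f x)%:E =
   \int[leb2 R]_(a in @angles R) (f (spherical a) * sin (a.1 : R))%:E)%E.
Proof.
move=> cf; rewrite integral_mkcond integralE [RHS]integralE.
have mf : measurable_fun setT (((fun x => (f x)%:E) \_ (@sphere R)) : mpt R -> \bar R).
  apply/(measurable_restrictT _ _).1; first exact: measurable_sphere.
  apply: measurable_funTS; apply/measurable_EFinP.
  exact: continuous_measurable3.
rewrite !ge0_integral_surface//; [|exact: measurable_funeneg|exact: measurable_funepos].
(* The sine is nonnegative on [0, pi], so it factors out of positive and negative parts. *)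
congr (_ - _)%E; apply: eq_integral => a; rewrite inE => -[/sin_ge0_pi sa _].
- rewrite !funeposE patchE mem_set; last exact: spherical_sphere.
  by rewrite EFinM maxe_pMl ?lee_fin// mul0e.
- rewrite !funenegE patchE mem_set; last exact: spherical_sphere.
  by rewrite EFinM -mulNe maxe_pMl ?lee_fin// mul0e.
Qed.

End sphere_integral.

(** * The divergence theorem, one axis at a time *)

Section divergence.
Context {R : realType}.
Local Notation mu := (@lebesgue_measure R).

Let cpolar : continuous (fun q : R * R => (q.1 * cos q.2, q.1 * sin q.2)).
Proof.
have c1 := @continuous_fst R R; have c2 := @continuous_snd R R.
apply: continuous_pairfun; apply: continuousM_fun => //.
  exact: continuous_compfun c2 (@continuous_cos R).
exact: continuous_compfun c2 (@continuous_sin R).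
Qed.

Let cpolarw (G : R * R -> R) : continuous G ->
  continuous (fun q : R * R => G (q.1 * cos q.2, q.1 * sin q.2) * q.1).
Proof.
move=> cG; apply: continuousM_fun; last exact: continuous_fst.
exact: continuous_compfun cpolar cG.
Qed.

Lemma ge0_polar_disc (G : R * R -> R) : continuous G -> (forall p, 0 <= G p) ->
  (forall p, 1 <= p.1 ^+ 2 + p.2 ^+ 2 -> G p = 0) ->
  (\int[leb2 R]_p (G p)%:E =
   \int[leb2 R]_(q in `[0%R, 1%R] `*` `[0%R, (2 * pi)%R])
     (G (q.1 * cos q.2, q.1 * sin q.2) * q.1)%:E)%E.
Proof.
move=> cG G0 Gout; rewrite integral_rect1; last exact: cpolarw.
have G0' p : (0 <= (G p)%:E)%E by rewrite lee_fin.
etransitivity.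
  exact: (@fubini_tonelli1 _ _ (measurableTypeR R) (measurableTypeR R) R mu mu
    _ (continuous_measurable2E cG) G0').
etransitivity; first exact: ge0_polar.
clear G0'.
rewrite integral_mkcond [RHS]integral_mkcond; apply: eq_integral => r _.
rewrite !patchE !mem_setE !in_itv/= andbT.
have [r0|r0|<-] := ltgtP 0 r => //=.
- have [r1|r1] := leP r 1 => //.
  apply: integral0_eq => t _; rewrite Gout ?mul0r//=.
  by rewrite !exprMn -mulrDr cos2Dsin2 mulr1; nra.
- by case: ifP => // _; apply/esym/integral0_eq => t _; rewrite mulr0.
Qed.

Lemma polar_disc (G : R * R -> R) : continuous G ->
  (forall p, 1 <= p.1 ^+ 2 + p.2 ^+ 2 -> G p = 0) ->
  (\int[leb2 R]_p (G p)%:E =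
   \int[leb2 R]_(q in `[0%R, 1%R] `*` `[0%R, (2 * pi)%R])
     (G (q.1 * cos q.2, q.1 * sin q.2) * q.1)%:E)%E.
Proof.
move=> cG Gout.
have cN : continuous (fun p => `|G p|) by move=> p; apply: cvg_norm; exact: cG.
have isq (H : R * R -> R) : continuous H ->
    (forall p, 1 <= p.1 ^+ 2 + p.2 ^+ 2 -> H p = 0) ->
    (leb2 R).-integrable setT (EFin \o H).
  move=> cH Hout.
  have := integrable_rect (-1) 1 (-1) 1 cH.
  move/(integrable_mkcond _ (measurable_rect _ _ _ _)).
  apply: eq_integrable => // -[x y] _; rewrite patchE in_setX !mem_setE/= !in_itv/=.
  case: ifPn => // h; rewrite Hout//= leNgt; apply: contra h => h.
  by do 2 (apply/andP; split); nra.
(* Twice the positive and the negative part of [G]: both are continuous, nonnegative and zero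
   outside the disc. *)
pose P p := `|G p| + G p; pose N p := `|G p| - G p.
have cP : continuous P by exact: continuousD_fun.
have cQ : continuous N by exact: continuousB_fun.
have P0 p : 0 <= P p by rewrite /P; have := ler_norm (- G p); rewrite normrN; lra.
have N0 p : 0 <= N p by rewrite /N; have := ler_norm (G p); lra.
have Pout p : 1 <= p.1 ^+ 2 + p.2 ^+ 2 -> P p = 0.
  by move=> /Gout; rewrite /P => ->; rewrite normr0 addr0.
have Nout p : 1 <= p.1 ^+ 2 + p.2 ^+ 2 -> N p = 0.
  by move=> /Gout; rewrite /N => ->; rewrite normr0 subr0.
have eP := ge0_polar_disc cP P0 Pout; have eN := ge0_polar_disc cQ N0 Nout.
have iP := isq _ cP Pout; have iN := isq _ cQ Nout.
have iP' := integrable_rect 0 1 0 (2 * pi) (cpolarw cP).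
have iN' := integrable_rect 0 1 0 (2 * pi) (cpolarw cQ).
have GE p : G p = 2^-1 * (P p - N p) by rewrite /P /N; lra.
have mr := measurable_rect 0 1 0 (2 * pi).
transitivity (2^-1%:E * (\int[leb2 R]_p (P p)%:E - \int[leb2 R]_p (N p)%:E))%E.
  rewrite -integralB_EFin// -integralZl//; last exact: integrableB.
  by apply: eq_integral => p _; rewrite GE.
rewrite eP eN -integralB_EFin// -integralZl//; last exact: integrableB.
by apply: eq_integral => p _ /=; rewrite GE -EFinB -EFinM; congr EFin; ring.
Qed.

Definition i0 : 'I_3 := @Ordinal 3 0 isT.
Definition i1 : 'I_3 := @Ordinal 3 1 isT.
Definition i2 : 'I_3 := @Ordinal 3 2 isT.

Lemma is_derive_x (f : pt R -> R) (x y z : R) :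
  derivable f (x, y, z) (basis3 R i0) ->
  is_derive x 1 (fun t => f (t, y, z)) (partial i0 f (x, y, z)).
Proof.
have e : (fun h => h^-1 *: ((f \o shift (x, y, z)) (h *: basis3 R i0) - f (x, y, z))) =
    (fun h : R => h^-1 *: (((fun t => f (t, y, z)) \o shift x) (h *: 1) - f (x, y, z))).
  apply/funext => h /=.
  have -> : h *: basis3 R i0 + (x, y, z) = (h * 1 + x, h * 0 + y, h * 0 + z) by [].
  by rewrite !mulr0 !add0r.
move=> df; apply: DeriveDef; first by rewrite /derivable -e.
by rewrite /derive -e.
Qed.

Lemma is_derive_y (f : pt R -> R) (x y z : R) :
  derivable f (x, y, z) (basis3 R i1) ->
  is_derive y 1 (fun t => f (x, t, z)) (partial i1 f (x, y, z)).
Proof.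
have e : (fun h => h^-1 *: ((f \o shift (x, y, z)) (h *: basis3 R i1) - f (x, y, z))) =
    (fun h : R => h^-1 *: (((fun t => f (x, t, z)) \o shift y) (h *: 1) - f (x, y, z))).
  apply/funext => h /=.
  have -> : h *: basis3 R i1 + (x, y, z) = (h * 0 + x, h * 1 + y, h * 0 + z) by [].
  by rewrite !mulr0 !add0r.
move=> df; apply: DeriveDef; first by rewrite /derivable -e.
by rewrite /derive -e.
Qed.

Lemma is_derive_z (f : pt R -> R) (x y z : R) :
  derivable f (x, y, z) (basis3 R i2) ->
  is_derive z 1 (fun t => f (x, y, t)) (partial i2 f (x, y, z)).
Proof.
have e : (fun h => h^-1 *: ((f \o shift (x, y, z)) (h *: basis3 R i2) - f (x, y, z))) =
    (fun h : R => h^-1 *: (((fun t => f (x, y, t)) \o shift z) (h *: 1) - f (x, y, z))).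
  apply/funext => h /=.
  have -> : h *: basis3 R i2 + (x, y, z) = (h * 0 + x, h * 0 + y, h * 1 + z) by [].
  by rewrite !mulr0 !add0r.
move=> df; apply: DeriveDef; first by rewrite /derivable -e.
by rewrite /derive -e.
Qed.

Definition C1 (f : pt R -> R) : Prop :=
  continuous f /\ forall i, (forall x, derivable f x (basis3 R i)) /\
                            continuous (partial i f).

Lemma leb2_sigma_finite : sigma_finite setT (@leb2 R).
Proof.
exists (fun n : nat => `[- n%:R, n%:R] `*` `[- n%:R, n%:R]).
  apply/seteqP; split => // -[x y] _ /=.
  have [n [nx ny]] : exists n : nat, `|x| <= n%:R /\ `|y| <= n%:R.
    exists (maxn (Num.bound `|x|) (Num.bound `|y|)).
    split; apply: le_trans (ltW (archi_boundP _)) _ => //; rewrite ?ler_nat ?leq_maxl ?leq_maxr //.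
  by exists n => //=; rewrite !in_itv/= -!ler_norml.
move=> n; split; first exact: measurable_rect.
exact: leb2_rect_fin.
Qed.
(* The sigma-finite instance of the library for products is shadowed by the
   one for products of probability measures. *)
Definition leb2_sf : {sigma_finite_measure set (angle R) -> \bar R} :=
  HB.pack_for {sigma_finite_measure set (angle R) -> \bar R} (Measure.sort (leb2 R))
   (Measure_isSigmaFinite.Build _ _ _ (leb2 R) leb2_sigma_finite).

Lemma integrable_ball_patch (g : pt R -> R) : continuous g ->
  (leb3 R).-integrable setT ((EFin \o g) \_ (@ball3 R)).
Proof.
move=> cg; apply/(integrable_mkcond _ measurable_ball3).
exact: continuous_integrable_ball.
Qed.

Lemma measurable_ball_patch (g : pt R -> R) : continuous g ->
  measurable_fun setT (((EFin \o g) \_ (@ball3 R)) : mpt R -> \bar R).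
Proof. by move=> /integrable_ball_patch /integrableP[]. Qed.

Lemma integral_ball_z (g : pt R -> R) : continuous g ->
  (\int[leb3 R]_(x in @ball3 R) (g x)%:E =
   \int[leb2 R]_p \int[mu]_(z in [set z | (z ^+ 2 < 1 - p.1 ^+ 2 - p.2 ^+ 2)%R])
     (g (p, z))%:E)%E.
Proof.
move=> cg; rewrite integral_mkcond.
etransitivity.
  exact: (esym (@integral12_prod_meas1 _ _ (angle R) (measurableTypeR R) R
    leb2_sf mu _ (integrable_ball_patch cg))).
apply: eq_integral => p _; rewrite /fubini_F [RHS]integral_mkcond.
apply: eq_integral => z _; rewrite !patchE.
have -> // : ((p, z) \in @ball3 R) = (z \in [set z | z ^+ 2 < 1 - p.1 ^+ 2 - p.2 ^+ 2]).
by apply/idP/idP; rewrite !inE ball3E /nrm2/=; lra.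
Qed.

(** Integrability in the ball gives that of almost every slice only. A bound of [g] on the cube
    gives it for every [z], so that slices can be rewritten pointwise. *)
Lemma integrable_ball_section (g : pt R -> R) (z : R) : continuous g ->
  (leb2 R).-integrable setT (fun p => ((EFin \o g) \_ (@ball3 R)) (p, z)).
Proof.
move=> cg; have [M M0 MP] := continuous_bounded_cube cg.
pose sq : set (angle R) := `[-1, 1] `*` `[-1, 1].
have msq : measurable sq := measurable_rect _ _ _ _.
pose h (p : angle R) := if (p, z) \in @ball3 R then g (p, z) else 0.
have hE p : ((EFin \o g) \_ (@ball3 R)) (p, z) = (h p)%:E.
  by rewrite patchE /h; case: ifP.
have mh : measurable_fun setT h.
  apply/measurable_EFinP; apply: (eq_measurable_fun (fun p => ((EFin \o g) \_ (@ball3 R)) (p, z))).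
    by move=> p _; rewrite hE.
  apply: measurableT_comp; first exact: measurable_ball_patch.
  exact: pair2_measurable.
have : (leb2 R).-integrable sq (EFin \o h).
  apply: measurable_bounded_integrable => //.
  - exact: leb2_rect_fin.
  - exact: measurable_funTS.
  - exists M; split=> [|y My p _]; first exact: num_real.
    apply: le_trans (ltW My); rewrite /h; case: ifPn; last by rewrite normr0.
    by rewrite inE => Bp; apply: MP; exact: ball3_cube.
move/(integrable_mkcond _ msq); apply: eq_integrable => // p _.
rewrite hE patchE; case: ifPn => // psq; rewrite /h ifF//.
apply: contraNF psq; rewrite !inE => Bp.
by have [] := ball3_cube Bp.
Qed.

Lemma integral_ball_yx (g : pt R -> R) : continuous g ->
  (\int[leb3 R]_(x in @ball3 R) (g x)%:E =
   \int[mu]_z \int[mu]_y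
     \int[mu]_(x in [set x | (x ^+ 2 < (1 - z ^+ 2) - y ^+ 2)%R]) (g (x, y, z))%:E)%E.
Proof.
move=> cg; rewrite integral_mkcond.
etransitivity.
  exact: (esym (@integral21_prod_meas1 _ _ (angle R) (measurableTypeR R) R
    leb2_sf mu _ (integrable_ball_patch cg))).
apply: eq_integral => z _; rewrite /fubini_G.
etransitivity.
  exact: (esym (@integral21_prod_meas1 _ _ (measurableTypeR R) (measurableTypeR R) R
    mu mu _ (integrable_ball_section z cg))).
apply: eq_integral => y _; rewrite /fubini_G [RHS]integral_mkcond.
apply: eq_integral => x _; rewrite !patchE.
have -> // : ((x, y, z) \in @ball3 R) = (x \in [set x | x ^+ 2 < 1 - z ^+ 2 - y ^+ 2]).
by apply/idP/idP; rewrite !inE ball3E /nrm2/=; lra.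
Qed.

Lemma integral_ball_xy (g : pt R -> R) : continuous g ->
  (\int[leb3 R]_(x in @ball3 R) (g x)%:E =
   \int[mu]_z \int[mu]_x
     \int[mu]_(y in [set y | (y ^+ 2 < (1 - z ^+ 2) - x ^+ 2)%R]) (g (x, y, z))%:E)%E.
Proof.
move=> cg; rewrite integral_mkcond.
etransitivity.
  exact: (esym (@integral21_prod_meas1 _ _ (angle R) (measurableTypeR R) R
    leb2_sf mu _ (integrable_ball_patch cg))).
apply: eq_integral => z _; rewrite /fubini_G.
etransitivity.
  exact: (esym (@integral12_prod_meas1 _ _ (measurableTypeR R) (measurableTypeR R) R
    mu mu _ (integrable_ball_section z cg))).
apply: eq_integral => x _; rewrite /fubini_F [RHS]integral_mkcond.
apply: eq_integral => y _; rewrite !patchE.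
have -> // : ((x, y, z) \in @ball3 R) = (y \in [set y | y ^+ 2 < 1 - z ^+ 2 - x ^+ 2]).
by apply/idP/idP; rewrite !inE ball3E /nrm2/=; lra.
Qed.

Let csph : continuous (fun a : R * R => (sin a.1 * cos a.2, sin a.1 * sin a.2, cos a.1)).
Proof.
have c1 := @continuous_fst R R; have c2 := @continuous_snd R R.
have s1 := continuous_compfun c1 (@continuous_sin R).
have k1 := continuous_compfun c1 (@continuous_cos R).
have s2 := continuous_compfun c2 (@continuous_sin R).
have k2 := continuous_compfun c2 (@continuous_cos R).
apply: continuous_pairfun => //; apply: continuous_pairfun; exact: continuousM_fun.
Qed.

Lemma integral_sphere_angles (f : pt R -> R) : continuous f ->
  (\int[dS R]_(x in @sphere R) (f x)%:E =
   \int[mu]_(t in `[0%R, (2 * pi)%R]) \int[mu]_(a in `[0%R, pi%R])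
     (f (sin a * cos t, sin a * sin t, cos a) * sin a)%:E)%E.
Proof.
move=> cf; rewrite integral_sphere// anglesE.
apply: (@integral_rect2 R (fun a => f (sin a.1 * cos a.2, sin a.1 * sin a.2, cos a.1) * sin a.1)).
apply: continuousM_fun; first exact: continuous_compfun csph cf.
by apply: continuous_compfun (@continuous_sin R); exact: continuous_fst.
Qed.

(** At height z = cos a the latitude circle has radius sqrt (1 - z^2) = sin a, and dz supplies the
    last factor [sin a], that of the surface element. Outside [-1, 1] the square root is 0, which
    kills the integrand. *)
Lemma integral_latitudes (f : pt R -> R) (w : R -> R) : continuous f -> continuous w ->
  (\int[mu]_z \int[mu]_(t in `[0%R, (2 * pi)%R])
     (f (Num.sqrt (1 - z ^+ 2) * cos t, Num.sqrt (1 - z ^+ 2) * sin t, z) *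
      (Num.sqrt (1 - z ^+ 2) * w t))%:E =
   \int[mu]_(t in `[0%R, (2 * pi)%R]) \int[mu]_(a in `[0%R, pi%R])
     (f (sin a * cos t, sin a * sin t, cos a) * (sin a * w t) * sin a)%:E)%E.
Proof.
move=> cf cw.
have c1 := @continuous_fst R R; have c2 := @continuous_snd R R.
have s2 := continuous_compfun c2 (@continuous_sin R).
have k2 := continuous_compfun c2 (@continuous_cos R).
have w2 := continuous_compfun c2 cw.
pose K (q : R * R) :=
  f (Num.sqrt (1 - q.1 ^+ 2) * cos q.2, Num.sqrt (1 - q.1 ^+ 2) * sin q.2, q.1) *
  (Num.sqrt (1 - q.1 ^+ 2) * w q.2).
have cr : continuous (fun q : R * R => Num.sqrt (1 - q.1 ^+ 2)).
  apply: continuous_sqrt_fun; apply: continuousB_fun.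
    exact: continuous_cst_fun.
  exact: continuousX_fun.
have cK : continuous K.
  apply: continuousM_fun; last exact: continuousM_fun.
  apply: continuous_compfun cf; apply: continuous_pairfun => //.
  by apply: continuous_pairfun; exact: continuousM_fun.
transitivity (\int[mu]_(z in `[(-1)%R, 1%R]) \int[mu]_(t in `[0%R, (2 * pi)%R]) (K (z, t))%:E)%E.
  rewrite [RHS]integral_mkcond; apply: eq_integral => z _.
  rewrite patchE mem_setE in_itv/=; case: ifPn => // z1.
  apply: integral0_eq => t _; rewrite ler0_sqrtr ?mul0r ?mulr0//.
  by rewrite leNgt; apply: contra z1 => z1; apply/andP; split; nra.
rewrite -(integral_rect1 _ _ _ _ cK) (integral_rect2 _ _ _ _ cK).
apply: eq_integral => t _.
have cKt : continuous (fun z => K (z, t)) by exact: continuous_section2.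
pose H a := f (sin a * cos t, sin a * sin t, cos a) * (sin a * w t) * sin a.
have cH : continuous H.
  have cs := @continuous_sin R.
  apply: continuousM_fun => //; apply: continuousM_fun.
    apply: continuous_compfun cf.
    apply: continuous_pairfun; last exact: continuous_cos.
    by apply: continuous_pairfun; apply: continuousM_fun => //; exact: continuous_cst_fun.
  by apply: continuousM_fun => //; exact: continuous_cst_fun.
rewrite -[RHS]/(\int[mu]_(a in _) (H a)%:E)%E (integral_EFin_itv _ _ cKt).
rewrite (integral_EFin_itv _ _ cH); congr EFin.
have cNs : continuous (fun a : R => - sin a) by apply: continuousN_fun; exact: continuous_sin.
have e : \int[mu]_(a in `[0, pi]) (K (cos a, t) * - sin a) =
    - \int[mu]_(x in `[-1, 1]) K (x, t).
  have := @integral_comp_decr _ _ cos (fun t => - sin t) (- 1 - 1) 0 pi cKt cNs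
    (@is_derive_cos R).
  rewrite cos0 cospi; apply => //.
  - by move=> u; have := cos_geN1 u; lra.
  - exact: pi_ge0.
rewrite -[LHS]opprK -e -[LHS]mulN1r -RintegralZl//; last first.
  apply: continuous_integrable_itv; apply: continuousM_fun => //.
  by apply: continuous_compfun cKt; exact: continuous_cos.
apply: eq_Rintegral => a; rewrite inE/= in_itv/= => /sin_ge0_pi sa.
have := @sqrt_sub_sqr R 1 (cos a) (sin a) sa (cos2Dsin2 a).
by rewrite sqrtr1 !mul1r /K /H/= => ->; ring.
Qed.

(** Integrating along parallels to the x axis leaves the values of f at the ends of the chords. At
    fixed z these ends run along a latitude circle, where dy produces the factor x of the normal. *)
Lemma divergence_x (f : pt R -> R) : C1 f ->
  (\int[leb3 R]_(x in @ball3 R) (partial i0 f x)%:E =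
   \int[dS R]_(x in @sphere R) (f x * x.1.1)%:E)%E.
Proof.
move=> [cf /(_ i0)[df cdf]].
rewrite integral_ball_yx// integral_sphere_angles; last first.
  by apply: continuousM_fun => //; exact: continuous_x.
rewrite -(integral_latitudes cf (@continuous_cos R)).
apply: eq_integral => z _.
have cfz : continuous (fun p => f (p, z)).
  by apply: continuous_compfun cf; apply: continuous_pairfun; [exact: continuous_id_fun|exact: continuous_cst_fun].
rewrite -(@integral_chordx R (fun p => f (p, z)) (1 - z ^+ 2) cfz).
apply: eq_integral => y _.
have cc : continuous (fun x => partial i0 f (x, y, z)).
  apply: continuous_compfun cdf; apply: continuous_pairfun; last exact: continuous_cst_fun.
  by apply: continuous_pairfun; [exact: continuous_id_fun|exact: continuous_cst_fun].
exact: (integral_sqr_lt _ cc (fun x => is_derive_x (df (x, y, z)))).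
Qed.

Lemma divergence_y (f : pt R -> R) : C1 f ->
  (\int[leb3 R]_(x in @ball3 R) (partial i1 f x)%:E =
   \int[dS R]_(x in @sphere R) (f x * x.1.2)%:E)%E.
Proof.
move=> [cf /(_ i1)[df cdf]].
rewrite integral_ball_xy// integral_sphere_angles; last first.
  by apply: continuousM_fun => //; exact: continuous_y.
rewrite -(integral_latitudes cf (@continuous_sin R)).
apply: eq_integral => z _.
have cfz : continuous (fun p => f (p, z)).
  by apply: continuous_compfun cf; apply: continuous_pairfun; [exact: continuous_id_fun|exact: continuous_cst_fun].
rewrite -(@integral_chordy R (fun p => f (p, z)) (1 - z ^+ 2) cfz).
apply: eq_integral => x _.
have cc : continuous (fun y => partial i1 f (x, y, z)).
  apply: continuous_compfun cdf; apply: continuous_pairfun; last exact: continuous_cst_fun.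
  by apply: continuous_pairfun; [exact: continuous_cst_fun|exact: continuous_id_fun].
exact: (integral_sqr_lt _ cc (fun y => is_derive_y (df (x, y, z)))).
Qed.

(** Vertical chords end on the two hemispheres, parametrised by polar coordinates of the unit disc.
    With r = sin a, the range [0, pi/2] gives the upper hemisphere and [pi/2, pi] the lower one, and
    dr = cos a da produces the factor z of the normal. *)
Lemma divergence_z (f : pt R -> R) : C1 f ->
  (\int[leb3 R]_(x in @ball3 R) (partial i2 f x)%:E =
   \int[dS R]_(x in @sphere R) (f x * x.2)%:E)%E.
Proof.
move=> [cf /(_ i2)[df cdf]].
have c1 := @continuous_fst R R; have c2 := @continuous_snd R R.
have cid : continuous (fun p : R * R => p) by exact: continuous_id_fun.
pose h (p : R * R) := Num.sqrt (1 - p.1 ^+ 2 - p.2 ^+ 2).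
have ch : continuous h.
  apply: continuous_sqrt_fun; apply: continuousB_fun; last exact: continuousX_fun.
  by apply: continuousB_fun; [exact: continuous_cst_fun|exact: continuousX_fun].
pose G (p : R * R) := f (p, h p) - f (p, - h p).
have cG : continuous G.
  apply: continuousB_fun; apply: continuous_compfun cf; apply: continuous_pairfun => //.
  exact: continuousN_fun.
have Gout p : 1 <= p.1 ^+ 2 + p.2 ^+ 2 -> G p = 0.
  by move=> p1; rewrite /G /h ler0_sqrtr ?oppr0 ?subrr//; lra.
transitivity (\int[leb2 R]_p (G p)%:E)%E.
  rewrite integral_ball_z//; apply: eq_integral => -[x y] _.
  have cc : continuous (fun z => partial i2 f (x, y, z)).
    apply: continuous_compfun cdf; apply: continuous_pairfun.
      exact: continuous_cst_fun.
    exact: continuous_id_fun.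
  exact: (integral_sqr_lt _ cc (fun z => is_derive_z (df (x, y, z)))).
rewrite (polar_disc cG Gout) (integral_rect2 _ _ _ _ (cpolarw cG)).
rewrite integral_sphere_angles; last first.
  by apply: continuousM_fun => //; exact: continuous_z.
apply: eq_integral => t _.
have cq : continuous (fun r : R => Num.sqrt (1 - r ^+ 2)).
  apply: continuous_sqrt_fun; apply: continuousB_fun; first exact: continuous_cst_fun.
  by apply: continuousX_fun; exact: continuous_id_fun.
have cid1 : continuous (fun r : R => r) by exact: continuous_id_fun.
have cm (c : R) : continuous (fun r : R => r * c).
  by apply: continuousM_fun => //; exact: continuous_cst_fun.
pose A (r : R) := f (r * cos t, r * sin t, Num.sqrt (1 - r ^+ 2)) * r.
pose B (r : R) := f (r * cos t, r * sin t, - Num.sqrt (1 - r ^+ 2)) * r.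
have cA : continuous A.
  apply: continuousM_fun => //; apply: continuous_compfun cf.
  by apply: continuous_pairfun => //; exact: continuous_pairfun.
have cB : continuous B.
  apply: continuousM_fun => //; apply: continuous_compfun cf.
  apply: continuous_pairfun; first exact: continuous_pairfun.
  exact: continuousN_fun.
have cc := @continuous_cos R; have cs := @continuous_sin R.
pose H a := f (sin a * cos t, sin a * sin t, cos a) * cos a * sin a.
have cH : continuous H.
  apply: continuousM_fun => //; apply: continuousM_fun => //.
  apply: continuous_compfun cf; apply: continuous_pairfun => //.
  by apply: continuous_pairfun; apply: continuousM_fun => //; exact: continuous_cst_fun.
rewrite -[RHS]/(\int[mu]_(a in _) (H a)%:E)%E (integral_EFin_itv _ _ cH).
transitivity (\int[mu]_(r in `[0%R, 1%R]) (A r - B r)%:E)%E.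
  apply: eq_integral => r _; congr EFin.
  have e : 1 - (r * cos t) ^+ 2 - (r * sin t) ^+ 2 = 1 - r ^+ 2.
    by have := cos2Dsin2 t; rewrite !exprMn; nra.
  by rewrite /G /h/= e mulrBl.
rewrite (integral_EFin_itv _ _ (continuousB_fun cA cB)); congr EFin.
rewrite RintegralB//; [|exact: continuous_integrable_itv|exact: continuous_integrable_itv].
have p0 := @pi_gt0 R.
rewrite (@Rintegral_itv_split _ H 0 (pi / 2) pi)//; try lra.
have sgt (u : R) : - 1 - 1 < sin u by have := sin_geN1 u; lra.
congr (_ + _).
  have := @integral_comp_incr _ A sin cos (- 1 - 1) 0 (pi / 2) cA cc
    (@is_derive_sin R) sgt.
  rewrite sin0 sin_pihalf => <-//; last by lra.
  apply: eq_Rintegral => a; rewrite inE/= in_itv/= => /andP[a0 a1].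
  have ca : 0 <= cos a by apply: cos_ge0_pihalf; apply/andP; split; lra.
  have := @sqrt_sub_sqr R 1 (sin a) (cos a) ca.
  rewrite addrC cos2Dsin2 sqrtr1 !mul1r /A /H => /(_ erefl) ->; ring.
have := @integral_comp_decr _ B sin cos (- 1 - 1) (pi / 2) pi cB cc
  (@is_derive_sin R) sgt.
rewrite sinpi sin_pihalf => <-//; last by lra.
apply: eq_Rintegral => a; rewrite inE/= in_itv/= => /andP[a0 a1].
have ca : 0 <= - cos a.
  by rewrite -cos_piB; apply: cos_ge0_pihalf; apply/andP; split; lra.
have := @sqrt_sub_sqr R 1 (sin a) (- cos a) ca.
rewrite sqrrN addrC cos2Dsin2 sqrtr1 !mul1r /B /H => /(_ erefl) ->.
by rewrite opprK; ring.
Qed.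

Definition coord (i : 'I_3) (x : pt R) : R :=
  match nat_of_ord i with 0 => x.1.1 | 1 => x.1.2 | _ => x.2 end.

Lemma ord3P (i : 'I_3) : [\/ i = i0, i = i1 | i = i2].
Proof.
case: i => [[|[|[|//]]] p]; [apply: Or31|apply: Or32|apply: Or33]; exact: val_inj.
Qed.

Lemma divergence (f : pt R -> R) (i : 'I_3) : C1 f ->
  \int[leb3 R]_(x in @ball3 R) partial i f x =
  \int[dS R]_(x in @sphere R) (f x * coord i x).
Proof.
move=> Cf; apply: (congr1 fine).
have [->|->|->] := ord3P i.
- exact: divergence_x.
- exact: divergence_y.
- exact: divergence_z.
Qed.

End divergence.

(** * Complex-valued integrals *)

Section cint_theory.
Context d (T : measurableType d) {R : realType}.
Variables (mu : {measure set T -> \bar R}) (D : set T).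
Hypothesis mD : measurable D.
Implicit Types (f g : T -> R[i]).

Definition cintegrable f : Prop :=
  mu.-integrable D (EFin \o (fun x => complex.Re (f x))) /\
  mu.-integrable D (EFin \o (fun x => complex.Im (f x))).

Lemma ReMi (x y : R[i]) : complex.Re (x * y) =
  complex.Re x * complex.Re y - complex.Im x * complex.Im y.
Proof. by case: x; case: y. Qed.

Lemma ImMi (x y : R[i]) : complex.Im (x * y) =
  complex.Re x * complex.Im y + complex.Im x * complex.Re y.
Proof. by case: x => a b; case: y => e h /=. Qed.

Lemma ReDi (x y : R[i]) : complex.Re (x + y) = complex.Re x + complex.Re y.
Proof. by case: x; case: y. Qed.

Lemma ImDi (x y : R[i]) : complex.Im (x + y) = complex.Im x + complex.Im y.
Proof. by case: x; case: y. Qed.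

Lemma ReNi (x : R[i]) : complex.Re (- x) = - complex.Re x.
Proof. by case: x. Qed.

Lemma ImNi (x : R[i]) : complex.Im (- x) = - complex.Im x.
Proof. by case: x. Qed.

Lemma ReCi (x : R[i]) : complex.Re (x^*) = complex.Re x.
Proof. by case: x. Qed.

Lemma ImCi (x : R[i]) : complex.Im (x^*) = - complex.Im x.
Proof. by case: x. Qed.

Lemma eq_complexP (x y : R[i]) : complex.Re x = complex.Re y ->
  complex.Im x = complex.Im y -> x = y.
Proof. by case: x => a b; case: y => a' b' /= -> ->. Qed.

Lemma integrable_lincomb (a b : R) (u v : T -> R) :
  mu.-integrable D (EFin \o u) -> mu.-integrable D (EFin \o v) ->
  mu.-integrable D (EFin \o (fun x => a * u x + b * v x)).
Proof.
move=> iu iv.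
have := integrableD mD (integrableZl mD a iu) (integrableZl mD b iv).
by apply: eq_integrable => // x _; rewrite /= EFinD !EFinM.
Qed.

Lemma Rintegral_lincomb (a b : R) (u v : T -> R) :
  mu.-integrable D (EFin \o u) -> mu.-integrable D (EFin \o v) ->
  \int[mu]_(x in D) (a * u x + b * v x) =
  a * \int[mu]_(x in D) u x + b * \int[mu]_(x in D) v x.
Proof.
move=> iu iv; rewrite RintegralD//; first by rewrite !RintegralZl.
- have := integrableZl mD a iu.
  by apply: eq_integrable => // x _; rewrite /= EFinM.
- have := integrableZl mD b iv.
  by apply: eq_integrable => // x _; rewrite /= EFinM.
Qed.

Lemma eq_cint f g : (forall x, D x -> f x = g x) -> cint mu D f = cint mu D g.
Proof.
by move=> fg; rewrite /cint; congr (_ +i* _);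
  apply: eq_Rintegral => x; rewrite inE => /fg ->.
Qed.

Lemma eq_cintegrable f g : (forall x, D x -> f x = g x) ->
  cintegrable f -> cintegrable g.
Proof.
by move=> fg [i1 i2]; split; [move: i1|move: i2]; apply: eq_integrable => // x;
  rewrite inE => /fg /= ->.
Qed.

Lemma cintegrableD f g : cintegrable f -> cintegrable g ->
  cintegrable (fun x => f x + g x).
Proof.
move=> [f1 f2] [g1 g2]; split.
  have := integrable_lincomb 1 1 f1 g1.
  by apply: eq_integrable => // x _; rewrite /= ReDi !mul1r.
have := integrable_lincomb 1 1 f2 g2.
by apply: eq_integrable => // x _; rewrite /= ImDi !mul1r.
Qed.

Lemma cintegrableZ (a : R[i]) f : cintegrable f -> cintegrable (fun x => a * f x).
Proof.
move=> [f1 f2]; split.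
  have := integrable_lincomb (complex.Re a) (- complex.Im a) f1 f2.
  by apply: eq_integrable => // x _; rewrite /= ReMi mulNr.
have := integrable_lincomb (complex.Re a) (complex.Im a) f2 f1.
by apply: eq_integrable => // x _; rewrite /= ImMi.
Qed.

Lemma cintegrable0 : cintegrable (fun=> 0).
Proof. by split; exact: integrable0. Qed.

Lemma cintegrable_sum (I : Type) (s : seq I) (F : I -> T -> R[i]) :
  (forall i, cintegrable (F i)) -> cintegrable (fun x => \sum_(i <- s) F i x).
Proof.
move=> iF; elim: s => [|i s IH].
  by apply: eq_cintegrable cintegrable0 => x _; rewrite big_nil.
apply: eq_cintegrable (cintegrableD (iF i) IH) => x _.
by rewrite big_cons.
Qed.

Lemma cintD f g : cintegrable f -> cintegrable g ->
  cint mu D (fun x => f x + g x) = cint mu D f + cint mu D g.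
Proof.
move=> [f1 f2] [g1 g2]; rewrite /cint; apply: eq_complexP => /=.
  rewrite -RintegralD//; apply: eq_Rintegral => x _; exact: ReDi.
rewrite -RintegralD//; apply: eq_Rintegral => x _; exact: ImDi.
Qed.

Lemma cintZ (a : R[i]) f : cintegrable f ->
  cint mu D (fun x => a * f x) = a * cint mu D f.
Proof.
move=> [f1 f2]; rewrite /cint; apply: eq_complexP.
  rewrite ReMi /= -mulNr -Rintegral_lincomb//; apply: eq_Rintegral => x _.
  by rewrite ReMi mulNr.
rewrite ImMi /= -Rintegral_lincomb//; apply: eq_Rintegral => x _.
by rewrite ImMi.
Qed.

Lemma cint0 : cint mu D (fun=> 0) = 0.
Proof.
rewrite /cint /Rintegral/= integral0 /=; exact: eq_complexP.
Qed.

Lemma cintN f : cintegrable f -> cint mu D (fun x => - f x) = - cint mu D f.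
Proof.
move=> cf; rewrite -mulN1r -cintZ//; apply: eq_cint => x _.
by rewrite mulN1r.
Qed.

Lemma cintB f g : cintegrable f -> cintegrable g ->
  cint mu D (fun x => f x - g x) = cint mu D f - cint mu D g.
Proof.
move=> cf cg; rewrite -cintN// -cintD//.
by apply: eq_cintegrable (cintegrableZ (-1) cg) => x _; rewrite mulN1r.
Qed.

Lemma cint_sum (I : Type) (s : seq I) (F : I -> T -> R[i]) :
  (forall i, cintegrable (F i)) ->
  cint mu D (fun x => \sum_(i <- s) F i x) = \sum_(i <- s) cint mu D (F i).
Proof.
move=> iF; elim: s => [|i s IH].
  by rewrite big_nil -[RHS]cint0; apply: eq_cint => x _; rewrite big_nil.
rewrite big_cons -IH -cintD//; last exact: cintegrable_sum.
by apply: eq_cint => x _; rewrite big_cons.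
Qed.

Hypothesis muD : (mu D < +oo)%E.

Lemma normcE (x : R[i]) :
  Normc.normc x = Num.sqrt (complex.Re x ^+ 2 + complex.Im x ^+ 2).
Proof. by case: x. Qed.

Lemma Re_le_normc (x : R[i]) : `|complex.Re x| <= Normc.normc x.
Proof. by rewrite normcE -sqrtr_sqr ler_wsqrtr// lerDl sqr_ge0. Qed.

Lemma Im_le_normc (x : R[i]) : `|complex.Im x| <= Normc.normc x.
Proof. by rewrite normcE -sqrtr_sqr ler_wsqrtr// lerDr sqr_ge0. Qed.

Lemma normc_ge0 (x : R[i]) : 0 <= Normc.normc x.
Proof. by rewrite normcE sqrtr_ge0. Qed.

Definition cmeasurable f : Prop :=
  measurable_fun D (fun x => complex.Re (f x)) /\
  measurable_fun D (fun x => complex.Im (f x)).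

Lemma measurable_normc f : cmeasurable f ->
  measurable_fun D (fun x => Normc.normc (f x)).
Proof.
move=> [m1 m2]; under eq_fun do rewrite normcE.
apply: (measurableT_comp (continuous_measurable_fun (@sqrt_continuous R))).
by apply: measurable_funD; exact: measurable_funX.
Qed.

Lemma cmeasurableM f g : cmeasurable f -> cmeasurable g ->
  cmeasurable (fun x => f x * g x).
Proof.
move=> [f1 f2] [g1 g2]; split.
  under eq_fun do rewrite ReMi.
  by apply: measurable_funB; exact: measurable_funM.
under eq_fun do rewrite ImMi.
by apply: measurable_funD; exact: measurable_funM.
Qed.

(** Hoelder's inequality against the indicator of [D], which has finite norm because [mu D] is
    finite; the added 1 makes the constant positive. *)
Lemma integral_normc_le : exists2 K : R, 0 < K & forall f, cmeasurable f ->
  (\int[mu]_(x in D) (Normc.normc (f x))%:E <= K%:E * norm_Lp mu D 2 f)%E.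
Proof.
pose c := ('N[mu]_2%:E[EFin \o (\1_D : T -> R)])%E.
have cfin : (c < +oo)%E.
  rewrite /c unlock /=; apply: poweR_lty.
  rewrite (eq_integral (fun x => (\1_D x)%:E)) ?integral_indic ?setIT// => x _.
  rewrite /= indicE; case: (_ \in _); rewrite /= ?normr1 ?normr0.
    by rewrite powR1.
  by rewrite powR0.
exists (fine c + 1).
  by rewrite ltr_wpDl// fine_ge0// Lnorm_ge0.
move=> f mf; pose u := (fun x => Normc.normc (f x)) \_ D.
have mu_ : measurable_fun setT u.
  by apply/(measurable_restrictT _ mD).1; exact: measurable_normc.
have m1 : measurable_fun setT (\1_D : T -> R) by exact: measurable_indic.
have := @hoelder _ _ _ mu u (\1_D) 2 2 mu_ m1 ltac:(lra) ltac:(lra) ltac:(lra).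
rewrite Lnorm1 -/c.
have -> : norm_Lp mu D 2 f = ('N[mu]_2%:E[EFin \o u])%E.
  by rewrite /norm_Lp; congr ('N[mu]_(2%:E)[_])%E; rewrite -restrict_EFin.
move=> h; apply: le_trans (le_trans h _).
  rewrite integral_mkcond le_eqVlt; apply/orP; left; apply/eqP.
  have uE x : u x = if x \in D then Normc.normc (f x) else 0 by [].
  apply: eq_integral => x _; rewrite patchE/= uE indicE.
  case: (x \in D) => /=; last by rewrite mul0r normr0.
  by rewrite mulr1 ger0_norm// normc_ge0.
rewrite muleC; apply: lee_wpmul2r; first exact: Lnorm_ge0.
by rewrite EFinD fineK ?leeDl// ge0_fin_numE// Lnorm_ge0.
Qed.

Lemma normcMi (x y : R[i]) : Normc.normc (x * y) = Normc.normc x * Normc.normc y.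
Proof. exact: Normc.normcM. Qed.

Lemma normc_conj (x : R[i]) : Normc.normc (x^*) = Normc.normc x.
Proof. by rewrite !normcE ReCi ImCi sqrrN. Qed.

Section bounded_weight.
Variables (W : T -> R[i]) (M : R).
Hypotheses (mW : cmeasurable W) (WM : forall x, D x -> Normc.normc (W x) <= M).

Let M1 := `|M| + 1.
Let M1_gt0 : 0 < M1. Proof. by rewrite ltr_wpDl. Qed.

Let WM1 f x : D x -> Normc.normc (f x * W x) <= M1 * Normc.normc (f x).
Proof.
move=> /WM WxM; rewrite normcMi mulrC ler_wpM2r ?normc_ge0//.
by rewrite (le_trans WxM)// (le_trans (ler_norm _))// lerDl.
Qed.

Let normcM_integrable f : cmeasurable f -> (norm_Lp mu D 2 f < +oo)%E ->
  mu.-integrable D (fun x => (M1 * Normc.normc (f x))%:E).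
Proof.
move=> mf fy; have [K K0 KP] := integral_normc_le.
have : mu.-integrable D (fun x => (Normc.normc (f x))%:E).
  apply/integrableP; split; first exact/measurable_EFinP/measurable_normc.
  under eq_integral do rewrite /= ger0_norm ?normc_ge0//.
  by apply: le_lt_trans (KP f mf) _; rewrite lte_mul_pinfty// lee_fin ltW.
move/(integrableZl mD M1); exact: eq_integrable.
Qed.

Lemma cintegrable_L2M f : cmeasurable f -> (norm_Lp mu D 2 f < +oo)%E ->
  cintegrable (fun x => f x * W x).
Proof.
move=> mf fy; have i1 := normcM_integrable mf fy.
have [mr mi] := cmeasurableM mf mW.
split; apply: le_integrable i1 => //; try exact/measurable_EFinP.
- move=> x Dx; rewrite lee_fin (le_trans (Re_le_normc _))//.
  by rewrite (le_trans (WM1 _ Dx))// ler_norm.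
- move=> x Dx; rewrite lee_fin (le_trans (Im_le_normc _))//.
  by rewrite (le_trans (WM1 _ Dx))// ler_norm.
Qed.

Lemma cint_L2M_le : exists2 C : R, 0 < C & forall f, cmeasurable f ->
  (norm_Lp mu D 2 f < +oo)%E ->
  (`|complex.Re (cint mu D (fun x => (f x * W x)%R))|%:E <= C%:E * norm_Lp mu D 2 f)%E /\
  (`|complex.Im (cint mu D (fun x => (f x * W x)%R))|%:E <= C%:E * norm_Lp mu D 2 f)%E.
Proof.
have [K K0 KP] := integral_normc_le.
exists (M1 * K); first exact: mulr_gt0.
move=> f mf fy; have i1 := normcM_integrable mf fy.
have [ir ii] := cintegrable_L2M mf fy.
have key (u : T -> R) : mu.-integrable D (EFin \o u) ->
    (forall x, D x -> `|u x| <= M1 * Normc.normc (f x)) ->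
    (`|\int[mu]_(x in D) u x|%:E <= (M1 * K)%:E * norm_Lp mu D 2 f)%E.
  move=> iu uM; apply: (@le_trans _ _ (\int[mu]_(x in D) (M1 * Normc.normc (f x))%:E)%E).
    have mu_ : measurable_fun D (EFin \o u) by case/integrableP : iu.
    rewrite EFin_normr_Rintegral//; apply: (le_trans (le_abse_integral mu mD mu_)).
    apply: ge0_le_integral => //.
    - exact: measurableT_comp.
    - by case/integrableP : i1.
  under eq_integral do rewrite EFinM.
  rewrite ge0_integralZl//; last 3 first.
  - exact/measurable_EFinP/measurable_normc.
  - by move=> x _; rewrite lee_fin normc_ge0.
  - by rewrite lee_fin ltW.
  by rewrite EFinM -muleA lee_pmul2l//; exact: KP.
split; apply: key => // x Dx; apply: le_trans (WM1 _ Dx).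
  exact: Re_le_normc.
exact: Im_le_normc.
Qed.

(** The continuity on L^2 of the pairing with a bounded weight, the one limit argument of the proof:
    it serves for traces and for the Zernike expansion. *)
Lemma cint_L2M_small (g : nat -> T -> R[i]) : (forall n, cmeasurable (g n)) ->
  (fun n => norm_Lp mu D 2 (g n)) @ \oo --> 0%E ->
  forall e : R, 0 < e -> \forall n \near \oo,
    [/\ cintegrable (fun x => g n x * W x),
       `|complex.Re (cint mu D (fun x => g n x * W x))| < e &
       `|complex.Im (cint mu D (fun x => g n x * W x))| < e].
Proof.
move=> mg cg e e0; have [C C0 CP] := cint_L2M_le.
have : \forall n \near \oo, (norm_Lp mu D 2 (g n) < (e / C)%:E)%E.
  have eC : 0 < e / C by exact: divr_gt0.
  move/fine_cvgP : cg => [gfin /cvgr0_norm_lt /(_ _ eC)].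
  apply: filterS2 gfin => n gn; rewrite -lte_fin; apply: le_lt_trans.
  by rewrite -[leLHS]fineK// lee_fin ler_norm.
apply: filterS => n gn.
have gy : (norm_Lp mu D 2 (g n) < +oo)%E by apply: lt_trans gn (ltry _).
have [h1 h2] := CP _ (mg n) gy.
have Ce : (C%:E * norm_Lp mu D 2 (g n) < e%:E)%E.
  by rewrite (_ : e = C * (e / C)) ?EFinM ?lte_pmul2l// mulrC divfK// gt_eqF.
split; first exact: cintegrable_L2M.
  by rewrite -lte_fin; exact: le_lt_trans Ce.
by rewrite -lte_fin; exact: le_lt_trans Ce.
Qed.

End bounded_weight.

End cint_theory.

(** * Polynomial functions and their gradients *)

Section real_C1.
Context {R : realType}.
Implicit Types f g : pt R -> R.

Lemma C1_cont f : C1 f -> continuous f. Proof. by case. Qed.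
Lemma C1_der f i x : C1 f -> derivable f x (basis3 R i). Proof. by case=> _ /(_ i)[]. Qed.
Lemma C1_partial f i : C1 f -> continuous (partial i f). Proof. by case=> _ /(_ i)[]. Qed.

Lemma partial_cst (c : R) i : partial i (fun=> c) = (fun=> 0).
Proof. by apply/funext => x; rewrite /partial derive_cst. Qed.

Lemma C1_cst (c : R) : C1 (fun=> c).
Proof.
split=> [|i]; first exact: continuous_cst_fun.
split=> [x|]; first exact: derivable_cst.
by rewrite partial_cst; exact: continuous_cst_fun.
Qed.

Lemma partialD f g i : (forall x, derivable f x (basis3 R i)) ->
  (forall x, derivable g x (basis3 R i)) ->
  partial i (fun x => f x + g x) = (fun x => partial i f x + partial i g x).
Proof. by move=> df dg; apply/funext => x; rewrite /partial (deriveD (df x) (dg x)). Qed.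

Lemma partialM f g i : (forall x, derivable f x (basis3 R i)) ->
  (forall x, derivable g x (basis3 R i)) ->
  partial i (fun x => f x * g x) =
  (fun x => partial i f x * g x + f x * partial i g x).
Proof.
move=> df dg; apply/funext => x; rewrite /partial (deriveM (df x) (dg x)).
by rewrite addrC /GRing.scale/= (mulrC (g x)).
Qed.

Lemma partialN f i : (forall x, derivable f x (basis3 R i)) ->
  partial i (fun x => - f x) = (fun x => - partial i f x).
Proof. by move=> df; apply/funext => x; rewrite /partial (deriveN (df x)). Qed.

Lemma C1D f g : C1 f -> C1 g -> C1 (fun x => f x + g x).
Proof.
move=> Cf Cg; split=> [|i]; first by apply: continuousD_fun; exact: C1_cont.
have df x := @C1_der f i x Cf; have dg x := @C1_der g i x Cg.
split=> [x|]; first exact: derivableD.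
by rewrite partialD//; apply: continuousD_fun; exact: C1_partial.
Qed.

Lemma C1N f : C1 f -> C1 (fun x => - f x).
Proof.
move=> Cf; split=> [|i]; first by apply: continuousN_fun; exact: C1_cont.
have df x := @C1_der f i x Cf.
split=> [x|]; first exact: derivableN.
by rewrite partialN//; apply: continuousN_fun; exact: C1_partial.
Qed.

Lemma C1M f g : C1 f -> C1 g -> C1 (fun x => f x * g x).
Proof.
move=> Cf Cg; split=> [|i]; first by apply: continuousM_fun; exact: C1_cont.
have df x := @C1_der f i x Cf; have dg x := @C1_der g i x Cg.
split=> [x|]; first exact: derivableM.
rewrite partialM//; apply: continuousD_fun; apply: continuousM_fun;
  by [exact: C1_partial|exact: C1_cont].
Qed.

Lemma coord_shift (i j : 'I_3) (h : R) (x : pt R) :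
  coord j (h *: basis3 R i + x) = h * (i == j)%:R + coord j x.
Proof.
have [->|->|->] := ord3P i; have [->|->|->] := ord3P j; rewrite /coord/=;
 by rewrite /GRing.scale/= ?mulr1 ?mulr0.
Qed.

Lemma coord_quotient_cvg (i j : 'I_3) (x : pt R) :
  (h^-1 *: ((coord j \o shift x) (h *: basis3 R i) - coord j x)) @[h --> 0^'] -->
  ((i == j)%:R : R).
Proof.
apply: (@cvg_trans _ ((fun=> ((i == j)%:R : R)) @ (0 : R)^')); last exact: cvg_cst.
apply: near_eq_cvg; near=> h.
rewrite /= coord_shift addrK /GRing.scale/= mulKf//.
by near: h; exact: nbhs_dnbhs_neq.
Unshelve. all: by end_near.
Qed.

Lemma derivable_coord (i j : 'I_3) (x : pt R) : derivable (@coord R j) x (basis3 R i).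
Proof. by apply/cvg_ex; exists (i == j)%:R; exact: coord_quotient_cvg. Qed.

Lemma partial_coord (i j : 'I_3) : partial i (@coord R j) = (fun=> (i == j)%:R).
Proof. by apply/funext => x; apply: cvg_lim => //; exact: coord_quotient_cvg. Qed.

Lemma continuous_coord (j : 'I_3) : continuous (@coord R j).
Proof.
by have [->|->|->] := ord3P j; [exact: continuous_x|exact: continuous_y|exact: continuous_z].
Qed.

Lemma C1_coord j : C1 (@coord R j).
Proof.
split=> [|i]; first exact: continuous_coord.
split=> [x|]; first exact: derivable_coord.
by rewrite partial_coord; exact: continuous_cst_fun.
Qed.

(** A predicate on functions rather than a type of polynomials in three variables. Being stable
    under [partial], it yields every regularity and integrability condition at once. *)
Inductive polyfun : (pt R -> R) -> Prop :=
| polyfun_cst c : polyfun (fun=> c)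
| polyfun_coord j : polyfun (coord j)
| polyfunD f g : polyfun f -> polyfun g -> polyfun (fun x => f x + g x)
| polyfunM f g : polyfun f -> polyfun g -> polyfun (fun x => f x * g x).

Lemma polyfun_C1 f : polyfun f -> C1 f.
Proof.
elim=> [c|j|{}f g _ Cf _ Cg|{}f g _ Cf _ Cg]; first exact: C1_cst.
- exact: C1_coord.
- exact: C1D.
- exact: C1M.
Qed.

Lemma polyfun_partial i f : polyfun f -> polyfun (partial i f).
Proof.
elim=> [c|j|{}f g pf pf' pg pg'|{}f g pf pf' pg pg'].
- by rewrite partial_cst; exact: polyfun_cst.
- by rewrite partial_coord; exact: polyfun_cst.
- rewrite partialD; try by move=> x; apply: C1_der; exact: polyfun_C1.
  exact: polyfunD.
- rewrite partialM; try by move=> x; apply: C1_der; exact: polyfun_C1.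
  by apply: polyfunD; exact: polyfunM.
Qed.

Lemma polyfunN f : polyfun f -> polyfun (fun x => - f x).
Proof.
move=> pf; rewrite (_ : (fun x => - f x) = (fun x => (-1) * f x)).
  by apply: polyfunM => //; exact: polyfun_cst.
by apply/funext => x; rewrite mulN1r.
Qed.

Lemma polyfun_class_C U k f : polyfun f -> class_C U k f.
Proof.
elim: k f => [|k IH] f pf /=; split=> //; try by move=> x _; exact: (C1_cont (polyfun_C1 pf)).
move=> i; split=> [x _|]; first exact: C1_der (polyfun_C1 pf).
by apply: IH; exact: polyfun_partial.
Qed.

Lemma smooth_C1 f : smooth f -> C1 f.
Proof.
move=> sf; have /= [cf pf] := sf 1%N; split=> [x|i]; first exact: cf.
have [df [cp _]] := pf i; split=> x; first exact: df.
exact: cp.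
Qed.

End real_C1.

Section complex_C1.
Context {R : realType}.
Implicit Types u v : pt R -> R[i].

Definition C1c u : Prop := C1 (fun x => complex.Re (u x)) /\ C1 (fun x => complex.Im (u x)).

Definition cpoly u : Prop :=
  polyfun (fun x => complex.Re (u x)) /\ polyfun (fun x => complex.Im (u x)).

Lemma cpoly_C1c u : cpoly u -> C1c u.
Proof. by move=> [p1 p2]; split; exact: polyfun_C1. Qed.

Lemma csmooth_C1c u : csmooth u -> C1c u.
Proof. by move=> [p1 p2]; split; exact: smooth_C1. Qed.

Lemma cpoly_csmooth u : cpoly u -> csmooth u.
Proof. by move=> [p1 p2]; split=> k; exact: polyfun_class_C. Qed.

Lemma C1cM u v : C1c u -> C1c v -> C1c (fun x => u x * v x).
Proof.
move=> [u1 u2] [v1 v2]; split.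
  by under eq_fun do rewrite ReMi; apply: C1D; [|apply: C1N]; exact: C1M.
by under eq_fun do rewrite ImMi; apply: C1D; exact: C1M.
Qed.

Lemma C1c_conj u : C1c u -> C1c (fun x => (u x)^*).
Proof.
move=> [u1 u2]; split; first by under eq_fun do rewrite ReCi.
by under eq_fun do rewrite ImCi; exact: C1N.
Qed.

Lemma C1c_real (f : pt R -> R) : C1 f -> C1c (fun x => (f x)%:C).
Proof. by move=> Cf; split=> //; exact: C1_cst. Qed.

Lemma C1c_cst (c : R[i]) : C1c (fun=> c).
Proof. by split; exact: C1_cst. Qed.

Lemma cpoly_cst (c : R[i]) : cpoly (fun=> c).
Proof. by split; exact: polyfun_cst. Qed.

Lemma cpoly_real (f : pt R -> R) : polyfun f -> cpoly (fun x => (f x)%:C).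
Proof. by move=> Cf; split=> //; exact: polyfun_cst. Qed.

Lemma cpolyD u v : cpoly u -> cpoly v -> cpoly (fun x => u x + v x).
Proof.
move=> [u1 u2] [v1 v2]; split.
  by under eq_fun do rewrite ReDi; exact: polyfunD.
by under eq_fun do rewrite ImDi; exact: polyfunD.
Qed.

Lemma cpolyM u v : cpoly u -> cpoly v -> cpoly (fun x => u x * v x).
Proof.
move=> [u1 u2] [v1 v2]; split.
  by under eq_fun do rewrite ReMi; apply: polyfunD; [|apply: polyfunN]; exact: polyfunM.
by under eq_fun do rewrite ImMi; apply: polyfunD; exact: polyfunM.
Qed.

Lemma cpoly_conj u : cpoly u -> cpoly (fun x => (u x)^*).
Proof.
move=> [u1 u2]; split; first by under eq_fun do rewrite ReCi.
by under eq_fun do rewrite ImCi; exact: polyfunN.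
Qed.

Lemma cpolyN u : cpoly u -> cpoly (fun x => - u x).
Proof.
move=> pu; rewrite (_ : (fun x => - u x) = (fun x => (-1) * u x)).
  by apply: cpolyM => //; exact: cpoly_cst.
by apply/funext => x; rewrite mulN1r.
Qed.

Lemma cpolyX u n : cpoly u -> cpoly (fun x => u x ^+ n).
Proof.
move=> pu; elim: n => [|n IH]; first by apply: cpoly_cst.
rewrite (_ : (fun x => _) = (fun x => u x * u x ^+ n)); first exact: cpolyM.
by apply/funext => x; rewrite exprS.
Qed.

Lemma cpoly_sum (I : Type) (s : seq I) (F : I -> pt R -> R[i]) :
  (forall i, cpoly (F i)) -> cpoly (fun x => \sum_(i <- s) F i x).
Proof.
move=> pF; elim: s => [|i s IH].
  rewrite (_ : (fun x => _) = (fun=> 0)); first exact: cpoly_cst.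
  by apply/funext => x; rewrite big_nil.
rewrite (_ : (fun x => _) = (fun x => F i x + \sum_(i <- s) F i x)); first exact: cpolyD.
by apply/funext => x; rewrite big_cons.
Qed.

Lemma cpoly_grad u i : cpoly u -> cpoly (grad u i).
Proof. by move=> [u1 u2]; split; exact: polyfun_partial. Qed.

Lemma gradD u v i x : C1c u -> C1c v ->
  grad (fun x => u x + v x) i x = grad u i x + grad v i x.
Proof.
move=> [u1 u2] [v1 v2]; rewrite /grad (eq_fun (fun y => ReDi (u y) (v y))).
rewrite (eq_fun (fun y => ImDi (u y) (v y))).
by rewrite !partialD//; move=> y; exact: C1_der.
Qed.

Lemma gradM u v i x : C1c u -> C1c v ->
  grad (fun x => u x * v x) i x = grad u i x * v x + u x * grad v i x.
Proof.
move=> Cu Cv; have [u1 u2] := Cu; have [v1 v2] := Cv.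
have d f : C1 f -> forall y, derivable f y (basis3 R i) by move=> h y; exact: C1_der.
rewrite /grad (eq_fun (fun y => ReMi (u y) (v y))).
rewrite (eq_fun (fun y => ImMi (u y) (v y))).
apply: eq_complexP; rewrite ?ReDi ?ImDi.
  rewrite !ReMi /= partialD; try by apply: d; do ?apply: C1N; exact: C1M.
  rewrite partialN; last by apply: d; exact: C1M.
  by rewrite !partialM//; try exact: d; ring.
rewrite !ImMi /= partialD; try by apply: d; exact: C1M.
by rewrite !partialM//; try exact: d; ring.
Qed.

Lemma grad_cst (c : R[i]) i x : grad (fun=> c) i x = 0.
Proof. by rewrite /grad !partial_cst; exact: eq_complexP. Qed.

Lemma grad_conj u i x : C1c u -> grad (fun x => (u x)^*) i x = (grad u i x)^*.
Proof.
move=> [u1 u2]; rewrite /grad (eq_fun (fun y => ReCi (u y))) (eq_fun (fun y => ImCi (u y))).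
by rewrite partialN// => y; exact: C1_der.
Qed.

Lemma grad_real (f : pt R -> R) i x :
  grad (fun x => (f x)%:C) i x = (partial i f x)%:C.
Proof. by rewrite /grad/= partial_cst. Qed.

Lemma gradZ (c : R[i]) u i x : C1c u -> grad (fun x => c * u x) i x = c * grad u i x.
Proof.
by move=> Cu; rewrite gradM//; [rewrite grad_cst mul0r add0r|exact: C1c_cst].
Qed.

Lemma grad_sum (I : Type) (s : seq I) (F : I -> pt R -> R[i]) i x :
  (forall j, cpoly (F j)) ->
  grad (fun x => \sum_(j <- s) F j x) i x = \sum_(j <- s) grad (F j) i x.
Proof.
move=> pF; elim: s => [|j s IH].
  rewrite big_nil (_ : (fun x => _) = (fun=> 0)) ?grad_cst//.
  by apply/funext => y; rewrite big_nil.
rewrite big_cons -IH -gradD; [|exact: cpoly_C1c|by apply: cpoly_C1c; exact: cpoly_sum].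
by congr (grad _ i x); apply/funext => y; rewrite big_cons.
Qed.

Definition ccont u : Prop :=
  continuous (fun x => complex.Re (u x)) /\ continuous (fun x => complex.Im (u x)).

Lemma C1c_ccont u : C1c u -> ccont u.
Proof. by move=> [[? _] [? _]]. Qed.

Lemma C1c_grad_ccont u i : C1c u -> ccont (grad u i).
Proof. by move=> [h1 h2]; split; exact: C1_partial. Qed.

Lemma ccontM u v : ccont u -> ccont v -> ccont (fun x => u x * v x).
Proof.
move=> [u1 u2] [v1 v2]; split.
  by under eq_fun do rewrite ReMi; apply: continuousB_fun; exact: continuousM_fun.
by under eq_fun do rewrite ImMi; apply: continuousD_fun; exact: continuousM_fun.
Qed.

Lemma ccont_conj u : ccont u -> ccont (fun x => (u x)^*).
Proof.
move=> [u1 u2]; split; first by under eq_fun do rewrite ReCi.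
by under eq_fun do rewrite ImCi; exact: continuousN_fun.
Qed.

Lemma ccont_ball u : ccont u -> cintegrable (leb3 R) (@ball3 R) u.
Proof. by move=> [u1 u2]; split; exact: continuous_integrable_ball. Qed.

Lemma ccont_sphere u : ccont u -> cintegrable (dS R) (@sphere R) u.
Proof. by move=> [u1 u2]; split; exact: continuous_integrable_sphere. Qed.

Lemma ccont_cmeasurable u (D : set (mpt R)) : ccont u -> cmeasurable D u.
Proof.
by move=> [u1 u2]; split; apply: measurable_funTS; exact: continuous_measurable3.
Qed.

Lemma ccont_bounded_cube u : ccont u ->
  exists M : R, forall x, cube x -> Normc.normc (u x) <= M.
Proof.
move=> [u1 u2].
have cn : continuous (fun x => Normc.normc (u x)).
  rewrite (eq_fun (fun y => normcE (u y))).
  by apply: continuous_sqrt_fun; apply: continuousD_fun; exact: continuousX_fun.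
have [M _ MP] := continuous_bounded_cube cn; exists M => x cx.
by apply: le_trans (MP x cx); exact: ler_norm.
Qed.

Lemma cdivergence u i : C1c u ->
  cint (leb3 R) (@ball3 R) (grad u i) =
  cint (dS R) (@sphere R) (fun x => u x * (coord i x)%:C).
Proof.
move=> [u1 u2]; apply: eq_complexP => /=.
  rewrite divergence//; apply: eq_Rintegral => x _.
  by rewrite ReMi /= mulr0 subr0.
rewrite divergence//; apply: eq_Rintegral => x _.
by rewrite ImMi /= mulr0 add0r.
Qed.

End complex_C1.

(** * Homogeneous polynomials and Green's formula *)

Section green.
Context {R : realType}.
Implicit Types u v : pt R -> R[i].

Definition cc (i : 'I_3) (x : pt R) : R[i] := (coord i x)%:C.
Definition r2 (x : pt R) : R[i] := \sum_(i < 3) cc i x * cc i x.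
Definition lap u (x : pt R) : R[i] := \sum_(i < 3) grad (grad u i) i x.
Opaque grad.

(** Homogeneity of degree [n], expressed by Euler's identity since only the radial derivative is
    ever needed. *)
Definition euler (n : nat) u : Prop :=
  forall x, \sum_(i < 3) cc i x * grad u i x = n%:R * u x.

Lemma sum3 (V : zmodType) (F : 'I_3 -> V) : \sum_(i < 3) F i = F i0 + F i1 + F i2.
Proof.
rewrite !big_ord_recl big_ord0 addr0 addrA.
by congr (F _ + F _ + F _); exact: val_inj.
Qed.

Lemma r2E x : r2 x = (nrm2 x)%:C.
Proof. by rewrite /r2 sum3 /cc /coord /nrm2/= -!rmorphM -!rmorphD -!expr2. Qed.

Lemma cpoly_cc i : cpoly (cc i).
Proof. by apply: cpoly_real; exact: polyfun_coord. Qed.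

Lemma cpoly_r2 : cpoly r2.
Proof. by apply: cpoly_sum => i; apply: cpolyM; exact: cpoly_cc. Qed.

Lemma grad_cc i j x : grad (cc j) i x = (i == j)%:R.
Proof. by rewrite grad_real partial_coord; case: (i == j). Qed.

Lemma grad_r2 i x : grad r2 i x = 2 * cc i x.
Proof.
rewrite grad_sum => [|j]; last by apply: cpolyM; exact: cpoly_cc.
rewrite (bigD1 i)//= big1 ?addr0 => [|j ji].
  by rewrite gradM; try exact/cpoly_C1c/cpoly_cc; rewrite grad_cc eqxx mulr1n; ring.
rewrite gradM; try exact/cpoly_C1c/cpoly_cc.
by rewrite grad_cc eq_sym (negbTE ji) mul0r mulr0 addr0.
Qed.

Lemma gradX u n i x : cpoly u ->
  grad (fun x => u x ^+ n) i x = n%:R * u x ^+ n.-1 * grad u i x.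
Proof.
move=> pu; case: n => [|n].
  by rewrite (_ : (fun x => _) = (fun=> 1)) ?grad_cst ?mul0r.
elim: n x => [|n IH] x; first by rewrite /= expr0 mulr1 mul1r.
have -> : (fun x => u x ^+ n.+2) = (fun x => u x * u x ^+ n.+1).
  by apply/funext => y; rewrite exprS.
rewrite gradM; [|exact: cpoly_C1c|by apply: cpoly_C1c; exact: cpolyX].
by rewrite IH/= -[n.+2%:R]natr1 exprS; ring.
Qed.

Lemma lapM u v x : cpoly u -> cpoly v ->
  lap (fun x => u x * v x) x =
  lap u x * v x + 2 * (\sum_(i < 3) grad u i x * grad v i x) + u x * lap v x.
Proof.
move=> pu pv; have Cu := cpoly_C1c pu; have Cv := cpoly_C1c pv.
have Cgu i := cpoly_C1c (cpoly_grad i pu); have Cgv i := cpoly_C1c (cpoly_grad i pv).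
have e i : grad (grad (fun x => u x * v x) i) i x =
    grad (grad u i) i x * v x + 2 * (grad u i x * grad v i x) + u x * grad (grad v i) i x.
  have -> : grad (fun x => u x * v x) i = (fun x => grad u i x * v x + u x * grad v i x).
    by apply/funext => y; exact: gradM.
  etransitivity; first exact: (gradD i x (C1cM (Cgu i) Cv) (C1cM Cu (Cgv i))).
  etransitivity.
    exact: (congr2 +%R (gradM i x (Cgu i) Cv) (gradM i x Cu (Cgv i))).
  by rewrite mulr2n mulrDl mul1r !addrA.
etransitivity; first by apply: eq_bigr => i _; exact: e.
by rewrite !big_split/= mulr_suml !mulr_sumr.
Qed.

Lemma lapD u v x : cpoly u -> cpoly v -> lap (fun x => u x + v x) x = lap u x + lap v x.
Proof.
move=> pu pv; have Cu := cpoly_C1c pu; have Cv := cpoly_C1c pv.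
have e i : grad (grad (fun x => u x + v x) i) i x = grad (grad u i) i x + grad (grad v i) i x.
  have -> : grad (fun x => u x + v x) i = (fun x => grad u i x + grad v i x).
    by apply/funext => y; exact: gradD.
  by apply: gradD; apply: cpoly_C1c; exact: cpoly_grad.
by etransitivity; [by apply: eq_bigr => i _; exact: e|rewrite big_split].
Qed.

Lemma lap_cst (c : R[i]) x : lap (fun=> c) x = 0.
Proof.
rewrite /lap big1// => i _; rewrite (_ : grad (fun=> c) i = fun=> 0) ?grad_cst//.
by apply/funext => y; exact: grad_cst.
Qed.

Lemma lapZ (c : R[i]) u x : cpoly u -> lap (fun x => c * u x) x = c * lap u x.
Proof.
move=> pu; rewrite lapM//; last exact: cpoly_cst.
rewrite lap_cst mul0r add0r big1 ?mulr0 ?add0r// => i _.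
by rewrite grad_cst mul0r.
Qed.

Lemma lap_sum (I : Type) (s : seq I) (F : I -> pt R -> R[i]) x :
  (forall j, cpoly (F j)) ->
  lap (fun x => \sum_(j <- s) F j x) x = \sum_(j <- s) lap (F j) x.
Proof.
move=> pF; elim: s => [|j s IH].
  rewrite big_nil (_ : (fun x => _) = (fun=> 0)) ?lap_cst//.
  by apply/funext => y; rewrite big_nil.
have -> : (fun x => \sum_(j <- j :: s) F j x) = (fun x => F j x + \sum_(j <- s) F j x).
  by apply/funext => y; rewrite big_cons.
etransitivity; first exact: (lapD x (pF j) (cpoly_sum s pF)).
by rewrite IH big_cons.
Qed.

Lemma lap_conj u x : cpoly u -> lap (fun x => (u x)^*) x = (lap u x)^*.
Proof.
move=> pu; have Cu := cpoly_C1c pu.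
have e i : grad (grad (fun x => (u x)^*) i) i x = (grad (grad u i) i x)^*.
  have -> : grad (fun x => (u x)^*) i = (fun x => (grad u i x)^*).
    by apply/funext => y; exact: grad_conj.
  by apply: grad_conj; apply: cpoly_C1c; exact: cpoly_grad.
by etransitivity; [by apply: eq_bigr => i _; exact: e|rewrite -rmorph_sum].
Qed.

Lemma eulerM m n u v : cpoly u -> cpoly v -> euler m u -> euler n v ->
  euler (m + n) (fun x => u x * v x).
Proof.
move=> pu pv eu ev x.
have Cu := cpoly_C1c pu; have Cv := cpoly_C1c pv.
have e i : cc i x * grad (fun x => u x * v x) i x =
    (cc i x * grad u i x) * v x + u x * (cc i x * grad v i x).
  by rewrite mulrCA -mulrA -mulrDr; congr (_ * _); exact: gradM.
etransitivity; first by apply: eq_bigr => i _; exact: e.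
rewrite big_split/= -mulr_suml -mulr_sumr (eu x) (ev x) natrD mulrDl.
by rewrite -mulrA (mulrCA (u x)).
Qed.

Lemma eulerD n u v : cpoly u -> cpoly v -> euler n u -> euler n v ->
  euler n (fun x => u x + v x).
Proof.
move=> pu pv eu ev x.
have e i : cc i x * grad (fun x => u x + v x) i x = cc i x * grad u i x + cc i x * grad v i x.
  by rewrite -mulrDr; congr (_ * _); apply: gradD; exact: cpoly_C1c.
etransitivity; first by apply: eq_bigr => i _; exact: e.
by rewrite big_split/= (eu x) (ev x) -mulrDr.
Qed.

Lemma euler_cst (c : R[i]) : euler 0 (fun=> c).
Proof. by move=> x; rewrite mul0r big1// => i _; rewrite grad_cst mulr0. Qed.

Lemma eulerZ n (c : R[i]) u : cpoly u -> euler n u -> euler n (fun x => c * u x).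
Proof.
move=> pu eu; have := eulerM (cpoly_cst c) pu (euler_cst c) eu.
by rewrite add0n.
Qed.

Lemma euler0 n : euler n (fun=> 0).
Proof. by move=> x; rewrite mulr0 big1// => i _; rewrite grad_cst mulr0. Qed.

Lemma euler_sum (I : Type) (s : seq I) (F : I -> pt R -> R[i]) n :
  (forall j, cpoly (F j)) -> (forall j, euler n (F j)) ->
  euler n (fun x => \sum_(j <- s) F j x).
Proof.
move=> pF eF; elim: s => [|j s IH].
  rewrite (_ : (fun x => _) = (fun=> 0)); first exact: euler0.
  by apply/funext => y; rewrite big_nil.
rewrite (_ : (fun x => _) = (fun x => F j x + \sum_(j <- s) F j x)).
  by apply: eulerD => //; exact: cpoly_sum.
by apply/funext => y; rewrite big_cons.
Qed.

Lemma eulerX m n u : cpoly u -> euler m u -> euler (m * n) (fun x => u x ^+ n).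
Proof.
move=> pu eu; elim: n => [|n IH].
  by rewrite muln0; exact: euler_cst.
rewrite mulnS (_ : (fun x => _) = (fun x => u x * u x ^+ n)).
  by apply: eulerM => //; exact: cpolyX.
by apply/funext => y; rewrite exprS.
Qed.

Lemma euler_cc i : euler 1 (cc i).
Proof.
move=> x; rewrite mul1r (bigD1 i)//= big1 ?addr0 => [|j ji].
  by rewrite grad_cc eqxx mulr1n mulr1.
by rewrite grad_cc (negbTE ji) mulr0.
Qed.

Lemma euler_r2 : euler 2 r2.
Proof.
by apply: euler_sum => i; [apply: cpolyM; exact: cpoly_cc|];
  apply: (@eulerM 1 1); do ?exact: cpoly_cc; exact: euler_cc.
Qed.

Lemma euler_conj n u : cpoly u -> euler n u -> euler n (fun x => (u x)^*).
Proof.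
move=> pu eu x; have Cu := cpoly_C1c pu.
have e i : cc i x * grad (fun x => (u x)^*) i x = (cc i x * grad u i x)^*.
  have ccr : (cc i x)^* = cc i x by exact: conjc_real.
  rewrite (grad_conj i x Cu) rmorphM; congr (_ * _); exact: esym ccr.
etransitivity; first by apply: eq_bigr => i _; exact: e.
by rewrite -rmorph_sum (eu x) rmorphM/= conjc_nat.
Qed.

Lemma r2_sphere x : sphere x -> r2 x = 1.
Proof. by rewrite r2E sphereE/= => ->. Qed.

Local Notation B := (@ball3 R).
Local Notation S := (@sphere R).

Lemma cpoly_ball u : cpoly u -> cintegrable (leb3 R) B u.
Proof. by move=> pu; apply/ccont_ball/C1c_ccont/cpoly_C1c. Qed.

Lemma cpoly_sphere u : cpoly u -> cintegrable (dS R) S u.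
Proof. by move=> pu; apply/ccont_sphere/C1c_ccont/cpoly_C1c. Qed.

Lemma cdivergence_sum (V : 'I_3 -> pt R -> R[i]) : (forall i, C1c (V i)) ->
  cint (leb3 R) B (fun x => \sum_(i < 3) grad (V i) i x) =
  cint (dS R) S (fun x => \sum_(i < 3) V i x * cc i x).
Proof.
move=> CV; rewrite !cint_sum; try exact: measurable_ball3; try exact: measurable_sphere.
- by apply: eq_bigr => i _; exact: cdivergence.
- move=> i; apply: ccont_sphere; apply: ccontM; first exact: C1c_ccont.
  exact/C1c_ccont/cpoly_C1c/cpoly_cc.
- by move=> i; apply: ccont_ball; exact: C1c_grad_ccont.
Qed.

(** The field u(x) x has divergence (n + 3) u, and its normal component on the unit sphere is u. *)
Lemma cint_ball_euler n u : cpoly u -> euler n u ->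
  (n + 3)%:R * cint (leb3 R) B u = cint (dS R) S u.
Proof.
move=> pu eu.
rewrite -cintZ; [|exact: measurable_ball3|exact: cpoly_ball].
transitivity (cint (leb3 R) B (fun x => \sum_(i < 3) grad (fun x => u x * cc i x) i x)).
  apply: eq_cint => x _.
  have e i : grad (fun x => u x * cc i x) i x = cc i x * grad u i x + u x.
    etransitivity; first exact: (gradM i x (cpoly_C1c pu) (cpoly_C1c (cpoly_cc i))).
    by rewrite grad_cc eqxx mulr1 mulrC.
  rewrite (eq_bigr _ (fun i _ => e i)) big_split/= (eu x) sumr_const card_ord.
  by rewrite natrD mulrDl !mulr_natl.
rewrite cdivergence_sum; last first.
  by move=> i; apply: cpoly_C1c; apply: cpolyM => //; exact: cpoly_cc.
apply: eq_cint => x /r2_sphere; rewrite /r2 => h.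
under eq_bigr do rewrite -mulrA.
by rewrite -mulr_sumr h mulr1.
Qed.

Section ring_identities.
Variable K : comNzRingType.
Implicit Types a b c d e f : K.

Fact green_ring1 a b c d e f :
  (a * b + c * d) + -1 * (b * a + e * f) = c * d - e * f.
Proof. ring. Qed.

Fact green_ring2 a b c d : a * (c * b) - b * (d * a) = (c - d) * (a * b).
Proof. ring. Qed.

Fact green_ring3 a b c d e :
  (a + b + c + d) * ((c - b) * e) - (c - b) * (a * e) = (c - b) * (c + b + d) * e.
Proof. ring. Qed.

Fact green_ring4 a b c d : a * (b * c * d) = c * (b * (a * d)).
Proof. ring. Qed.

Fact green_ring5 a b c d : a * b * (c * d) = c * a * b * d.
Proof. ring. Qed.

Fact green_ring6 a b c d e f :
  a * b * d + c * (e - f) = c * e - c * f + a * (b * d).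
Proof. ring. Qed.

Fact green_ring7 a b c d e f : a - b * (c * 0) + d * e * f = a + d * (e * f).
Proof. ring. Qed.

Fact green_ring8 a b c d e : a + b * (c * (d * e)) = a + b * d * (c * e).
Proof. ring. Qed.

Fact sum_lincomb3 (P a b c : K) (u v s : 'I_3 -> K) :
  \sum_(i < 3) (P * (a * u i) - P * (b * v i) + c * s i) =
  P * (a * \sum_(i < 3) u i) - P * (b * \sum_(i < 3) v i) + c * \sum_(i < 3) s i.
Proof. by rewrite !big_split/= sumrN -!mulr_sumr. Qed.

End ring_identities.

(* The field r^(2j) (h grad w - w grad h) has divergence
   r^(2j) h lap w + 2 j (N - L) r^(2j - 2) h w. *)
Lemma green_moment (L N j : nat) h w : cpoly h -> cpoly w ->
  euler L h -> euler N w -> (forall x, lap h x = 0) ->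
  (2 * j + L + N + 1)%:R * cint (leb3 R) B (fun x => r2 x ^+ j * (h x * lap w x)) =
  (N%:R - L%:R) * (N + L + 1)%:R * cint (dS R) S (fun x => h x * w x).
Proof.
move=> ph pw eh ew hh.
have Ch := cpoly_C1c ph; have Cw := cpoly_C1c pw.
have pr n : cpoly (fun x => r2 x ^+ n) by apply: cpolyX; exact: cpoly_r2.
have pgh i := cpoly_grad i ph; have pgw i := cpoly_grad i pw.
have plw : cpoly (lap w).
  by apply: cpoly_sum => i; apply: cpoly_grad; exact: cpoly_grad.
have phw : cpoly (fun x => h x * w x) by exact: cpolyM.
pose A i x := h x * grad w i x - w x * grad h i x.
have pA i : cpoly (A i) by apply: cpolyD; [exact: cpolyM|apply: cpolyN; exact: cpolyM].
pose V i x := r2 x ^+ j * A i x.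
have pV i : cpoly (V i) by exact: cpolyM.
have gA i x : grad (A i) i x = h x * grad (grad w i) i x - w x * grad (grad h i) i x.
  have -> : A i = (fun x => h x * grad w i x + (- 1) * (w x * grad h i x)).
    by apply/funext => y; rewrite mulN1r.
  have p1 : cpoly (fun x => h x * grad w i x) by exact: cpolyM.
  have p2 : cpoly (fun x => w x * grad h i x) by exact: cpolyM.
  have p3 : cpoly (fun x => (- 1) * (w x * grad h i x)).
    by apply: cpolyM => //; exact: cpoly_cst.
  etransitivity; first exact: (gradD i x (cpoly_C1c p1) (cpoly_C1c p3)).
  rewrite (gradZ (-1) i x (cpoly_C1c p2)).
  rewrite (gradM i x Ch (cpoly_C1c (pgw i))) (gradM i x Cw (cpoly_C1c (pgh i))).
  exact: green_ring1.
have gr i x : grad (fun x => r2 x ^+ j) i x = (2 * j)%:R * r2 x ^+ j.-1 * cc i x.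
  rewrite (gradX j i x cpoly_r2) grad_r2 natrM; exact: green_ring5.
have sA x : \sum_(i < 3) cc i x * A i x = (N%:R - L%:R) * (h x * w x).
  have e i : cc i x * A i x = h x * (cc i x * grad w i x) - w x * (cc i x * grad h i x).
    by rewrite /A mulrBr mulrCA [X in _ - X]mulrCA.
  rewrite (eq_bigr _ (fun i _ => e i)) big_split/= sumrN -!mulr_sumr (ew x) (eh x).
  exact: green_ring2.
have div x : \sum_(i < 3) grad (V i) i x =
    r2 x ^+ j * (h x * lap w x) +
    ((2 * j)%:R * (N%:R - L%:R)) * (r2 x ^+ j.-1 * (h x * w x)).
  have e i : grad (V i) i x =
     r2 x ^+ j * (h x * grad (grad w i) i x) - r2 x ^+ j * (w x * grad (grad h i) i x) +
     (2 * j)%:R * r2 x ^+ j.-1 * (cc i x * A i x).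
    etransitivity; first exact: (gradM i x (cpoly_C1c (pr j)) (cpoly_C1c (pA i))).
    etransitivity.
      exact: (congr2 (fun a b => a * A i x + r2 x ^+ j * b) (gr i x) (gA i x)).
    exact: green_ring6.
  etransitivity; first by apply: eq_bigr => i _; exact: e.
  etransitivity; first exact: sum_lincomb3.
  etransitivity.
    exact: (congr2 (fun b s => r2 x ^+ j * (h x * lap w x) - r2 x ^+ j * (w x * b) +
      (2 * j)%:R * r2 x ^+ j.-1 * s) (hh x) (sA x)).
  rewrite green_ring7; exact: green_ring8.
have phlw : cpoly (fun x => r2 x ^+ j * (h x * lap w x)).
  by apply: cpolyM => //; exact: cpolyM.
have prhw : cpoly (fun x => r2 x ^+ j.-1 * (h x * w x)) by exact: cpolyM.
set X := cint (leb3 R) B _; set S0 := cint (dS R) S _.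
pose Y0 := cint (leb3 R) B (fun x => r2 x ^+ j.-1 * (h x * w x)).
have E1 : X + ((2 * j)%:R * (N%:R - L%:R)) * Y0 = (N%:R - L%:R) * S0.
  rewrite /X /Y0 /S0 -cintZ; [|exact: measurable_ball3|exact: cpoly_ball].
  rewrite -cintD; [|exact: measurable_ball3|exact: cpoly_ball|]; last first.
    by apply: cpoly_ball; apply: cpolyM => //; exact: cpoly_cst.
  rewrite -cintZ; [|exact: measurable_sphere|exact: cpoly_sphere].
  transitivity (cint (leb3 R) B (fun x => \sum_(i < 3) grad (V i) i x)).
    apply: eq_cint => x _; exact: esym (div x).
  rewrite cdivergence_sum => [|i]; last exact: cpoly_C1c.
  apply: eq_cint => x /r2_sphere r1; rewrite -sA.
  by apply: eq_bigr => i _; rewrite /V r1 expr1n mul1r mulrC.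
(* The factor 2 j disposes of j = 0, where [j.-1] is not j - 1. For j > 0 the integrand of [Y0] is
   homogeneous of degree 2 (j - 1) + L + N, and [cint_ball_euler] applies. *)
have E2 : (2 * j)%:R * ((2 * j + L + N + 1)%:R * Y0) = (2 * j)%:R * S0.
  case: j @X @Y0 {V pV gr div phlw prhw E1} => [|j] /=; first by rewrite muln0 !mul0r.
  congr (_ * _).
  have pY : cpoly (fun x => r2 x ^+ j * (h x * w x)) by exact: cpolyM.
  have eY : euler (2 * j + (L + N)) (fun x => r2 x ^+ j * (h x * w x)).
    apply: eulerM => //; last exact: eulerM.
    by apply: eulerX; [exact: cpoly_r2|exact: euler_r2].
  rewrite -(_ : (2 * j + (L + N) + 3 = 2 * j.+1 + L + N + 1)%N); last by lia.
  rewrite (cint_ball_euler pY eY).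
  by apply: eq_cint => x /r2_sphere ->; rewrite expr1n mul1r.
have -> : X = (N%:R - L%:R) * S0 - ((2 * j)%:R * (N%:R - L%:R)) * Y0.
  by rewrite -E1 addrK.
rewrite mulrBr.
etransitivity; first exact: (congr1 (fun t => _ - t) (green_ring4 _ _ _ _)).
rewrite E2 !natrD; exact: green_ring3.
Qed.

End green.

(** * The Neumann problem with polynomial solutions *)

Section norms.
Context d (T : measurableType d) {R : realType}.
Variables (mu : {measure set T -> \bar R}) (D : set T).

Lemma norm_Lp0 (p : R) (f : T -> R[i]) : p != 0 -> (forall x, f x = 0) ->
  norm_Lp mu D p f = 0%E.
Proof.
move=> p0 f0; rewrite /norm_Lp -[RHS](@Lnorm0 _ _ _ mu p%:E)//.
apply: eq_Lnorm => x; rewrite patchE f0 normcE/= expr0n/= addr0 sqrtr0.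
by case: ifP.
Qed.

Lemma norm_Lp_conj (p : R) (f g : T -> R[i]) :
  (forall x, f x = (g x)^*) -> norm_Lp mu D p f = norm_Lp mu D p g.
Proof.
move=> fg; rewrite /norm_Lp; apply: eq_Lnorm => x; rewrite !patchE.
by case: ifP => // _; rewrite fg normc_conj.
Qed.

Lemma mem_Lp_bounded (f : T -> R[i]) (M : R) : measurable D -> (mu D < +oo)%E ->
  cmeasurable D f -> (forall x, D x -> Normc.normc (f x) <= M) -> mem_Lp mu D 2 f.
Proof.
move=> mD muD mf fM; have [m1 m2] := mf; split => //.
rewrite /norm_Lp unlock; apply: poweR_lty.
apply: (@le_lt_trans _ _ (\int[mu]_(x in D) ((`|M| + 1) `^ 2)%:E)%E).
  rewrite [leRHS]integral_mkcond; apply: ge0_le_integral => //.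
  - by move=> x _; exact: poweR_ge0.
  - apply: (measurableT_comp (measurable_poweR _)).
    apply: measurableT_comp => //.
    apply/(measurable_restrictT _ mD).1; apply/measurable_EFinP.
    exact: measurable_normc.
  - apply/(measurable_restrictT _ mD).1; exact: measurable_cst.
  - move=> x _; rewrite !patchE; case: ifPn => xD.
      rewrite inE in xD.
      rewrite /= lee_fin ger0_norm ?normc_ge0// ge0_ler_powR// ?nnegrE ?normc_ge0 ?addr_ge0//.
      by apply: (le_trans (fM x xD)); rewrite (le_trans (ler_norm M))// lerDl.
    by rewrite /= normr0 powR0// lee_fin.
by rewrite integral_cst// lte_mul_pinfty// lee_fin powR_ge0.
Qed.

End norms.

Section neumann.
Context {R : realType}.
Implicit Types u v f : pt R -> R[i].
Local Notation B := (@ball3 R).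
Local Notation S := (@sphere R).

Lemma ccont_mem_L2_ball u : ccont u -> mem_Lp (leb3 R) B 2 u.
Proof.
move=> cu; have [M MP] := ccont_bounded_cube cu.
apply: (@mem_Lp_bounded _ _ _ _ _ _ M).
- exact: measurable_ball3.
- exact: leb3_ball_fin.
- exact: ccont_cmeasurable.
- by move=> x /ball3_cube; exact: MP.
Qed.

Lemma ccont_mem_L2_sphere u : ccont u -> mem_Lp (dS R) S 2 u.
Proof.
move=> cu; have [M MP] := ccont_bounded_cube cu.
apply: (@mem_Lp_bounded _ _ _ _ _ _ M).
- exact: measurable_sphere.
- exact: surface_sphere_fin.
- exact: ccont_cmeasurable.
- by move=> x /sphere_cube; exact: MP.
Qed.

Lemma test_function_sphere (phi : pt R -> R) x : test_function phi -> S x -> phi x = 0.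
Proof.
move=> [_ supp] Sx; apply/eqP/negPn/negP => px.
have : B x by apply: supp; exact: subset_closure.
by rewrite /ball3/= (Sx : enorm x = 1) ltxx.
Qed.

Lemma H1_poly u : cpoly u -> H1 u (grad u).
Proof.
move=> pu; have Cu := cpoly_C1c pu; split.
- exact/ccont_mem_L2_ball/C1c_ccont.
- by move=> i; exact/ccont_mem_L2_ball/C1c_grad_ccont.
move=> i phi tphi; have Cphi := C1c_real (smooth_C1 (proj1 tphi)).
have ig : ccont (fun x => u x * (partial i phi x)%:C).
  apply: ccontM; first exact: C1c_ccont.
  by split; [exact: C1_partial (smooth_C1 (proj1 tphi))|exact: continuous_cst_fun].
have ih : ccont (fun x => grad u i x * (phi x)%:C).
  by apply: ccontM; [exact: C1c_grad_ccont|exact: C1c_ccont].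
apply/eqP; rewrite -subr_eq0 opprK -cintD; [|exact: measurable_ball3|exact: ccont_ball|exact: ccont_ball].
apply/eqP; transitivity (cint (leb3 R) B (grad (fun x => u x * (phi x)%:C) i)).
  apply: eq_cint => x _; apply/esym.
  etransitivity; first exact: (gradM i x Cu Cphi).
  by rewrite grad_real addrC.
rewrite cdivergence; last exact: C1cM.
rewrite -[RHS](@cint0 _ _ R (dS R) S); apply: eq_cint => x Sx.
by rewrite (test_function_sphere tphi Sx) mulr0 mul0r.
Qed.

(** A polynomial is smooth up to the boundary, so the constant sequence approximates it. *)
Lemma trace_poly u : cpoly u -> trace u (grad u) u.
Proof.
move=> pu; split; first exact/ccont_mem_L2_sphere/C1c_ccont/cpoly_C1c.
have z d (T : measurableType d) (mu : {measure set T -> \bar R}) D (g : T -> R[i]) :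
    (fun _ : nat => norm_Lp mu D 2 (fun x => g x - g x)) @ \oo --> 0%E.
  rewrite norm_Lp0 ?pnatr_eq0//; first exact: cvg_cst.
  by move=> x; rewrite subrr.
exists (fun=> u); split => [_|||].
- exact: cpoly_csmooth.
- exact: z.
- by move=> i; exact: z.
- exact: z.
Qed.

Lemma harmonic_poly u : cpoly u -> (forall x, lap u x = 0) -> harmonic_in_ball u.
Proof.
move=> [p1 p2] hu; split; [exact: polyfun_class_C|exact: polyfun_class_C|].
move=> x _; have h := hu x; split.
  by rewrite -[RHS](congr1 (@complex.Re R) h) /lap /laplacian !sum3 !ReDi.
by rewrite -[RHS](congr1 (@complex.Im R) h) /lap /laplacian !sum3 !ImDi.
Qed.

(** The divergence theorem for the field conj(v) grad u: on the unit sphere the normal derivative is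
    x . grad u, which is n u by homogeneity. *)
Lemma neumann_smooth u f v n : cpoly u -> (forall x, lap u x = 0) -> euler n u ->
  (forall x, S x -> f x = n%:R * u x) -> C1c v ->
  cint (leb3 R) B (fun x => \sum_(i < 3) grad u i x * (grad v i x)^*) =
  inner_L2 (dS R) S f v.
Proof.
move=> pu hu eu fu Cv; have Cv' := C1c_conj Cv.
have Cg i := cpoly_C1c (cpoly_grad i pu).
transitivity (cint (leb3 R) B (fun x => \sum_(i < 3) grad (fun x => grad u i x * (v x)^*) i x)).
  apply: eq_cint => x _; apply/esym.
  have e i : grad (fun x => grad u i x * (v x)^*) i x =
      grad (grad u i) i x * (v x)^* + grad u i x * (grad v i x)^*.
    etransitivity; first exact: (gradM i x (Cg i) Cv').
    by congr (_ + _ * _); exact: grad_conj.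
  etransitivity; first by apply: eq_bigr => i _; exact: e.
  rewrite big_split/= -mulr_suml.
  by rewrite -[X in X * _]/(lap u x) hu mul0r add0r.
rewrite cdivergence_sum; last by move=> i; exact: C1cM.
apply: eq_cint => x Sx; rewrite fu// -(eu x) mulr_suml.
by apply: eq_bigr => i _; rewrite mulrC mulrA.
Qed.

Lemma small_eq0 (z : R[i]) :
  (forall e : R, 0 < e -> `|complex.Re z| < e /\ `|complex.Im z| < e) -> z = 0.
Proof.
move=> h; apply: eq_complexP; apply/eqP; rewrite -normr_le0 leNgt; apply/negP => z0.
  by have [] := h _ z0; rewrite ltxx.
by have [_] := h _ z0; rewrite ltxx.
Qed.

Lemma small_combination (z a b c : R[i]) (e : R) :
  `|complex.Re a| < e / 4 -> `|complex.Im a| < e / 4 ->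
  `|complex.Re b| < e / 4 -> `|complex.Im b| < e / 4 ->
  `|complex.Re c| < e / 4 -> `|complex.Im c| < e / 4 ->
  `|complex.Re z| < e / 4 -> `|complex.Im z| < e / 4 ->
  `|complex.Re (z - (a + b + c))| < e /\ `|complex.Im (z - (a + b + c))| < e.
Proof.
rewrite ReDi ReNi !ReDi ImDi ImNi !ImDi !ltr_norml.
by do 8 move=> /andP[? ?]; split; apply/andP; split; lra.
Qed.

Lemma near4_ex (P Q P' Q' : nat -> Prop) :
  (\forall n \near \oo, P n) -> (\forall n \near \oo, Q n) ->
  (\forall n \near \oo, P' n) -> (\forall n \near \oo, Q' n) ->
  exists n, [/\ P n, Q n, P' n & Q' n].
Proof.
by move=> nP nQ nP' nQ'; near \oo => n; exists n; split; near: n.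
Unshelve. all: by end_near.
Qed.

(** The identity holds for the smooth functions [vn] that define the trace. The weights [grad u] and
    [n u] are bounded, so both sides pass to the limit in L^2. *)
Lemma neumann_trace_poly u f n : cpoly u -> (forall x, lap u x = 0) -> euler n u ->
  (forall x, S x -> f x = n%:R * u x) -> neumann_trace u f.
Proof.
move=> pu hu eu fu v Dv t [_ mDv _] [[mt1 mt2 tfin] [vn [svn _ cDv cvt]]].
have Cvn n' := csmooth_C1c (svn n').
have mB := @measurable_ball3 R; have mS := @measurable_sphere R.
have cu := C1c_ccont (cpoly_C1c pu).
have cg i := C1c_grad_ccont i (cpoly_C1c pu).
(* [f] is known on the sphere only; [F] is a polynomial that agrees with it there. *)
pose F x := n%:R * u x.
have CF : C1c F by apply: C1cM; [exact: C1c_cst|exact: cpoly_C1c].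
have cF := C1c_ccont CF.
have mcj (D : set (mpt R)) (g : mpt R -> R[i]) : cmeasurable D g -> cmeasurable D (fun x => (g x)^*).
  move=> [m1 m2]; split; first by rewrite (eq_fun (fun y => ReCi (g y))).
  by rewrite (eq_fun (fun y => ImCi (g y))); exact: measurable_funN.
have mB' (D : set (mpt R)) (g h : mpt R -> R[i]) :
    cmeasurable D g -> cmeasurable D h -> cmeasurable D (fun x => g x - h x).
  move=> [m1 m2] [m3 m4]; split.
    by under eq_fun do rewrite ReDi ReNi; exact: measurable_funB.
  by under eq_fun do rewrite ImDi ImNi; exact: measurable_funB.
have [MF MFP] := ccont_bounded_cube cF.
pose gt n' x := (vn n' x - t x)^*.
have gts := @cint_L2M_small _ _ _ (dS R) S mS surface_sphere_fin F MF
  (ccont_cmeasurable S cF) (fun x Sx => MFP x (sphere_cube Sx)) gt.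
pose gi i n' x := (grad (vn n') i x - Dv i x)^*.
have gis i : forall e : R, 0 < e -> \forall n' \near \oo,
    [/\ cintegrable (leb3 R) B (fun x => gi i n' x * grad u i x),
       `|complex.Re (cint (leb3 R) B (fun x => gi i n' x * grad u i x))| < e &
       `|complex.Im (cint (leb3 R) B (fun x => gi i n' x * grad u i x))| < e].
  have [Mg MgP] := ccont_bounded_cube (cg i).
  apply: (@cint_L2M_small _ _ _ (leb3 R) B mB leb3_ball_fin (grad u i) Mg).
  - exact: ccont_cmeasurable.
  - by move=> x /ball3_cube; exact: MgP.
  - move=> n'; apply: mcj; apply: mB'.
      by apply: ccont_cmeasurable; exact: C1c_grad_ccont.
    by have [] := mDv i.
  - have := cDv i; apply: cvg_trans; apply: near_eq_cvg; apply: nearW => n'.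
    exact/esym/norm_Lp_conj.
apply/eqP; rewrite -subr_eq0; apply/eqP; apply: small_eq0 => e e0.
(* Four errors are added: one for each component of the gradient and one for the boundary values. *)
have e4 : 0 < e / 4 by rewrite divr_gt0.
have gtn : \forall n' \near \oo,
    [/\ cintegrable (dS R) S (fun x => gt n' x * F x),
       `|complex.Re (cint (dS R) S (fun x => gt n' x * F x))| < e / 4 &
       `|complex.Im (cint (dS R) S (fun x => gt n' x * F x))| < e / 4].
  apply: gts => //.
    move=> n'; apply: mcj; apply: mB' => //.
    exact/ccont_cmeasurable/C1c_ccont.
  apply: cvg_trans cvt; apply: near_eq_cvg; apply: nearW => n'.
  exact/esym/norm_Lp_conj.
have [n0 [[j0 r0 m0] [j1 r1 m1] [j2 r2 m2] [jt rt mt]]] :=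
  near4_ex (gis i0 _ e4) (gis i1 _ e4) (gis i2 _ e4) gtn.
have ji i : cintegrable (leb3 R) B (fun x => gi i n0 x * grad u i x).
  by have [->|->|->] := ord3P i.
have jv i : cintegrable (leb3 R) B (fun x => grad u i x * (grad (vn n0) i x)^*).
  by apply: ccont_ball; apply: ccontM => //; apply: ccont_conj; exact: C1c_grad_ccont.
have jvt : cintegrable (dS R) S (fun x => F x * (vn n0 x)^*).
  by apply: ccont_sphere; apply: ccontM => //; apply: ccont_conj; exact: C1c_ccont.
have sub_int (g h k : pt R -> R[i]) (D : set (mpt R)) (mu : {measure set (mpt R) -> \bar R}) :
    measurable D -> cintegrable mu D (fun x => g x * (h x)^*) ->
    cintegrable mu D (fun x => (h x - k x)^* * g x) ->
    cintegrable mu D (fun x => g x * (k x)^*) /\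
    cint mu D (fun x => g x * (k x)^*) =
    cint mu D (fun x => g x * (h x)^*) - cint mu D (fun x => (h x - k x)^* * g x).
  move=> mD i1 i2.
  have e2 x : g x * (k x)^* = g x * (h x)^* - (h x - k x)^* * g x.
    by rewrite rmorphB/= mulrBl opprB addrC !(mulrC _ (g x)) subrK.
  split; last by rewrite -(cintB mD i1 i2); apply: eq_cint => x _; exact: e2.
  have := cintegrableD mD i1 (cintegrableZ mD (-1) i2).
  by apply: (eq_cintegrable mD) => x _; rewrite mulN1r -e2.
have hD i := sub_int _ _ (Dv i) _ _ mB (jv i) (ji i).
have [_ ht] := sub_int _ _ t _ _ mS jvt jt.
have -> : cint (leb3 R) B (fun x => \sum_(i < 3) grad u i x * (Dv i x)^*) =
    cint (leb3 R) B (fun x => \sum_(i < 3) grad u i x * (grad (vn n0) i x)^*) -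
    \sum_(i < 3) cint (leb3 R) B (fun x => gi i n0 x * grad u i x).
  rewrite !cint_sum//; last by move=> i; have [] := hD i.
  by rewrite -sumrB; apply: eq_bigr => i _; exact: (proj2 (hD i)).
rewrite (neumann_smooth pu hu eu fu (Cvn n0)).
have -> : inner_L2 (dS R) S f t = cint (dS R) S (fun x => F x * (t x)^*).
  by apply: eq_cint => x Sx; rewrite fu.
have -> : inner_L2 (dS R) S f (vn n0) = cint (dS R) S (fun x => F x * (vn n0 x)^*).
  by apply: eq_cint => x Sx; rewrite fu.
rewrite ht opprB addrCA [X in _ + X]addrAC subrr add0r.
rewrite -[X in X - _]/(cint (dS R) S (fun x => gt n0 x * F x)).
rewrite sum3; exact: small_combination.
Qed.

Lemma neumann_poly u f n : cpoly u -> (forall x, lap u x = 0) -> euler n u -> (0 < n)%N ->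
  (forall x, S x -> f x = n%:R * u x) -> neumann_solution f u.
Proof.
move=> pu hu eu n0 fu; split.
- exact: harmonic_poly.
- exact: neumann_trace_poly fu.
exists (grad u), u; split; [exact: H1_poly|exact: trace_poly|].
(* By homogeneity the left side is the flux of [grad u] through the sphere, hence the integral of
   the Laplacian of u, which is 0. *)
have e : n%:R * cint (dS R) S u = 0.
  rewrite -cintZ; [|exact: measurable_sphere|exact: cpoly_sphere].
  transitivity (cint (dS R) S (fun x => \sum_(i < 3) grad u i x * cc i x)).
    by apply: eq_cint => x _; rewrite -(eu x); apply: eq_bigr => i _; rewrite mulrC.
  rewrite -cdivergence_sum; last by move=> i; apply: cpoly_C1c; exact: cpoly_grad.
  by rewrite -[RHS](@cint0 _ _ R (leb3 R) B); apply: eq_cint => x _; exact: hu.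
move/eqP : e; rewrite mulf_eq0 pnatr_eq0 => /orP[/eqP n00|/eqP//].
by rewrite n00 in n0.
Qed.

End neumann.

(** * Solid and spherical harmonics *)

(** The induction step of [rodr_sym] for l = b + d + 2, freed of polynomials. The first two
    equations are [rodr_ode] at the orders l + b and l - b - 2: they express the outermost
    derivatives [z4] and [w0] through those for which the identity is known. The factor d + 1 is the
    one with which [w0] enters the second equation. *)
Lemma rodr_sym_step (K : idomainType) (d b f g X w0 w1 w2 z2 z3 z4 : K) (n : nat) :
  d + 1 != 0 ->
  (X ^+ 2 - 1) * z4 = 2 * (b + d + 1 + 1 - (b + b + d + 1 + 1) - 1) * X * z3 +
    (b + b + d + 1 + 1 + 1) * (2 * (b + d + 1 + 1) - (b + b + d + 1 + 1)) * z2 ->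
  (X ^+ 2 - 1) * w2 = 2 * (b + d + 1 + 1 - d - 1) * X * w1 +
    (d + 1) * (2 * (b + d + 1 + 1) - d) * w0 ->
  (d + 1 + 1) * ((d + 1) * f) * ((X ^+ 2 - 1) ^+ n * z2) =
    (b + b + d + 1 + 1) * ((b + b + d + 1) * g) * w2 ->
  (d + 1) * f * ((X ^+ 2 - 1) ^+ n.+1 * z3) =
    (b + b + d + 1 + 1 + 1) * ((b + b + d + 1 + 1) * ((b + b + d + 1) * g)) * w1 ->
  f * ((X ^+ 2 - 1) ^+ n.+2 * z4) =
    (b + b + d + 1 + 1 + 1 + 1) *
    ((b + b + d + 1 + 1 + 1) * ((b + b + d + 1 + 1) * ((b + b + d + 1) * g))) * w0.
Proof.
move=> d0; move: (X ^+ 2 - 1) => x2; rewrite !exprS; move: (x2 ^+ n) => P.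
move=> S1 S2 I1 I2; apply: (mulfI d0).
have -> : (d + 1) * (f * (x2 * (x2 * P) * z4)) =
  (d + 1) * f * (x2 * P) * (x2 * z4) by ring.
have -> : (d + 1) * f * (x2 * P) * (x2 * z4) =
  (d + 1) * f * (x2 * P * z3) * (- 2 * (b + 1) * X) +
  x2 * (b + b + d + 1 + 1 + 1) * ((d + 1 + 1) * ((d + 1) * f) * (P * z2)).
  by rewrite S1; ring.
rewrite I1 I2.
transitivity ((b + b + d + 1 + 1 + 1) * ((b + b + d + 1 + 1) * ((b + b + d + 1) * g)) *
  (x2 * w2 - 2 * (b + 1) * X * w1)); first by ring.
by rewrite S2; ring.
Qed.

Section rodrigues.
Variable R : realType.
Local Open Scope ring_scope.

Definition rodr (l j : nat) : {poly R} := (('X^2 - 1) ^+ l)^`(j).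
(** The polynomial factor of [P_l^a] beside (1 - x^2)^(a/2), up to the constant (-1)^a / (2^l l!).
    It is a polynomial and not an angle. *)
Definition theta (l a : nat) : {poly R} := rodr l (l + a).

Lemma rodrS l j : rodr l j.+1 = (rodr l j)^`().
Proof. by rewrite /rodr derivnS. Qed.

Lemma deriv_X2 : ('X^2 - 1 : {poly R})^`() = 2 * 'X.
Proof. by rewrite derivB derivXn derivC subr0 expr1 mulr_natl. Qed.

Lemma rodr1 l : ('X^2 - 1) * rodr l 1 = (2 * l)%:R * 'X * rodr l 0.
Proof.
rewrite /rodr derivn1 derivn0 deriv_exp deriv_X2 natrM.
case: l => [|l]; first by rewrite mulr0n mulr0 mulr0 !mul0r.
by rewrite -mulr_natr /= (exprS _ l); ring.
Qed.

(** Comes from differentiating the first order equation [rodr1] j + 1 times; j = l is Legendre's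
    equation. *)
Lemma rodr_ode l j : ('X^2 - 1) * rodr l j.+2 =
  2 * (l%:R - j%:R - 1) * 'X * rodr l j.+1 + (j%:R + 1) * (2 * l%:R - j%:R) * rodr l j.
Proof.
have dC (n : nat) : (n%:R : {poly R})^`() = 0 by rewrite -polyC_natr derivC.
have d2 : (2 : {poly R})^`() = 0 by exact: dC.
elim: j => [|j IH].
  have := congr1 (@deriv R) (rodr1 l).
  rewrite !derivM deriv_X2 derivX dC -!rodrS mul0r add0r mulr1 natrM => h.
  have -> : ('X^2 - 1) * rodr l 2 =
    (2 * 'X * rodr l 1 + ('X^2 - 1) * rodr l 2) - 2 * 'X * rodr l 1 by ring.
  by rewrite h; ring.
move: ('X^2 - 1) deriv_X2 IH => P dP /(congr1 (@deriv R)).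
have d1 : (1 : {poly R})^`() = 0 by exact: derivC.
rewrite !(derivM, derivD, derivB, derivN) dP derivX !dC ?d2 ?d1 -!rodrS => h.
have -> : P * rodr l j.+3 =
  (2 * 'X * rodr l j.+2 + P * rodr l j.+3) - 2 * 'X * rodr l j.+2 by ring.
by rewrite h -natr1; ring.
Qed.

(* The proportionality of the Legendre functions of orders [a] and [- a]. *)
Lemma rodr_sym l a : (a <= l)%N ->
  (l - a)`!%:R * (('X^2 - 1) ^+ a * rodr l (l + a)) = (l + a)`!%:R * rodr l (l - a).
Proof.
(* The differential equation links three consecutive derivatives, so the induction carries two
   consecutive orders. *)
suff H (b : nat) : ((b <= l)%N -> (l - b)`!%:R * (('X^2 - 1) ^+ b * rodr l (l + b)) = (l + b)`!%:R * rodr l (l - b)) /\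
  ((b < l)%N -> (l - b.+1)`!%:R * (('X^2 - 1) ^+ b.+1 * rodr l (l + b.+1)) = (l + b.+1)`!%:R * rodr l (l - b.+1)).
  by case: (H a).
elim: b => [|b [IH1 IH2]].
  split=> [_|]; first by rewrite subn0 addn0 expr0 mul1r.
  case: l => // l _; rewrite expr1 addn1 subn1/=.
  rewrite rodr_ode !factS !natrM -!natr1.
  by ring.
split=> [bl|bl]; first exact: IH2.
have b1 : (b.+1 <= l)%N by exact: ltnW.
have {}IH1 := IH1 (ltnW b1); have {}IH2 := IH2 b1.
have [d ld] : exists d, l = (b + d).+2.
  by exists (l - b.+2)%N; lia.
rewrite ld in IH1 IH2 *.
have e0 : ((b + d).+2 - b = d.+2)%N by lia.
have e1 : ((b + d).+2 - b.+1 = d.+1)%N by lia.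
have e2 : ((b + d).+2 - b.+2 = d)%N by lia.
have s0 : ((b + d).+2 + b = (b + b + d).+2)%N by lia.
have s1 : ((b + d).+2 + b.+1 = (b + b + d).+3)%N by lia.
have s2 : ((b + d).+2 + b.+2 = (b + b + d).+4)%N by lia.
rewrite e0 s0 in IH1; rewrite e1 s1 in IH2; rewrite e2 s2.
have S1 := rodr_ode (b + d).+2 (b + b + d).+2.
have S2 := rodr_ode (b + d).+2 d.
have d0 : (d%:R + 1 : {poly R}) != 0 by rewrite natr1 -polyC_natr polyC_eq0 pnatr_eq0.
move: S1 S2 IH1 IH2; rewrite !factS !natrM.
move: (rodr _ (b + b + d).+4) (rodr _ (b + b + d).+3) (rodr _ (b + b + d).+2) => z4 z3 z2.
move: (rodr _ d.+2) (rodr _ d.+1) (rodr _ d) => w2 w1 w0 S1 S2 IH1 IH2.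
have := @rodr_sym_step _ d%:R b%:R d`!%:R (b + b + d)`!%:R 'X w0 w1 w2 z2 z3 z4 b d0.
move: ('X^2 - 1) d0 S1 S2 IH1 IH2 => X2; move: (X2 ^+ _) (X2 ^+ _) (X2 ^+ _) => X3 X4 X5.
move: (d`!%:R) ((b + b + d)`!%:R) 'X; rewrite !(=^~ natr1, natrD).
move: b%:R d%:R => b' d' f g X d0 S1 S2 IH1 IH2 H.
have {}S1 := etrans S1; have {}S2 := etrans S2.
etransitivity; last etransitivity.
- by [].
- apply: H.
  + by apply: S1; ring.
  + by apply: S2; ring.
  + by etransitivity; [|etransitivity; [exact: IH1|]]; ring.
  + by etransitivity; [|etransitivity; [exact: IH2|]]; ring.
- by ring.
Qed.

(** Writing (X^2 - 1)^l as (X - 1)^l composed with X^2 displays both the parity and the degree of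
    [theta]. *)
Lemma coef_theta l a k : (theta l a)`_k =
  ((('X - 1) ^+ l \Po 'X^2)`_(l + a + k) *+ (l + a + k) ^_ (l + a)) :> R.
Proof. by rewrite /theta /rodr coef_derivn rmorphXn/= rmorphB/= rmorph1 comp_polyX. Qed.

Lemma theta_parity l a k : odd (l + a + k) -> (theta l a)`_k = 0.
Proof.
by move=> o; rewrite coef_theta coef_comp_poly_Xn// dvdn2 o mul0rn.
Qed.

Lemma theta_gt l a k : (l < a + k)%N -> (theta l a)`_k = 0.
Proof.
move=> lk; rewrite coef_theta coef_comp_poly_Xn//; case: ifP => [h|]; last by rewrite mul0rn.
rewrite nth_default ?mul0rn// size_exp_XsubC.
by case/dvdnP: h => n e; rewrite e mulnK//; lia.
Qed.

Lemma theta_lead a d : (theta (a + d) a)`_d != 0.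
Proof.
rewrite coef_theta coef_comp_poly_Xn// (_ : (a + d + a + d = (a + d) * 2)%N); last by lia.
rewrite dvdn_mull// mulnK//.
have := lead_coef_exp ('X - 1 : {poly R}) (a + d).
rewrite lead_coefXsubC expr1n /lead_coef size_exp_XsubC/= => ->.
by rewrite pnatr_eq0 -lt0n ffact_gt0; lia.
Qed.

Lemma size_theta a d : size (theta (a + d) a) = d.+1.
Proof.
apply/eqP; rewrite eqn_leq; apply/andP; split.
  by apply/leq_sizeP => k dk; apply: theta_gt; lia.
by apply/gtn_neq0_size || (rewrite ltnNge; apply: contra (theta_lead a d) => /leq_sizeP h; rewrite h).
Qed.

(** The coefficient of X^k in the differential equation of [theta]; it is the cancellation that
    makes [solid_harm] harmonic. *)
Lemma theta_rec a d k : (k%:R + 2) * (k%:R + 1) * (theta (a + d) a)`_k.+2 =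
  (k%:R - d%:R) * (d%:R + k%:R + 1 + 2 * a%:R) * (theta (a + d) a)`_k :> R.
Proof.
have h := rodr_ode (a + d) (a + d + a).
set p := theta (a + d) a; rewrite -/(theta (a + d) a) -/p in h.
rewrite !rodrS -/(theta (a + d) a) -/p in h.
have /(congr1 (fun q : {poly R} => q`_k)) : 'X * ('X * p^`()^`()) - p^`()^`() =
   (- 2 * (a%:R + 1)) *: ('X * p^`()) + ((a + d + a)%:R + 1) * d%:R *: p.
  rewrite -!mul_polyC !rmorphM !rmorphN !rmorphD/= !polyC_natr.
  transitivity (('X^2 - 1) * p^`()^`()); first by ring.
  by rewrite h; ring.
rewrite coefB coefD !coefZ !coefXM; case: k => [|k] /=.
  rewrite sub0r !coef_deriv; move: p`_0 p`_2 => u v e.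
  have -> : (0 + 2) * (0 + 1) * v = - (v *+ 2 *- 1) by ring.
  by rewrite e !natrD; ring.
rewrite !coef_deriv; case: k => [|k] /=.
  move: p`_1 p`_3 => u v e.
  have -> : (1 + 2) * (1 + 1) * v = - (0 - v *+ 3 *+ 2) by ring.
  by rewrite e !natrD; ring.
move: p`_k.+2 p`_k.+4 => u v e.
have -> : (k.+2%:R + 2) * (k.+2%:R + 1) * v =
  u *+ k.+2 *+ k.+1 - (u *+ k.+2 *+ k.+1 - v *+ k.+4 *+ k.+3) by ring.
by rewrite e !natrD; ring.
Qed.


End rodrigues.

(** * Laplacians of products of powers of x + iy or x - iy, z and r^2 *)

Section harmonics.
Context {R : realType}.
Implicit Types u v : pt R -> R[i].

(** The sign of [m] is carried by i, so that [zeta m] is x + iy or x - iy and its power |m| has the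
    azimuthal factor e^(i m phi) for either sign. *)
Definition sgi (m : int) : R[i] := if 0 <= m then 0 +i* 1 else 0 +i* (-1).
Definition zeta (m : int) (x : pt R) : R[i] := cc i0 x + sgi m * cc i1 x.
Opaque grad.

Lemma sgi_sqr m : sgi m * sgi m = -1.
Proof. by rewrite /sgi; case: ifP => _; apply: eq_complexP; rewrite ?ReMi ?ImMi/=; ring. Qed.

Lemma cpoly_zeta m : cpoly (zeta m).
Proof.
apply: cpolyD; first exact: cpoly_cc.
by apply: cpolyM; [exact: cpoly_cst|exact: cpoly_cc].
Qed.

Lemma euler_zeta m : euler 1 (zeta m).
Proof.
apply: eulerD; [exact: cpoly_cc| |exact: euler_cc|].
  by apply: cpolyM; [exact: cpoly_cst|exact: cpoly_cc].
by apply: eulerZ; [exact: cpoly_cc|exact: euler_cc].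
Qed.

Lemma grad_zeta m i x : grad (zeta m) i x = (i == i0)%:R + sgi m * (i == i1)%:R.
Proof.
have C0 := cpoly_C1c (@cpoly_cc R i0); have C1 := cpoly_C1c (@cpoly_cc R i1).
have C2 : C1c (fun x => sgi m * cc i1 x).
  by apply: cpoly_C1c; apply: cpolyM; [exact: cpoly_cst|exact: cpoly_cc].
etransitivity; first exact: (gradD i x C0 C2).
by rewrite grad_cc (gradZ (sgi m) i x C1) grad_cc.
Qed.

(** [p] and [q] stand for u^n and u^(n-1); the hypothesis keeps the factor n because [n.-1] is 0
    when n = 0. *)
Fact lapX_ring (K : comNzRingType) (n u l g p q : K) :
  n * u * q = n * p ->
  l * (u * p) + 2 * ((n + 1) * p * g) + u * ((n + 1) * p * l + (n + 1) * (n * q) * g) =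
  (n + 1 + 1) * (u * p) * l + (n + 1 + 1) * ((n + 1) * p) * g.
Proof.
move=> h.
have -> : u * ((n + 1) * p * l + (n + 1) * (n * q) * g) =
  u * (n + 1) * p * l + (n + 1) * (n * u * q) * g by ring.
by rewrite h; ring.
Qed.

Lemma lapX u n x : cpoly u ->
  lap (fun x => u x ^+ n) x = n%:R * u x ^+ n.-1 * lap u x +
    n%:R * (n.-1%:R * u x ^+ n.-2) * (\sum_(i < 3) grad u i x * grad u i x).
Proof.
move=> pu; case: n => [|n].
  by rewrite (_ : (fun x => _) = (fun=> 1)) ?lap_cst ?mul0r ?addr0.
elim: n => [|n IH].
  by rewrite (_ : (fun x => _) = u)// !mul0r mulr0 mul0r addr0 !mul1r.
rewrite (eq_fun (fun y => exprS (u y) n.+1)).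
etransitivity; first by apply: lapM => //; exact: cpolyX.
have e i : grad u i x * grad (fun x => u x ^+ n.+1) i x =
    n.+1%:R * u x ^+ n * (grad u i x * grad u i x).
  by rewrite mulrCA; congr (_ * _); exact: gradX.
rewrite (eq_bigr _ (fun i _ => e i)) -mulr_sumr IH !succnK.
rewrite -[n.+2%:R]natr1 -[n.+1%:R]natr1 [u x ^+ n.+1]exprS; apply: lapX_ring.
by case: n {IH e} => [|n]; rewrite ?mul0r//= -mulrA -exprS.
Qed.

Lemma lap_cc i x : lap (@cc R i) x = 0.
Proof.
rewrite /lap big1// => j _; rewrite (_ : grad (cc i) j = fun=> (j == i)%:R) ?grad_cst//.
by apply/funext => y; exact: grad_cc.
Qed.

Lemma lap_zeta m x : lap (zeta m) x = 0.
Proof.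
rewrite /lap big1// => j _.
rewrite (_ : grad (zeta m) j = fun=> (j == i0)%:R + sgi m * (j == i1)%:R) ?grad_cst//.
by apply/funext => y; exact: grad_zeta.
Qed.

Lemma lap_r2 x : lap (@r2 R) x = 6.
Proof.
have e i : grad (grad (@r2 R) i) i x = 2.
  rewrite (_ : grad (@r2 R) i = fun x => 2 * cc i x); last first.
    by apply/funext => y; exact: grad_r2.
  rewrite (gradZ 2 i x (cpoly_C1c (cpoly_cc i))) grad_cc eqxx mulr1//.
by rewrite /lap (eq_bigr _ (fun i _ => e i)) sumr_const card_ord -mulrnA.
Qed.

(** [zeta m] is harmonic and its gradient (1, i, 0) or (1, -i, 0) is isotropic: the squares of its
    components add up to 0. *)
Lemma lap_zetaX m a x : lap (fun x => zeta m x ^+ a) x = 0.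
Proof.
etransitivity; first exact: (lapX a x (cpoly_zeta m)).
rewrite lap_zeta mulr0 add0r sum3 !grad_zeta/= !(mulr0, mulr1, addr0, add0r).
by rewrite sgi_sqr subrr mulr0.
Qed.

Lemma lap_ccX k (x : pt R) : lap (fun x => cc i2 x ^+ k) x = k%:R * (k.-1%:R * cc i2 x ^+ k.-2).
Proof.
etransitivity; first exact: (lapX k x (cpoly_cc i2)).
by rewrite lap_cc mulr0 add0r sum3 !grad_cc/= !(mulr0, mulr1, addr0, add0r).
Qed.

Lemma lap_r2X j x : lap (fun x => @r2 R x ^+ j) x =
  (2 * j%:R) * (2 * j%:R + 1) * r2 x ^+ j.-1.
Proof.
etransitivity; first exact: (lapX j x (@cpoly_r2 R)).
have -> : \sum_(i < 3) grad (@r2 R) i x * grad (@r2 R) i x = 4 * r2 x.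
  rewrite /r2 mulr_sumr; apply: eq_bigr => i _; rewrite grad_r2.
  by rewrite mulrACA -natrM.
rewrite lap_r2; move: (r2 x) => r; case: j => [|[|j]] /=.
- by rewrite !(mul0r, mulr0) addr0.
- by rewrite !(mul0r, mulr0) addr0 expr0; ring.
by rewrite exprS; ring.
Qed.

Definition zzr m a k j x : R[i] := zeta m x ^+ a * cc i2 x ^+ k * r2 x ^+ j.

Lemma cpoly_zz m a k : cpoly (fun x => zeta m x ^+ a * cc i2 x ^+ k).
Proof.
by apply: cpolyM; apply: cpolyX; [exact: cpoly_zeta|exact: cpoly_cc].
Qed.

Lemma euler_zz m a k : euler (a + k) (fun x => zeta m x ^+ a * cc i2 x ^+ k).
Proof.
apply: eulerM; [by apply: cpolyX; exact: cpoly_zeta|by apply: cpolyX; exact: cpoly_cc| |].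
  by have := eulerX a (cpoly_zeta m) (euler_zeta m); rewrite mul1n.
by have := eulerX k (@cpoly_cc R i2) (@euler_cc R i2); rewrite mul1n.
Qed.

Lemma lap_zz m a k x : lap (fun x => zeta m x ^+ a * cc i2 x ^+ k) x =
  k%:R * k.-1%:R * (zeta m x ^+ a * cc i2 x ^+ k.-2).
Proof.
have p1 : cpoly (fun x => zeta m x ^+ a) by apply: cpolyX; exact: cpoly_zeta.
have p2 : cpoly (fun x => @cc R i2 x ^+ k) by apply: cpolyX; exact: cpoly_cc.
etransitivity; first exact: (lapM x p1 p2).
rewrite lap_zetaX lap_ccX mul0r add0r big1 => [|i _].
  by rewrite mulr0 add0r; move: (zeta m x ^+ a) (cc i2 x ^+ k.-2) => A B; ring.
rewrite (gradX a i x (cpoly_zeta m)) (gradX k i x (cpoly_cc i2)) grad_zeta grad_cc.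
by case: (ord3P i) => ->; rewrite /= !(mulr0, mul0r, addr0).
Qed.

(** The gradient of r^(2j) is radial, so Euler's identity in degree a + k evaluates the cross
    term. *)
Lemma lap_zzr m a k j x : lap (zzr m a k j) x =
  k%:R * k.-1%:R * zzr m a k.-2 j x +
  2 * j%:R * (2 * j%:R + 1 + 2 * (a%:R + k%:R)) * zzr m a k j.-1 x.
Proof.
have p1 := @cpoly_zz m a k.
have p2 : cpoly (fun x => @r2 R x ^+ j) by apply: cpolyX; exact: cpoly_r2.
etransitivity; first exact: (lapM x p1 p2).
rewrite lap_zz lap_r2X.
have e i : grad (fun x => zeta m x ^+ a * cc i2 x ^+ k) i x * grad (fun x => @r2 R x ^+ j) i x =
    j%:R * r2 x ^+ j.-1 * 2 * (cc i x * grad (fun x => zeta m x ^+ a * cc i2 x ^+ k) i x).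
  rewrite [grad (fun x => r2 x ^+ j) i x](gradX j i x (@cpoly_r2 R)) grad_r2.
  by move: (grad _ _ _) (cc i x) (r2 x ^+ _) => A B C; ring.
rewrite (eq_bigr _ (fun i _ => e i)) -mulr_sumr (euler_zz m a k x) /zzr natrD.
move: (zeta m x ^+ a) (cc i2 x ^+ k) (cc i2 x ^+ k.-2) (r2 x ^+ j) (r2 x ^+ j.-1).
by move=> A B C D E; ring.
Qed.

End harmonics.

Section solid.
Context {R : realType}.
Implicit Types u v : pt R -> R[i].
Opaque grad.

Lemma cpoly_zzr m a k j : cpoly (@zzr R m a k j).
Proof. by apply: cpolyM; [exact: cpoly_zz|apply: cpolyX; exact: cpoly_r2]. Qed.

Lemma euler_zzr m a k j : euler (a + k + 2 * j) (@zzr R m a k j).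
Proof.
apply: eulerM; [exact: cpoly_zz|apply: cpolyX; exact: cpoly_r2|exact: euler_zz|].
exact: (eulerX j (@cpoly_r2 R) (@euler_r2 R)).
Qed.

(* Here [a = |m|] and [a + d] is the degree. The halving is exact where it
   matters: the coefficients with [d - k] odd vanish. *)
Definition solid_harm (m : int) (a d : nat) (x : pt R) : R[i] :=
  \sum_(k < d.+1) ((theta R (a + d) a)`_k)%:C * zzr m a k (d - k)./2 x.

Lemma cpoly_solid m a d : cpoly (solid_harm m a d).
Proof.
by apply: cpoly_sum => k; apply: cpolyM; [exact: cpoly_cst|exact: cpoly_zzr].
Qed.

Lemma theta_parity_half a d k : (k <= d)%N ->
  (theta R (a + d) a)`_k = 0 \/ d = (k + 2 * (d - k)./2)%N.
Proof.
move=> kd; case: (boolP (odd (d - k))) => o; [left|right].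
  by apply: theta_parity; lia.
by lia.
Qed.

Lemma euler_solid m a d : euler (a + d) (solid_harm m a d).
Proof.
apply: euler_sum => k; first by apply: cpolyM; [exact: cpoly_cst|exact: cpoly_zzr].
have kd : (k <= d)%N by rewrite -ltnS.
have [->|e] := theta_parity_half a kd.
  rewrite (_ : (fun x => _) = fun=> 0); first exact: euler0.
  by apply/funext => x; rewrite mul0r.
have -> : (a + d = a + k + 2 * (d - k)./2)%N by rewrite {1}e addnA.
by apply: eulerZ; [exact: cpoly_zzr|exact: euler_zzr].
Qed.

Fact solid_step (p p' : R) (k d a : R) (z : R[i]) :
  (k + 2) * (k + 1) * p' = (k - d) * (d + k + 1 + 2 * a) * p ->
  p'%:C * ((k + 2) * (k + 1))%:C * z + p%:C * ((d - k) * (d - k + 1 + 2 * (a + k)))%:C * z = 0.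
Proof.
move=> h; rewrite -!rmorphM -mulrDl -rmorphD/= mulrC.
rewrite (_ : p' * _ + _ = 0) ?rmorph0 ?mulr0//.
by rewrite mulrC h; ring.
Qed.

Lemma lap_solid m a d x : lap (solid_harm m a d) x = 0.
Proof.
pose p k := (theta R (a + d) a)`_k.
pose A k := (p k)%:C * (k%:R * k.-1%:R) * zzr m a k.-2 (d - k)./2 x.
pose B k := (p k)%:C * ((d%:R - k%:R) * (d%:R - k%:R + 1 + 2 * (a%:R + k%:R)))%:C *
  zzr m a k (d - k)./2.-1 x.
transitivity (\sum_(k < d.+1) (A k + B k)).
  etransitivity.
    by apply: lap_sum => k; apply: cpolyM; [exact: cpoly_cst|exact: cpoly_zzr].
  apply: eq_bigr => k _.
  etransitivity; first by apply: lapZ; exact: cpoly_zzr.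
  rewrite lap_zzr mulrDr.
  have kd : (k <= d)%N by rewrite -ltnS.
  have [e|e] := theta_parity_half a kd; first by rewrite /A /B /p e !mul0r.
  congr (_ + _); first exact: mulrA.
  rewrite /B -[RHS]mulrA; congr (_ * (_ * _)).
  have -> : (d%:R - k%:R : R) = 2 * (d - k)./2%:R.
    by rewrite -natrB// -natrM; congr (_%:R); lia.
  move: (d - k)./2 => j.
  transitivity ((2 * j * (2 * j + 1 + 2 * (a + k)))%N%:R : R[i]); first by ring.
  by rewrite -(rmorph_nat (real_complex R)); congr (_%:C); ring.
rewrite big_split/=.
(* [A k.+2] and [B k] carry the same monomial and cancel by [theta_rec]. Two zero terms are appended
   to [A], and its first two terms vanish through k (k - 1), so that the shifted ranges agree. *)
have -> : \sum_(k < d.+1) A k = \sum_(k < d.+3) A k.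
  by rewrite 2![in RHS]big_ord_recr/= /A /p !theta_gt ?mul0r ?addr0//; lia.
have A0 : A 0 = 0 by rewrite /A/= !(mul0r, mulr0).
have A1 : A 1 = 0 by rewrite /A/= !(mul0r, mulr0).
rewrite 2!big_ord_recl/= [A (bump _ _)]A1 A0 !add0r -big_split/= /A.
rewrite big1// => k _; rewrite /bump/= !add1n /B/=.
have kd : (k <= d)%N by rewrite -ltnS.
have -> : ((d - k.+2)./2 = (d - k)./2.-1)%N by lia.
rewrite -(@solid_step (p k) (p k.+2) k%:R d%:R a%:R (zzr m a k (d - k)./2.-1 x)).
  congr (_ * _ * _ + _).
  transitivity (((k.+2 * k.+1)%N)%:R : R[i]); first by rewrite natrM.
  by rewrite -(rmorph_nat (real_complex R)); congr (_%:C); ring.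
exact: theta_rec.
Qed.

End solid.

(** * Agreement of the solid harmonics with the angular definition *)

Section spherical_harmonics.
Context {R : realType}.
Local Notation sgi := (@sgi R).

Definition cis (s : R[i]) (t : R) : R[i] := (cos t)%:C + s * (sin t)%:C.

Lemma cisX s t a : s * s = -1 -> cis s t ^+ a = cis s (a%:R * t).
Proof.
move=> s2; elim: a => [|a IH].
  by rewrite expr0 /cis mul0r cos0 sin0 mulr0 addr0.
have -> : a.+1%:R * t = t + a%:R * t by rewrite -natr1; ring.
rewrite exprS IH /cis cosD sinD.
rewrite !(rmorphD, rmorphN, rmorphM)/=.
move: (cos t)%:C (sin t)%:C (cos (a%:R * t))%:C (sin (a%:R * t))%:C => A B C D.
transitivity (A * C + s * s * (B * D) + s * (A * D + B * C)); first by ring.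
by rewrite s2; ring.
Qed.

Lemma cis_sgi m t : cis (sgi m) t ^+ `|m| = cos (m%:~R * t) +i* sin (m%:~R * t).
Proof.
rewrite cisX; last exact: sgi_sqr.
case: m => a; rewrite /sgi/= /cis ?NegzE ?mulrNz ?mulNr ?cosN ?sinN;
  apply: eq_complexP; rewrite ?(ReDi, ImDi) ?(ReMi, ImMi)/=;
  rewrite ?(mul0r, mulr0, mul1r, mulN1r, subr0, addr0, add0r, oppr0)//.
Qed.

(* [P_l^m] and [P_l^(-m)] are proportional up to the sign [(-1)^m], which only
   the Condon-Shortley phase of the nonnegative orders leaves visible. *)
Definition harm_cst (l : nat) (m : int) : R :=
  (if 0 <= m then (-1) ^+ `|m| else 1) *
  Num.sqrt ((2 * l%:R + 1) / (4 * pi) * ((l - `|m|)`!%:R / (l + `|m|)`!%:R)) /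
  (2 ^+ l * l`!%:R).

Lemma sqr_powR (s a : R) : 0 <= s -> (s ^+ 2) `^ (a / 2) = s `^ a.
Proof.
move=> s0; rewrite -powR_mulrn// -powRrM; congr (_ `^ _).
by rewrite mulrC mulfVK.
Qed.

Lemma legendre_pos l a (t : R) : 0 <= sin t ->
  legendre l a%:Z (cos t) =
  (-1) ^+ a / (2 ^+ l * l`!%:R) * sin t ^+ a * (theta R l a).[cos t].
Proof.
move=> s0; rewrite /legendre -sin2cos2 sqr_powR// powR_mulrn//.
Qed.

(** [rodr_sym] trades the derivative of order l - a for (cos^2 t - 1)^a times the one of order l +
    a. The sign (-1)^a of that power cancels the Condon-Shortley phase. *)
Lemma legendre_neg l a (t : R) : (0 < a)%N -> (a <= l)%N -> 0 <= sin t ->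
  legendre l (- a%:Z) (cos t) = (l - a)`!%:R / (l + a)`!%:R / (2 ^+ l * l`!%:R) *
   sin t ^+ a * (theta R l a).[cos t].
Proof.
move=> a0 al s0; rewrite /legendre -sin2cos2 sqr_powR// mulrNz powRN powR_mulrn//.
have -> : absz (l%:Z - a%:Z) = (l - a)%N by rewrite subzn.
rewrite -/(rodr R l (l - a)).
have := congr1 (fun p : {poly R} => p.[cos t]) (rodr_sym R al).
rewrite -/(theta R l a) !hornerM -!polyC_natr !hornerC horner_exp !hornerE/=.
have -> : cos t ^+ 2 - 1 = - sin t ^+ 2 by rewrite sin2cos2 opprB.
move: (rodr R l (l - a)).[cos t] (theta R l a).[cos t] => u v.
have f1 : (l - a)`!%:R != 0 :> R by rewrite pnatr_eq0 -lt0n fact_gt0.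
have f2 : (l + a)`!%:R != 0 :> R by rewrite pnatr_eq0 -lt0n fact_gt0.
rewrite exprNn -exprM => e.
have -> : u = (l - a)`!%:R / (l + a)`!%:R * ((-1) ^+ a * sin t ^+ (2 * a) * v).
  by apply: (mulfI f2); rewrite -e mulrA; field.
have -> : (-1) ^ (- a%:Z) = (-1) ^+ a :> R by rewrite -exprnN invr_sign.
(* At the poles the negative power of [sin t] is [invr0], that is 0, and the right side vanishes
   because a > 0. *)
have [->|st] := eqVneq (sin t) 0.
  by rewrite !expr0n muln_eq0 (gtn_eqF a0)/= invr0 !(mulr0, mul0r).
have sta : sin t ^+ a != 0 by rewrite expf_neq0.
have l0 : l`!%:R != 0 :> R by rewrite pnatr_eq0 -lt0n fact_gt0.
have e2 : (-1) ^+ a * (-1) ^+ a = 1 :> R by rewrite -expr2 sqrr_sign.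
rewrite mulnC exprM expr2; move: (sin t ^+ a) sta => S S0.
have t0 : 2 ^+ l != 0 :> R by rewrite expf_neq0.
move: (2 ^+ l) t0 => T T0.
transitivity (((-1) ^+ a * (-1) ^+ a) * ((l - a)`!%:R / (l + a)`!%:R / (T * l`!%:R) * S * v)).
  by move: ((-1) ^+ a) => E; field; rewrite l0 f2 T0.
by rewrite e2 mul1r.
Qed.

Lemma sph_harmE l m (t p : R) : (`|m| <= l)%N -> 0 <= sin t ->
  sph_harm l m t p = (harm_cst l m * sin t ^+ `|m| * (theta R l `|m|).[cos t])%:C *
    (cos (m%:~R * p) +i* sin (m%:~R * p)).
Proof.
move=> ml s0; rewrite /sph_harm; congr (_%:C * _).
case: m ml => a al.
  rewrite legendre_pos// /harm_cst absz_nat/=.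
  have -> : absz (l%:Z - a%:Z) = (l - a)%N by rewrite subzn.
  by rewrite !mulrA; congr (_ * _ * _); rewrite -!mulrA mulrCA.
rewrite NegzE in al *.
have -> : absz (- a.+1%:Z) = a.+1 by rewrite abszN.
rewrite abszN absz_nat in al.
rewrite legendre_neg// /harm_cst abszN absz_nat lerNr oppr0 -[0 : int]/(0%:Z) lez_nat ltn0 mul1r.
have -> : absz (l%:Z - - a.+1%:Z) = (l + a.+1)%N by rewrite opprK.
have -> : absz (l%:Z + - a.+1%:Z) = (l - a.+1)%N by rewrite subzn.
rewrite !mulrA; congr (_ * _ * _).
set f := (l - a.+1)`!%:R; set g := (l + a.+1)`!%:R.
have f1 : 0 < f by rewrite ltr0n fact_gt0.
have g1 : 0 < g by rewrite ltr0n fact_gt0.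
have c0 : 0 <= (2 * l%:R + 1) / (4 * pi) :> R.
  by rewrite divr_ge0// ?mulr_ge0// ?pi_ge0//.
have fg : 0 <= f / g by rewrite divr_ge0// ltW.
set c := (_ / (4 * pi)) in c0 *.
(* The quotient of factorials from [legendre_neg] inverts the one under the square root: opposite
   orders share one normalisation. *)
have -> : Num.sqrt (c * f / g) = Num.sqrt (c * g / f) * (f / g).
  rewrite -(ger0_norm fg) -sqrtr_sqr -sqrtrM; last exact: divr_ge0 (mulr_ge0 c0 (ltW g1)) (ltW f1).
  by congr Num.sqrt; field; rewrite !gt_eqF.
by rewrite !mulrA.
Qed.


Lemma solid_spherical m a d (r t p : R) :
  solid_harm m a d (r * sin t * cos p, r * sin t * sin p, r * cos t) =
  (r ^+ (a + d) * sin t ^+ a * (theta R (a + d) a).[cos t])%:C * cis (sgi m) p ^+ a.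
Proof.
set x := (_, _, _).
have zx : zeta m x = (r * sin t)%:C * cis (sgi m) p.
  by rewrite /zeta /cc /coord/= /cis !rmorphM/=; ring.
have rx : r2 x = (r ^+ 2)%:C.
  rewrite r2E /nrm2/=; congr (_%:C).
  have := cos2Dsin2 p; have := cos2Dsin2 t.
  move: (cos p) (sin p) (cos t) (sin t) => A B C D h1 h2.
  transitivity (r ^+ 2 * (D ^+ 2 * (A ^+ 2 + B ^+ 2) + C ^+ 2)); first by ring.
  by rewrite h2 mulr1 addrC h1 mulr1.
rewrite /solid_harm.
transitivity (\sum_(k < d.+1) ((theta R (a + d) a)`_k * cos t ^+ k)%:C *
   ((r ^+ (a + d) * sin t ^+ a)%:C * cis (sgi m) p ^+ a)).
  apply: eq_bigr => k _; rewrite /zzr zx rx.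
  have kd : (k <= d)%N by rewrite -ltnS.
  have [->|e] := @theta_parity_half R a d k kd; first by rewrite !mul0r.
  rewrite (_ : r ^+ (a + d) = r ^+ a * (r ^+ k * (r ^+ 2) ^+ (d - k)./2)); last first.
    by rewrite -exprM -!exprD; congr (_ ^+ _); lia.
  rewrite exprMn /cc /coord/= -!rmorphXn/= !exprMn !rmorphM/=.
  move: ((theta _ _ _)`_k)%:C (cis _ _ ^+ a) => A B.
  by ring.
rewrite -mulr_suml -rmorph_sum/= mulrA -rmorphM/=; congr (_%:C * _).
by rewrite horner_coef size_theta mulrC.
Qed.

Lemma enorm_ge0 (x : pt R) : 0 <= enorm x.
Proof. exact: sqrtr_ge0. Qed.

Lemma enorm_sqr (x : pt R) : enorm x ^+ 2 = x.1.1 ^+ 2 + x.1.2 ^+ 2 + x.2 ^+ 2.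
Proof. by rewrite /enorm sqr_sqrtr// !addr_ge0// sqr_ge0. Qed.

Lemma sqr_le_ratio (a r : R) : 0 <= r -> a ^+ 2 <= r ^+ 2 -> -1 <= a / r <= 1.
Proof.
rewrite le_eqVlt => /orP[/eqP<- _|r0 h]; first by rewrite invr0 mulr0 lerN10 ler01.
rewrite ler_pdivrMr// ler_pdivlMr//.
by apply/andP; split; nra.
Qed.

Lemma polar_range (x : pt R) : -1 <= x.2 / enorm x <= 1.
Proof.
apply: sqr_le_ratio; first exact: enorm_ge0.
by rewrite enorm_sqr lerDr addr_ge0// sqr_ge0.
Qed.

Lemma sin_polar_ge0 (x : pt R) : 0 <= sin (polar x).
Proof. by rewrite sin_acos ?sqrtr_ge0//; exact: polar_range. Qed.

(** True at every point: at the origin and on the vertical axis the angles involve a division by 0,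
    but the sines and cosines concerned are multiplied by a radius that vanishes there. *)
Lemma spherical_coordinates (x : pt R) :
  x = (enorm x * sin (polar x) * cos (azimuth x),
       enorm x * sin (polar x) * sin (azimuth x), enorm x * cos (polar x)).
Proof.
case: x => [[a b] z]; set x := (a, b, z).
set rho := Num.sqrt (a ^+ 2 + b ^+ 2).
have rho0 : 0 <= rho by exact: sqrtr_ge0.
have rho2 : rho ^+ 2 = a ^+ 2 + b ^+ 2 by rewrite sqr_sqrtr// addr_ge0// sqr_ge0.
have rs : enorm x * sin (polar x) = rho.
  have := enorm_ge0 x; rewrite le_eqVlt => /orP[/eqP r0|r0].
    rewrite -r0 mul0r; apply/esym/eqP; rewrite -sqrf_eq0 rho2.
    by have := enorm_sqr x; rewrite -r0 expr0n/= => h; nra.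
  rewrite /polar sin_acos ?polar_range//.
  rewrite -{1}(ger0_norm (ltW r0)) -sqrtr_sqr -sqrtrM ?sqr_ge0//; congr Num.sqrt.
  rewrite mulrBr mulr1 expr_div_n mulrCA divff ?mulr1 ?expf_neq0 ?gt_eqF//.
  by rewrite enorm_sqr/=; ring.
have ez : enorm x * cos (polar x) = z.
  have := enorm_ge0 x; rewrite le_eqVlt => /orP[/eqP r0|r0].
    by rewrite -r0 mul0r; have := enorm_sqr x; rewrite -r0 expr0n/= => h; nra.
  rewrite /polar acosK; last by rewrite in_itv/=; exact: (polar_range x).
  by rewrite mulrC divfK// (gt_eqF r0).
rewrite ez rs; congr (_, _, _); rewrite /azimuth/= -/rho.
  have [r0|r0] := eqVneq rho 0.
    by rewrite r0 mul0r; move: rho2; rewrite r0 expr0n/= => h; nra.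
  have rg : -1 <= a / rho <= 1 by apply: sqr_le_ratio => //; rewrite rho2 lerDl sqr_ge0.
  have h : rho * cos (acos (a / rho)) = a.
    by rewrite acosK ?in_itv/= ?rg// mulrC divfK.
  by case: ifP => _; rewrite ?cos_2piB h.
have [r0|r0] := eqVneq rho 0.
  by rewrite r0 mul0r; move: rho2; rewrite r0 expr0n/= => h; nra.
have rg : -1 <= a / rho <= 1 by apply: sqr_le_ratio => //; rewrite rho2 lerDl sqr_ge0.
have h : rho * sin (acos (a / rho)) = `|b|.
  rewrite sin_acos// -{1}(ger0_norm rho0) -!sqrtr_sqr -sqrtrM ?sqr_ge0//; congr Num.sqrt.
  rewrite mulrBr mulr1 expr_div_n mulrCA divff ?mulr1 ?expf_neq0//.
  by rewrite rho2; ring.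
case: ifP => b0; first by rewrite h ger0_norm.
rewrite sin_2piB mulrN h ltr0_norm ?opprK//.
by rewrite ltNge b0.
Qed.

Definition harm (l : nat) (m : int) (x : pt R) : R[i] :=
  (harm_cst l m)%:C * solid_harm m `|m| (l - `|m|) x.

Lemma harmE l m (r t p : R) : (`|m| <= l)%N ->
  harm l m (r * sin t * cos p, r * sin t * sin p, r * cos t) =
  (r ^+ l * (harm_cst l m * sin t ^+ `|m| * (theta R l `|m|).[cos t]))%:C *
  (cos (m%:~R * p) +i* sin (m%:~R * p)).
Proof.
move=> ml; rewrite /harm solid_spherical subnKC// cis_sgi mulrA -rmorphM/=.
by congr (_%:C * _); ring.
Qed.

Lemma Y_harm l m (x : pt R) : (`|m| <= l)%N -> (enorm x ^+ l)%:C * Y l m x = harm l m x.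
Proof.
move=> ml; rewrite {3}[x]spherical_coordinates harmE// /Y sph_harmE ?sin_polar_ge0//.
by rewrite mulrA -rmorphM.
Qed.

Lemma cpoly_harm l m : cpoly (harm l m).
Proof. by apply: cpolyM; [exact: cpoly_cst|exact: cpoly_solid]. Qed.

Lemma euler_harm l m : (`|m| <= l)%N -> euler l (harm l m).
Proof.
move=> ml; apply: eulerZ; first exact: cpoly_solid.
by have := @euler_solid R m `|m| (l - `|m|); rewrite subnKC.
Qed.

Lemma lap_harm l m x : lap (harm l m) x = 0.
Proof.
etransitivity; first by apply: lapZ; exact: cpoly_solid.
by rewrite lap_solid mulr0.
Qed.

End spherical_harmonics.

(** * Products of three spherical harmonics *)

Section legendre_integrals.
Context {R : realType}.
Local Notation mu := (@lebesgue_measure R).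
Implicit Types p q : {poly R}.

(** The integral of [p] over [-1, 1], in the variable cos t under which it arises on the sphere. *)
Definition zonal (p : {poly R}) : R := \int[mu]_(t in `[0, pi]) (p.[cos t] * sin t).

Lemma continuous_horner_cos p : continuous (fun t : R => p.[cos t]).
Proof.
apply: continuous_compfun (@continuous_cos R) _ => x.
exact: continuous_horner.
Qed.

Lemma zonal_deriv p : zonal p^`() = p.[1] - p.[-1].
Proof.
have c : continuous (fun t : R => p^`().[cos t] * sin t).
  by apply: continuousM_fun; [exact: continuous_horner_cos|exact: continuous_sin].
have d (t : R) : 0 <= t <= pi -> is_derive t 1 (fun t : R => - p.[cos t]) (p^`().[cos t] * sin t).
  move=> _.
  have dp : is_derive (cos t) 1 (horner p) p^`().[cos t] by exact: is_derive_poly.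
  by have := is_deriveN (is_derive1_comp dp (is_derive_cos t)); rewrite mulrN opprK.
rewrite /zonal (integral_derive_itv (pi_ge0 R) c d) cospi cos0; ring.
Qed.


(** Together with [zonal_deriv], reduces every identity between values of [zonal] to evaluations at
    1 and -1. *)
Lemma primitive p : exists P, p = P^`().
Proof.
exists (\poly_(i < (size p).+1) (p`_i.-1 / i%:R)).
apply/polyP => i; rewrite coef_deriv coef_poly ltnS; case: ltnP => h /=.
  by rewrite -[RHS]mulr_natr divfK// pnatr_eq0.
by rewrite mul0rn nth_default.
Qed.

Lemma zonalD p q : zonal (p + q) = zonal p + zonal q.
Proof.
have [P ->] := primitive p; have [Q ->] := primitive q.
by rewrite -derivD !zonal_deriv !hornerD; ring.
Qed.

Lemma zonalZ (c : R) p : zonal (c *: p) = c * zonal p.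
Proof.
have [P ->] := primitive p.
by rewrite -derivZ !zonal_deriv !hornerZ; ring.
Qed.

Lemma zonal0 : zonal 0 = 0.
Proof. by rewrite -(scale0r 0) zonalZ mul0r. Qed.

Lemma zonal_parts p q : p.[1] = 0 -> p.[-1] = 0 ->
  zonal (p^`() * q) = - zonal (p * q^`()).
Proof.
move=> p1 pN1; apply/eqP; rewrite -addr_eq0 -zonalD -derivM zonal_deriv.
by rewrite !hornerM p1 pN1 !mul0r subrr.
Qed.

Lemma zonal_odd p : p \Po (- 'X) = - p -> zonal p = 0.
Proof.
have [P ->] := primitive p => h.
have e : (P \Po (- 'X))^`() = P^`().
  by rewrite deriv_comp h derivN derivX mulrN1 opprK.
have : zonal (P \Po (- 'X))^`() = zonal P^`() by rewrite e.
rewrite !zonal_deriv !horner_comp !hornerN !hornerX opprK => e2.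
by lra.
Qed.

Lemma rodr_ends n j (x : R) : (j < n)%N -> x ^+ 2 = 1 -> (rodr R n j).[x] = 0.
Proof.
move=> jn x2.
have [q ->] : exists q, rodr R n j = ('X^2 - 1) ^+ (n - j) * q.
  elim: j jn => [|j IH] jn.
    by exists 1; rewrite subn0 mulr1.
  have [q e] := IH (ltnW jn).
  rewrite rodrS e derivM deriv_exp.
  exists (((n - j)%:R * 2 * 'X) * q + ('X^2 - 1) * q^`()).
  have -> : (n - j = (n - j.+1).+1)%N by lia.
  rewrite deriv_X2/=; move: ('X^2 - 1) => X2.
  by rewrite exprS -mulr_natr; ring.
have -> : (n - j = (n - j).-1.+1)%N by lia.
by rewrite exprS !hornerM !hornerE x2 subrr !mul0r.
Qed.

Lemma zonal_rodr n j q : (j <= n)%N ->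
  zonal (rodr R n j * q) = (-1) ^+ j * zonal (('X^2 - 1) ^+ n * q^`(j)).
Proof.
elim: j q => [|j IH] q jn; first by rewrite expr0 mul1r /rodr !derivn0.
rewrite rodrS zonal_parts; last 2 first.
- by apply: rodr_ends => //; rewrite expr1n.
- by apply: rodr_ends => //; rewrite sqrrN expr1n.
rewrite IH ?(ltnW jn)// (exprS _ j) -derivSn.
by move: ((-1) ^+ j) => e; ring.
Qed.

(** The derivative of X (X^2 - 1)^(n+1) integrates to 0, which gives (2n + 3) I(n+1) + (2n + 2) I(n)
    = 0 for the integral I(n) in question. *)
Lemma zonal_weight_neq0 n : zonal (('X^2 - 1) ^+ n) != 0.
Proof.
elim: n => [|n IH].
  have : zonal ('X)^`() = 2 by rewrite zonal_deriv !hornerX; ring.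
  by rewrite derivX expr0 => ->; rewrite pnatr_eq0.
have : zonal ('X * ('X^2 - 1) ^+ n.+1)^`() = 0.
  by rewrite zonal_deriv !hornerM !horner_exp !hornerE/= sqrrN expr1n subrr expr0n/= !mulr0 subrr.
have -> : ('X * ('X^2 - 1) ^+ n.+1 : {poly R})^`() =
    (2 * n%:R + 3) *: ('X^2 - 1) ^+ n.+1 + (2 * n%:R + 2) *: ('X^2 - 1) ^+ n.
  rewrite derivM derivX deriv_exp deriv_X2 -!mul_polyC !rmorphD !rmorphM/= !polyC_natr.
  have xx : 'X * 'X = ('X^2 - 1) + 1 :> {poly R} by rewrite subrK expr2.
  move: ('X^2 - 1) xx => X2 xx; rewrite !exprS; move: (X2 ^+ n) => P.
  transitivity (X2 * P + 2 * n.+1%:R * ('X * 'X) * P); first by ring.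
  by rewrite xx -[n.+1%:R]natr1; ring.
rewrite zonalD !zonalZ => h; apply: contra IH => /eqP e.
move: h; rewrite e mulr0 add0r => /eqP; rewrite mulf_eq0 => /orP[|//].
by rewrite gt_eqF// ltr_wpDl// mulr_ge0.
Qed.

Definition gegen (n a : nat) p : R := zonal ((1 - 'X^2) ^+ a * theta R n a * p).

(** [rodr_sym] absorbs the weight by turning the derivative of order n + a into the one of order n -
    a; n - a integrations by parts then move it onto [p]. *)
Lemma gegenE n a p : (a <= n)%N -> gegen n a p =
  (-1) ^+ n * ((n + a)`!%:R / (n - a)`!%:R) * zonal (('X^2 - 1) ^+ n * p^`(n - a)).
Proof.
move=> an; have f0 : (n - a)`!%:R != 0 :> R by rewrite pnatr_eq0 -lt0n fact_gt0.
apply: (mulfI f0); rewrite -zonalZ.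
have -> : (n - a)`!%:R *: ((1 - 'X^2) ^+ a * theta R n a * p) =
    ((-1) ^+ a * (n + a)`!%:R) *: (rodr R n (n - a) * p).
  have := rodr_sym R an.
  rewrite -!mul_polyC !rmorphM !rmorphXn rmorphN1 /= !polyC_natr.
  have -> : (1 - 'X^2 : {poly R}) = (-1) * ('X^2 - 1) by ring.
  rewrite exprMn -/(theta R n a); move: (('X^2 - 1) ^+ a) (theta R n a) (rodr R n _) => A B C h.
  transitivity ((-1) ^+ a * ((n + a)`!%:R * C) * p); last by ring.
  by rewrite -h; ring.
rewrite zonalZ zonal_rodr ?leq_subr//.
have -> : (-1) ^+ n = (-1) ^+ (n - a) * (-1) ^+ a :> R by rewrite -exprD subnK.
by field.
Qed.

Lemma gegen_small n a p : (a <= n)%N -> (size p <= n - a)%N -> gegen n a p = 0.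
Proof.
move=> an sp; rewrite gegenE// derivn_poly0// mulr0 zonal0 mulr0//.
Qed.

Lemma gegen_neq0 n a p : (a <= n)%N -> size p = (n - a).+1 -> gegen n a p != 0.
Proof.
move=> an sp; rewrite gegenE//.
have -> : p^`(n - a) = ((lead_coef p) *+ (n - a)`!)%:P.
  apply/polyP => i; rewrite coef_derivn coefC; case: i => [|i] /=.
    by rewrite addn0 ffactnn /lead_coef sp.
  by rewrite nth_default ?mul0rn// sp; lia.
rewrite mulrC [_ * _%:P]mulrC mul_polyC zonalZ.
rewrite !mulf_neq0 ?zonal_weight_neq0 ?signr_eq0 ?invr_eq0 ?pnatr_eq0 -?lt0n ?fact_gt0//.
rewrite mulrn_eq0 negb_or -lt0n fact_gt0 lead_coef_eq0 -size_poly_gt0 sp//.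
Qed.

Lemma rodr_parity l j : rodr R l j \Po (- 'X) = (-1) ^+ j *: rodr R l j.
Proof.
elim: j => [|j IH].
  rewrite expr0 scale1r /rodr derivn0 rmorphXn rmorphB/= rmorphXn/= comp_polyX rmorph1.
  by rewrite sqrrN.
have := congr1 (@deriv R) IH.
rewrite deriv_comp -rodrS derivN derivX mulrN1 derivZ -rodrS => /eqP.
by rewrite eqr_oppLR => /eqP ->; rewrite exprS mulN1r scaleNr.
Qed.

Lemma gegen_odd (n a K L : nat) : odd (n + K + L) ->
  gegen n a (theta R K 0 * theta R L a) = 0.
Proof.
move=> o; apply: zonal_odd.
rewrite !rmorphM rmorphXn rmorphB/= rmorphXn/= comp_polyX rmorph1 sqrrN !rodr_parity.
rewrite -!scalerAr -!scalerAl -!scalerAr !scalerA -!exprD.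
rewrite -signr_odd (_ : odd _ = true) ?expr1 ?scaleN1r//.
by lia.
Qed.

End legendre_integrals.

Section triple_products.
Context {R : realType}.
Local Notation mu := (@lebesgue_measure R).
Local Notation S := (@sphere R).

Definition cisz (j : int) (p : R) : R[i] := cos (j%:~R * p) +i* sin (j%:~R * p).

Lemma ciszD i j p : cisz (i + j) p = cisz i p * cisz j p.
Proof.
by rewrite /cisz intrD mulrDl cosD sinD; apply: eq_complexP; rewrite ?ReMi ?ImMi/=; ring.
Qed.

Lemma cisz_conj (a : R) j p : (a%:C * cisz j p)^*%R = a%:C * cisz (- j) p.
Proof.
rewrite /cisz mulrNz mulNr cosN sinN.
by apply: eq_complexP; rewrite ?ReCi ?ImCi ?ReMi ?ImMi/=; ring.
Qed.

Lemma cisz0 p : cisz 0 p = 1.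
Proof. by rewrite /cisz mul0r cos0 sin0. Qed.

Lemma harm_cstN l m : harm_cst l (- m) = (-1) ^+ `|m| * harm_cst l m :> R.
Proof.
rewrite /harm_cst abszN !mulrA; congr (_ * _ / _).
have e2 (n : nat) : (-1) ^+ n * (-1) ^+ n = 1 :> R by rewrite -expr2 sqrr_sign.
case: m => [[|a]|a]; first by rewrite /= expr0 mulr1.
  by rewrite /= e2.
by rewrite NegzE opprK/= mulr1.
Qed.

Lemma Y_conj l m (x : pt R) : (`|m| <= l)%N ->
  Y l (- m) x = ((-1) ^+ `|m|)%:C * (Y l m x)^*.
Proof.
move=> ml; rewrite /Y !sph_harmE ?abszN// ?sin_polar_ge0//.
rewrite harm_cstN -/(cisz m (azimuth x)) -/(cisz (- m) (azimuth x)).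
rewrite cisz_conj.
have h (e a b c : R) (z : R[i]) : (e * a * b * c)%:C * z = e%:C * ((a * b * c)%:C * z).
  by rewrite -!(mulrA e) (rmorphM (real_complex R)) mulrA.
exact: h.
Qed.

Lemma cos_2pi_int (j : int) : cos (j%:~R * (2 * pi)) = 1 :> R.
Proof.
have e (n : nat) : cos (n%:R * (2 * pi)) = 1 :> R.
  elim: n => [|n IH]; first by rewrite mul0r cos0.
  by rewrite -natr1 mulrDl mul1r cos_2piD.
case: j => n; first exact: e.
by rewrite NegzE mulrNz mulNr cosN e.
Qed.

Lemma sin_2pi_int (j : int) : sin (j%:~R * (2 * pi)) = 0 :> R.
Proof.
have e (n : nat) : sin (n%:R * (2 * pi)) = 0 :> R.
  elim: n => [|n IH]; first by rewrite mul0r sin0.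
  by rewrite -natr1 mulrDl mul1r sin_2piD.
case: j => n; first exact: e.
by rewrite NegzE mulrNz mulNr sinN e oppr0.
Qed.

Let continuous_mul (c : R) : continuous (fun p : R => c * p).
Proof. by apply: continuousM_fun; [exact: continuous_cst_fun|exact: continuous_id_fun]. Qed.

Lemma continuous_cos_mul (c : R) : continuous (fun p : R => cos (c * p)).
Proof. exact: continuous_compfun (@continuous_mul c) (@continuous_cos R). Qed.

Lemma continuous_sin_mul (c : R) : continuous (fun p : R => sin (c * p)).
Proof. exact: continuous_compfun (@continuous_mul c) (@continuous_sin R). Qed.

Let is_derive_mul (c t : R) : is_derive t 1 (fun p : R => c * p) c.
Proof.
have := is_deriveZ c (is_derive_id t (1 : R)).
by rewrite /GRing.scale/= mulr1.
Qed.

Let pi2_ge0 : 0 <= 2 * pi :> R.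
Proof. by rewrite mulr_ge0// pi_ge0. Qed.

Lemma Rintegral_cos_period (j : int) :
  \int[mu]_(p in `[0, 2 * pi]) cos (j%:~R * p) = if j == 0 then 2 * pi else 0.
Proof.
case: eqP => [->|/eqP j0].
  have c1 : continuous (fun _ : R => 1 : R) by exact: continuous_cst_fun.
  have d1 (x : R) : 0 <= x <= 2 * pi -> is_derive x 1 (fun x : R => x) (1 : R).
    by move=> _; exact: is_derive_id.
  transitivity (\int[mu]_(p in `[0, 2 * pi]) (1 : R)).
    by apply: eq_Rintegral => p _; rewrite mul0r cos0.
  by rewrite (integral_derive_itv pi2_ge0 c1 d1) subr0.
have j0' : j%:~R != 0 :> R by rewrite intr_eq0.
have d (x : R) : 0 <= x <= 2 * pi ->
    is_derive x 1 (fun x : R => j%:~R^-1 * sin (j%:~R * x)) (cos (j%:~R * x)).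
  move=> _.
  have := is_deriveZ (j%:~R^-1) (is_derive1_comp (is_derive_sin (j%:~R * x)) (is_derive_mul j%:~R x)).
  by rewrite /GRing.scale/= mulrCA mulVf// mulr1.
by rewrite (integral_derive_itv pi2_ge0 (@continuous_cos_mul j%:~R) d) sin_2pi_int !mulr0 sin0 mulr0 subrr.
Qed.

Lemma Rintegral_sin_period (j : int) :
  \int[mu]_(p in `[0, 2 * pi]) sin (j%:~R * p) = 0.
Proof.
have [->|j0] := eqVneq j 0.
  by rewrite /Rintegral integral0_eq// => p _; rewrite mul0r sin0.
have j0' : j%:~R != 0 :> R by rewrite intr_eq0.
have d (x : R) : 0 <= x <= 2 * pi ->
    is_derive x 1 (fun x : R => (- j%:~R^-1) * cos (j%:~R * x)) (sin (j%:~R * x)).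
  move=> _.
  have := is_deriveZ (- j%:~R^-1) (is_derive1_comp (is_derive_cos (j%:~R * x)) (is_derive_mul j%:~R x)).
  by rewrite /GRing.scale/= !mulNr mulrN opprK mulrC -mulrA divff// mulr1.
rewrite (integral_derive_itv pi2_ge0 (@continuous_sin_mul j%:~R) d).
by rewrite cos_2pi_int mulr0 cos0 subrr.
Qed.

Lemma RintegralZ_itv (c a b : R) (f : R -> R) : continuous f ->
  \int[mu]_(x in `[a, b]) (c * f x) = c * \int[mu]_(x in `[a, b]) f x.
Proof. by move=> cf; rewrite RintegralZl//; exact: continuous_integrable_itv. Qed.

Lemma sphere_product (f : pt R -> R) (A b : R -> R) : continuous f ->
  continuous A -> continuous b ->
  (forall t p : R, f (sin t * cos p, sin t * sin p, cos t) = A t * b p) ->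
  \int[dS R]_(x in S) f x =
  (\int[mu]_(t in `[0, pi]) (A t * sin t)) * \int[mu]_(p in `[0, 2 * pi]) b p.
Proof.
move=> cf cA cb e; rewrite /Rintegral integral_sphere_angles//.
have cAs : continuous (fun t => A t * sin t).
  by apply: continuousM_fun => //; exact: continuous_sin.
transitivity (fine (\int[mu]_(p in `[0%R, (2 * pi)%R])
    ((\int[mu]_(t in `[0, pi]) (A t * sin t)) * b p)%:E)%E).
  congr fine; apply: eq_integral => p _.
  rewrite mulrC -RintegralZ_itv// -integral_EFin_itv; last first.
    by apply: continuousM_fun => //; exact: continuous_cst_fun.
  by apply: eq_integral => t _; rewrite e -mulrA mulrCA.
exact: RintegralZ_itv.
Qed.

Lemma cint_sphere_product (u : pt R -> R[i]) (A : R -> R) (j : int) : ccont u ->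
  continuous A ->
  (forall t p : R, u (sin t * cos p, sin t * sin p, cos t) = (A t)%:C * cisz j p) ->
  cint (dS R) S u =
  ((\int[mu]_(t in `[0, pi]) (A t * sin t)) * (if j == 0 then 2 * pi else 0))%:C.
Proof.
move=> [cR cI] cA e; rewrite /cint.
rewrite (sphere_product cR cA (@continuous_cos_mul j%:~R)); last first.
  by move=> t p; rewrite e ReMi/= mul0r subr0.
rewrite (sphere_product cI cA (@continuous_sin_mul j%:~R)); last first.
  by move=> t p; rewrite e ImMi/= mul0r addr0.
by rewrite Rintegral_cos_period Rintegral_sin_period mulr0.
Qed.

(** The form in which the pairing produces the Gaunt coefficient, with a conjugate in place of the
    order -m; [Y_conj] supplies the sign between the two. *)
Definition triple (K n L : nat) (m m' : int) : R[i] :=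
  cint (dS R) S (fun x => harm L m' x * (harm K 0 x * (harm n m x)^*)).

Lemma harm_sphere l m (t p : R) : (`|m| <= l)%N ->
  harm l m (sin t * cos p, sin t * sin p, cos t) =
  (harm_cst l m * sin t ^+ `|m| * (theta R l `|m|).[cos t])%:C * cisz m p.
Proof.
by move=> ml; have := harmE 1 t p ml; rewrite !mul1r expr1n mul1r.
Qed.

Lemma continuous_sinX n : continuous (fun t : R => sin t ^+ n).
Proof. by apply: continuousX_fun; exact: continuous_sin. Qed.

(** The azimuthal integral forces m' = m, after which the power |m| + |m'| of the sine is even and
    becomes the polynomial weight (1 - x^2)^|m|. *)
Lemma tripleE K n L m m' : (`|m| <= n)%N -> (`|m'| <= L)%N ->
  triple K n L m m' = if m' == m then
    (harm_cst K 0 * harm_cst n m * harm_cst L m *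
     gegen n `|m| (theta R K 0 * theta R L `|m|) * (2 * pi))%:C else 0.
Proof.
move=> mn mL.
pose A (t : R) := harm_cst K 0 * harm_cst n m * harm_cst L m' *
  ((theta R K 0 * theta R L `|m'| * theta R n `|m|).[cos t] * sin t ^+ (`|m| + `|m'|)).
have cA : continuous A.
  apply: continuousM_fun; first exact: continuous_cst_fun.
  apply: continuousM_fun; first exact: continuous_horner_cos.
  exact: continuous_sinX.
rewrite /triple (@cint_sphere_product _ A (m' - m))//; first last.
- move=> t p; rewrite !harm_sphere// cisz0 mulr1.
  rewrite cisz_conj ciszD /A !hornerM exprD absz0 expr0 mulr1.
  move: (harm_cst K 0) (harm_cst n m) (harm_cst L m') => a b c.
  move: (theta R K 0).[cos t] (theta R L _).[cos t] (theta R n _).[cos t] => d e f.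
  move: (cisz _ _) (cisz _ _) (sin t ^+ `|m|) (sin t ^+ `|m'|) => g h i j.
  by rewrite !(rmorphM (real_complex R))/=; ring.
- apply: C1c_ccont; apply: cpoly_C1c; apply: cpolyM; first exact: cpoly_harm.
  by apply: cpolyM; [exact: cpoly_harm|apply: cpoly_conj; exact: cpoly_harm].
rewrite subr_eq0 /A; case: eqP => [->|_]; last by rewrite mulr0.
congr (_%:C); congr (_ * _).
rewrite /gegen /zonal -RintegralZ_itv; last first.
  by apply: continuousM_fun; [exact: continuous_horner_cos|exact: continuous_sin].
apply: eq_Rintegral => t _.
rewrite !hornerM horner_exp !hornerE/= -sin2cos2 -exprM addnn -mul2n.
by move: (_.[_]) (_.[_]) (_.[_]) => d e f; ring.
Qed.

End triple_products.

(** * The Gamma function at half-integers *)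

Section gamma.
Context {R : realType}.
Local Notation mu := (@lebesgue_measure R).

(** The derivative is asked for in the open interval only, because the square root in [expsqrt] is
    not differentiable at 0. *)
Lemma integral_derive_oo (F f : R -> R) (a b : R) : a < b -> continuous f ->
  continuous F -> (forall x, a < x < b -> is_derive x 1 F (f x)) ->
  \int[mu]_(x in `[a, b]) f x = F b - F a.
Proof.
move=> ab cf cF dF; rewrite /Rintegral (@continuous_FTC2 _ f F)//.
- exact: continuous_subspaceT.
- split.
  + by move=> x; rewrite in_itv/= => axb; have [] := dF x axb.
  + by apply: cvg_at_right_filter; apply: cF.
  + by apply: cvg_at_left_filter; apply: cF.
- move=> x; rewrite in_itv/= => axb.
  by rewrite derive1E; have [_ ->] := dF x axb.
Qed.

(** The integrand t^(n/2) e^(-t) of Gamma(n/2 + 1); a natural power of the square root is continuous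
    on the whole line and covers integers and half-integers alike. *)
Definition expsqrt (n : nat) (t : R) : R := Num.sqrt t ^+ n * expR (- t).

Lemma expsqrt_ge0 n t : 0 <= expsqrt n t.
Proof. by apply: mulr_ge0; [apply: exprn_ge0; exact: sqrtr_ge0|exact: expR_ge0]. Qed.

Lemma continuous_expsqrt n : continuous (expsqrt n).
Proof.
apply: continuousM_fun; first by apply: continuousX_fun; apply: continuous_sqrt_fun; exact: continuous_id_fun.
apply: continuous_compfun (@continuous_expR R).
by apply: continuousN_fun; exact: continuous_id_fun.
Qed.

Lemma is_derive_expsqrt n (t : R) : 0 < t ->
  is_derive t 1 (fun t => - expsqrt n.+2 t) (expsqrt n.+2 t - (n%:R / 2 + 1) * expsqrt n t).
Proof.
move=> t0.
have ds := is_derive1_sqrt t0.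
have dX := is_deriveX n.+2 ds.
have dN := is_deriveN (is_derive_id t (1 : R)).
have dE := is_derive1_comp (is_derive_expR (- t)) dN.
have := is_deriveN (is_deriveM dX dE).
rewrite (_ : - (_ * _) = fun t => - expsqrt n.+2 t); last first.
  by apply/funext => x; rewrite /expsqrt !fctE.
move=> H; apply: (is_derive_eq H); rewrite exprfctE /= /GRing.scale/= /expsqrt.
have s0 : Num.sqrt t != 0 by rewrite gt_eqF// sqrtr_gt0.
move: (Num.sqrt t) (expR (- t)) s0 => s e s0.
by rewrite !exprS -!natr1; field.
Qed.

Definition gam (n : nat) : \bar R := (\int[mu]_(t in `[0%R, +oo[) (expsqrt n t)%:E)%E.
Definition gamN (n N : nat) : R := \int[mu]_(t in `[0, N.+1%:R]) expsqrt n t.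

Lemma gamN_cvg n : (gamN n N)%:E @[N --> \oo] --> gam n.
Proof.
have c := ge0_cvgn_integral (mu := mu) (@expsqrt_ge0 n)
  (continuous_measurable_fun (@continuous_expsqrt n)).
move: c; rewrite -cvg_shiftS/= => c.
rewrite (_ : (fun N => (gamN n N)%:E) =
  (fun N => \int[mu]_(t in `[0%R, N.+1%:R]) (expsqrt n t)%:E)%E)//.
by apply/funext => N; rewrite integral_EFin_itv//; exact: continuous_expsqrt.
Qed.

Lemma gamN_rec n N :
  gamN n.+2 N = (n%:R / 2 + 1) * gamN n N - expsqrt n.+2 N.+1%:R.
Proof.
have c1 := @continuous_expsqrt n.+2; have c2 := @continuous_expsqrt n.
have cf : continuous (fun t => expsqrt n.+2 t - (n%:R / 2 + 1) * expsqrt n t).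
  apply: continuousB_fun => //; apply: continuousM_fun => //; exact: continuous_cst_fun.
have cF : continuous (fun t => - expsqrt n.+2 t) by exact: continuousN_fun.
have NR : (0 : R) < N.+1%:R by rewrite ltr0n.
have dF (t : R) : 0 < t < N.+1%:R -> is_derive t 1 (fun t => - expsqrt n.+2 t)
    (expsqrt n.+2 t - (n%:R / 2 + 1) * expsqrt n t).
  by case/andP => t0 _; exact: is_derive_expsqrt.
have := integral_derive_oo NR cf cF dF.
have -> : \int[mu]_(x in `[0, N.+1%:R]) (expsqrt n.+2 x - (n%:R / 2 + 1) * expsqrt n x) =
    gamN n.+2 N - (n%:R / 2 + 1) * gamN n N.
  rewrite RintegralB//=; last 2 first.
  - exact: continuous_integrable_itv.
  - apply: continuous_integrable_itv; apply: continuousM_fun => //; exact: continuous_cst_fun.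
  by congr (_ - _); rewrite RintegralZl//; exact: continuous_integrable_itv.
rewrite [expsqrt _ 0]/expsqrt sqrtr0 expr0n mul0r oppr0 subr0 => h; lra.
Qed.

(** For r >= 1 one has sqrt r <= r and e^r >= r^(n+1) / (n+1)!, which leaves (n+1)! / r. *)
Lemma expsqrt_cvg0 n : expsqrt n (N.+1%:R : R) @[N --> \oo] --> 0.
Proof.
have h (N : nat) : expsqrt n N.+1%:R <= n.+1`!%:R * harmonic N.
  have N1 : (1 : R) <= N.+1%:R by rewrite ler1n.
  have NR : (0 : R) < N.+1%:R by rewrite ltr0n.
  have -> : harmonic N = N.+1%:R^-1 :> R by [].
  move: (N.+1%:R) N1 NR => r r1 r0.
  have s1 : Num.sqrt r ^+ n <= r ^+ n.
    apply: lerXn2r; rewrite ?nnegrE ?sqrtr_ge0 ?(ltW r0)//.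
    by rewrite -[leRHS]ger0_norm ?(ltW r0)// -sqrtr_sqr ler_sqrt ?sqr_ge0// expr2 ler_peMl// (ltW r0).
  have e1 : r ^+ n.+1 / n.+1`!%:R <= expR r.
    by apply: le_trans (expR_ge1Dxn n (ltW r0)); rewrite lerDr.
  have f0 : (0 : R) < n.+1`!%:R by rewrite ltr0n fact_gt0.
  rewrite /expsqrt expRN ler_pdivrMr ?expR_gt0//; apply: le_trans s1 _.
  move: e1; rewrite ler_pdivrMr// => e1.
  rewrite -(ler_pM2r r0) -exprSr; apply: le_trans e1 _.
  rewrite le_eqVlt; apply/orP; left; apply/eqP; field.
  by rewrite gt_eqF.
apply: (@squeeze_cvgr _ _ _ _ (fun=> 0) (fun N => n.+1`!%:R * harmonic N)).
- by apply: nearW => N; rewrite expsqrt_ge0 h.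
- exact: cvg_cst.
- rewrite -[X in _ --> X](mulr0 (n.+1`!%:R)); apply: cvgM; first exact: cvg_cst.
  exact: cvg_harmonic.
Qed.

Lemma gam_fin_rec n : gam n \is a fin_num ->
  gam n.+2 = ((n%:R / 2 + 1) * fine (gam n))%:E.
Proof.
move=> fn; have c := @gamN_cvg n; rewrite -(fineK fn) in c.
move/fine_cvg: c => /= c.
have c2 : (gamN n.+2 N)%:E @[N --> \oo] --> ((n%:R / 2 + 1) * fine (gam n))%:E.
  apply: cvg_EFin; first by apply: nearW.
  rewrite (_ : fine \o _ = fun N => (n%:R / 2 + 1) * gamN n N - expsqrt n.+2 N.+1%:R); last first.
    by apply/funext => N /=; exact: gamN_rec.
  rewrite -[_ * fine _]subr0; apply: cvgB; last exact: expsqrt_cvg0.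
  by apply: cvgM => //; exact: cvg_cst.
by rewrite -(cvg_lim _ (@gamN_cvg n.+2))// (cvg_lim _ c2).
Qed.

Lemma gam0 : gam 0 = 1%:E.
Proof.
have e N : gamN 0 N = 1 - expR (- N.+1%:R).
  have NR : (0 : R) < N.+1%:R by rewrite ltr0n.
  have cF : continuous (fun t : R => - expR (- t)).
    apply: continuousN_fun; apply: continuous_compfun (@continuous_expR R).
    by apply: continuousN_fun; exact: continuous_id_fun.
  have d (t : R) : 0 < t < N.+1%:R -> is_derive t 1 (fun t => - expR (- t)) (expsqrt 0 t).
    move=> _; have dN := is_deriveN (is_derive_id t (1 : R)).
    have := is_deriveN (is_derive1_comp (is_derive_expR (- t)) dN).
    by rewrite /expsqrt expr0 mul1r mulrN1 opprK.
  rewrite /gamN (integral_derive_oo NR (@continuous_expsqrt 0) cF d).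
  by rewrite oppr0 expR0; ring.
have c : (gamN 0 N)%:E @[N --> \oo] --> 1%:E.
  apply: cvg_EFin; first by apply: nearW.
  rewrite (_ : fine \o _ = fun N => 1 - expsqrt 0 N.+1%:R); last first.
    by apply/funext => N /=; rewrite e /expsqrt expr0 mul1r.
  have := cvgB (@cvg_cst _ (1 : R) _ \oo _) (@expsqrt_cvg0 0); rewrite subr0; exact.
by rewrite -(cvg_lim _ (@gamN_cvg 0))// (cvg_lim _ c).
Qed.

Lemma gam_ge0 n : (0 <= gam n)%E.
Proof. by apply: integral_ge0 => t _; rewrite lee_fin expsqrt_ge0. Qed.

Lemma gam1_fin : gam 1 \is a fin_num.
Proof.
rewrite ge0_fin_numE ?gam_ge0//.
have m (n : nat) : measurable_fun (`[0, +oo[%classic : set (measurableTypeR R)) (fun t => (expsqrt n t)%:E).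
  apply/measurable_EFinP; apply: measurable_funTS.
  by apply: continuous_measurable_fun; exact: continuous_expsqrt.
have p (n : nat) (t : R) : `[(0 : R), +oo[%classic t -> (0 <= (expsqrt n t)%:E)%E.
  by move=> _; rewrite lee_fin expsqrt_ge0.
(* With s the square root of t, s <= 1 + s^2. *)
apply: (@le_lt_trans _ _ (gam 0 + gam 2)%E).
  have mI : measurable (`[(0 : R), +oo[%classic : set (measurableTypeR R)) by exact: measurable_itv.
  rewrite /gam -(@ge0_integralD _ _ _ mu _ mI _ _ (p 0) (m 0) (p 2) (m 2)).
  refine (@ge0_le_integral _ _ _ mu _ mI _ _ (p 1) (m 1) (emeasurable_funD (m 0) (m 2)) _).
  move=> t; rewrite /= in_itv/= andbT => t0; rewrite -EFinD lee_fin /expsqrt.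
  rewrite -mulrDl ler_wpM2r ?expR_ge0// expr0 expr1.
  by move: (Num.sqrt t) (sqrtr_ge0 t) => s s0; nra.
by rewrite (@gam_fin_rec 0) gam0//= ltry.
Qed.

Lemma gam_fin n : gam n \is a fin_num.
Proof.
suff : gam n \is a fin_num /\ gam n.+1 \is a fin_num by case.
elim: n => [|n [IH1 IH2]]; first by rewrite gam0; split => //; exact: gam1_fin.
by split=> //; rewrite gam_fin_rec.
Qed.

(* Integrates [u >= u^2 - u^4 / 4] with [u] the square root of [t]. *)
Lemma gam1_gt0 : (0 < fine (gam 1)).
Proof.
have c n : gamN n N @[N --> \oo] --> fine (gam n).
  by have := @gamN_cvg n; rewrite -{1}(fineK (gam_fin n)) => /fine_cvg.
have g2 : fine (gam 2) = 1 by rewrite (@gam_fin_rec 0) gam0//= mul0r add0r mul1r.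
have g4 : fine (gam 4) = 2.
  by rewrite (@gam_fin_rec 2) ?gam_fin//= g2 divff// mulr1.
have h N : gamN 2 N - 4^-1 * gamN 4 N <= gamN 1 N.
  rewrite -subr_ge0.
  have i n : mu.-integrable `[0, N.+1%:R] (EFin \o expsqrt n).
    by apply: continuous_integrable_itv; exact: continuous_expsqrt.
  have i4 : mu.-integrable `[0, N.+1%:R] (EFin \o (fun t => 4^-1 * expsqrt 4 t)).
    by apply: continuous_integrable_itv; apply: continuousM_fun; [exact: continuous_cst_fun|exact: continuous_expsqrt].
  have i24 : mu.-integrable `[0, N.+1%:R] (EFin \o (fun t => expsqrt 2 t - 4^-1 * expsqrt 4 t)).
    apply: continuous_integrable_itv; apply: continuousB_fun; first exact: continuous_expsqrt.
    by apply: continuousM_fun; [exact: continuous_cst_fun|exact: continuous_expsqrt].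
  rewrite /gamN -RintegralZl// -RintegralB// -RintegralB//.
  apply: Rintegral_ge0 => t _; rewrite /expsqrt.
  have s0 := sqrtr_ge0 t; have e0 := expR_ge0 (- t).
  move: (Num.sqrt t) (expR (- t)) s0 e0 => s e s0 e0.
  have -> : s ^+ 1 * e - (s ^+ 2 * e - 4^-1 * (s ^+ 4 * e)) = (s * (1 - s + s ^+ 3 / 4)) * e by field.
  apply: mulr_ge0 => //; apply: mulr_ge0 => //.
  have : 0 <= (s - 1) ^+ 2 * (s + 2) by rewrite mulr_ge0 ?sqr_ge0 ?addr_ge0.
  nra.
have lim : gamN 2 N - 4^-1 * gamN 4 N @[N --> \oo] --> (1 - 4^-1 * 2 : R).
  apply: cvgB; first by rewrite -g2; exact: c.
  by apply: cvgM; [exact: cvg_cst|rewrite -g4; exact: c].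
have hl : 1 - 4^-1 * 2 <= fine (gam 1).
  by apply: (ler_cvg_to lim (c 1%N)); exact: nearW.
lra.
Qed.

Lemma gam_gt0 n : 0 < fine (gam n).
Proof.
suff : 0 < fine (gam n) /\ 0 < fine (gam n.+1) by case.
elim: n => [|n [IH1 IH2]]; first by rewrite gam0; split => //; exact: gam1_gt0.
split=> //; rewrite gam_fin_rec ?gam_fin//=.
by rewrite mulr_gt0// ltr_wpDl// divr_ge0.
Qed.

(** The multiples of 1/2 that are at least 1: every argument of [Gamma] met here is of this kind. *)
Definition half_integer (x : R) := exists n : nat, x = n%:R / 2 + 1.

Lemma Gamma_gam n : Gamma (n%:R / 2 + 1 : R) = fine (gam n).
Proof.
rewrite /Gamma /Rintegral /gam -integral_itv_obnd_cbnd; last first.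
  apply/measurable_EFinP; apply: measurable_funTS.
  by apply: continuous_measurable_fun; exact: continuous_expsqrt.
congr fine; apply: eq_integral => t; rewrite inE/= in_itv/= andbT => t0.
by rewrite addrK [n%:R / 2]mulrC powRrM powR12_sqrt ?(ltW t0)// powR_mulrn//.
Qed.

Lemma Gamma_gt0 (x : R) : half_integer x -> 0 < Gamma x.
Proof. by case=> n ->; rewrite Gamma_gam gam_gt0. Qed.

Lemma half_integerD1 (x : R) : half_integer x -> half_integer (x + 1).
Proof. by case=> n ->; exists n.+2; rewrite -!natr1; field. Qed.

Lemma half_integerD (x : R) k : half_integer x -> half_integer (x + k%:R).
Proof.
move=> hx; elim: k => [|k IH]; first by rewrite addr0.
by rewrite -natr1 addrA; exact: half_integerD1.
Qed.

Lemma GammaD1 (x : R) : half_integer x -> Gamma (x + 1) = x * Gamma x.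
Proof.
case=> n ->; rewrite Gamma_gam.
have -> : n%:R / 2 + 1 + 1 = n.+2%:R / 2 + 1 :> R by rewrite -!natr1; field.
by rewrite Gamma_gam gam_fin_rec ?gam_fin.
Qed.

Lemma GammaDn (x : R) k : half_integer x ->
  Gamma (x + k%:R) = \prod_(i < k) (x + i%:R) * Gamma x.
Proof.
move=> hx; elim: k => [|k IH]; first by rewrite addr0 big_ord0 mul1r.
rewrite -natr1 addrA GammaD1; last exact: half_integerD.
by rewrite IH big_ord_recr/= mulrCA mulrA.
Qed.

Lemma pochhammerE (x : R) k : half_integer x ->
  pochhammer x k = \prod_(i < k) (x + i%:R).
Proof.
by move=> hx; rewrite /pochhammer GammaDn// mulfK// gt_eqF// Gamma_gt0.
Qed.

Lemma gbinomialE (y : R) k : half_integer y ->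
  gbinomial (y + k%:R - 1) k = \prod_(i < k) (y + i%:R) / k`!%:R.
Proof.
move=> hy; rewrite /gbinomial subrK.
have -> : y + k%:R - 1 - k%:R + 1 = y by ring.
rewrite GammaDn//; have G0 : Gamma y != 0 by rewrite gt_eqF// Gamma_gt0.
have f0 : k`!%:R != 0 :> R by rewrite pnatr_eq0 -lt0n fact_gt0.
by field; rewrite G0 f0.
Qed.

End gamma.

(** * Radial moments *)

Section alternating_sums.
Variable K : fieldType.
Implicit Types (q r : nat) (h : nat -> K).

Definition altsum q h : K := \sum_(j < q.+1) (-1) ^+ j * 'C(q, j)%:R * h j.

Lemma eq_altsum q h h' : (forall j, (j <= q)%N -> h j = h' j) -> altsum q h = altsum q h'.
Proof. by move=> e; apply: eq_bigr => j _; rewrite e// -ltnS. Qed.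

Lemma altsumD q h h' : altsum q (fun j => h j + h' j) = altsum q h + altsum q h'.
Proof. by rewrite -big_split; apply: eq_bigr => j _; rewrite mulrDr. Qed.

Lemma altsumZ q (c : K) h : altsum q (fun j => c * h j) = c * altsum q h.
Proof. by rewrite mulr_sumr; apply: eq_bigr => j _; rewrite mulrCA. Qed.

Lemma altsum_recl q h : altsum q h =
  h 0 + \sum_(j < q.+1) (-1) ^+ j.+1 * 'C(q, j.+1)%:R * h j.+1.
Proof.
rewrite /altsum big_ord_recl/= expr0 bin0 !mul1r; congr (_ + _).
by rewrite big_ord_recr/= bin_small// mulr0 mul0r addr0.
Qed.

Lemma altsumS q h : altsum q.+1 h = altsum q h - altsum q (fun j => h j.+1).
Proof.
rewrite [in RHS]altsum_recl /altsum big_ord_recl/= expr0 bin0 !mul1r -addrA; congr (_ + _).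
rewrite -sumrB; apply: eq_bigr => j _; rewrite /bump/= add1n binS natrD exprS.
by ring.
Qed.

Lemma altsum_mul q h : altsum q.+1 (fun j => j%:R * h j) =
  - q.+1%:R * altsum q (fun j => h j.+1).
Proof.
rewrite /altsum big_ord_recl/= mul0r mulr0 add0r mulr_sumr; apply: eq_bigr => j _.
rewrite /bump/= add1n.
have := congr1 (fun n : nat => n%:R : K) (mul_bin_diag q.+1 j).
rewrite !natrM [q.+1.-1]/= => e; rewrite exprS.
transitivity (- ((-1) ^+ j * (j.+1%:R * 'C(q.+1, j.+1)%:R) * h j.+1)); first by ring.
by rewrite -e; ring.
Qed.

(** A finite difference of order q kills polynomials of degree r < q. The last factor is split off;
    its part in j is absorbed by the binomial coefficient, which lowers q and shifts j. *)
Lemma altsum_prod0 q r (b : nat -> K) : (r < q)%N ->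
  altsum q (fun j => \prod_(i < r) (b i - j%:R)) = 0.
Proof.
elim: r q b => [|r IH] [//|q] b rq.
  rewrite altsumS; apply/eqP; rewrite subr_eq0; apply/eqP.
  by apply: eq_altsum => j _; rewrite !big_ord0.
rewrite (@eq_altsum _ _ (fun j => b r * \prod_(i < r) (b i - j%:R) +
   (-1) * (j%:R * \prod_(i < r) (b i - j%:R)))); last first.
  by move=> j _; rewrite big_ord_recr/=; ring.
rewrite altsumD !altsumZ altsum_mul IH ?mulr0 ?add0r; last exact: ltnW.
rewrite (@eq_altsum _ _ (fun j => \prod_(i < r) ((b i - 1) - j%:R))) ?(IH q (fun i => b i - 1)) ?mulr0//.
by move=> j _; apply: eq_bigr => i _; rewrite -natr1; ring.
Qed.

(** The partial fraction expansion of the inverse of a (a - 1) ... (a - q), by induction through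
    Pascal's rule [altsumS]. *)
Lemma altsum_inv q (a : K) : (forall i, (i <= q)%N -> a - i%:R != 0) ->
  altsum q (fun j => (a - j%:R)^-1) = (-1) ^+ q * q`!%:R / \prod_(i < q.+1) (a - i%:R).
Proof.
elim: q a => [|q IH] a h.
  by rewrite /altsum !big_ord1 expr0 bin0 !mul1r.
have e1 (j : nat) : a - j.+1%:R = (a - 1) - j%:R by rewrite -natr1; ring.
have h1 i : (i <= q)%N -> a - i%:R != 0 by move=> iq; apply: h; exact: leqW.
have h2 i : (i <= q)%N -> a - 1 - i%:R != 0 by move=> iq; rewrite -e1; exact: h.
rewrite altsumS IH// (@eq_altsum _ (fun j => _) (fun j => (a - 1 - j%:R)^-1)); last first.
  by move=> j _; rewrite e1.
rewrite IH//.
have p1 : \prod_(i < q.+2) (a - i%:R) = \prod_(i < q.+1) (a - i%:R) * (a - q.+1%:R).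
  by rewrite big_ord_recr.
have p2 : \prod_(i < q.+2) (a - i%:R) = a * \prod_(i < q.+1) (a - 1 - i%:R).
  rewrite big_ord_recl/= subr0; congr (_ * _); apply: eq_bigr => i _.
  by rewrite /bump/= add1n e1.
have a0 : a != 0 by have := h 0 isT; rewrite subr0.
have aq : a - q.+1%:R != 0 by exact: h.
have n1 : \prod_(i < q.+1) (a - i%:R) != 0.
  by apply/prodf_neq0 => i _; apply: h1; rewrite -ltnS.
have n2 : \prod_(i < q.+1) (a - 1 - i%:R) != 0.
  by apply/prodf_neq0 => i _; apply: h2; rewrite -ltnS.
move: p1 p2 n1 n2; move: (\prod_(i < q.+2) _) (\prod_(i < q.+1) (a - i%:R)) (\prod_(i < q.+1) (a - 1 - i%:R)).
move=> P P1 P2 -> p2 n1 n2.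
have -> : P2 = P1 * (a - q.+1%:R) / a by rewrite p2 mulrAC divff// mul1r.
rewrite factS natrM exprS; move: ((-1) ^+ q) (q`!%:R) => e f.
by move: aq; rewrite -natr1 => aq; field; rewrite n1 a0 aq.
Qed.

(** Write b r - j as (b r - a) + (a - j): the second part cancels the denominator and leaves a sum
    killed by [altsum_prod0], so each j in the numerator is replaced by a. *)
Lemma altsum_partial_fractions q r (b : nat -> K) (a : K) : (r <= q)%N ->
  (forall i, (i <= q)%N -> a - i%:R != 0) ->
  altsum q (fun j => \prod_(i < r) (b i - j%:R) / (a - j%:R)) =
  \prod_(i < r) (b i - a) * ((-1) ^+ q * q`!%:R / \prod_(i < q.+1) (a - i%:R)).
Proof.
move=> rq h; elim: r rq => [|r IH] rq.
  rewrite big_ord0 mul1r -altsum_inv//; apply: eq_altsum => j _.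
  by rewrite big_ord0 mul1r.
rewrite (@eq_altsum _ _ (fun j => (b r - a) * (\prod_(i < r) (b i - j%:R) / (a - j%:R)) +
   \prod_(i < r) (b i - j%:R))); last first.
  move=> j jq; rewrite big_ord_recr/=; have := h j jq.
  by move: (\prod_(i < r) _) => P nz; field.
rewrite altsumD altsumZ altsum_prod0// addr0 IH ?(ltnW rq)//.
rewrite [in RHS]big_ord_recr/= mulrA; congr (_ * _); exact: mulrC.
Qed.

End alternating_sums.

Section radial.
Context {R : realType}.

(** The coefficient of r^(L + 2q - 2s) in the radial Zernike polynomial, with quotients of Gamma
    values written as finite products. *)
Definition radial_coef (L q s : nat) : R :=
  Num.sqrt (2 * L%:R + 4 * q%:R + 3) *
  ((-1) ^+ s * 'C(q, s)%:R * (\prod_(i < q) (L%:R + q%:R + 3 / 2 + i%:R - s%:R) / q`!%:R)).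

Lemma gbinomial_nat (n k : nat) : (k <= n)%N -> gbinomial (n%:R : R) k = 'C(n, k)%:R.
Proof.
move=> kn.
have h0 : half_integer (1 : R) by exists 0; rewrite mul0r add0r.
have G j : Gamma (j%:R + 1 : R) = j`!%:R * Gamma 1.
  elim: j => [|j IH]; first by rewrite add0r fact0 mul1r.
  rewrite -natr1 GammaD1; last by rewrite addrC; exact: half_integerD.
  by rewrite IH factS natrM -natr1 mulrA.
rewrite /gbinomial -natrB// !G -(bin_fact kn) !natrM.
have G1 : Gamma (1 : R) != 0 by rewrite gt_eqF// Gamma_gt0.
have f1 : k`!%:R != 0 :> R by rewrite pnatr_eq0 -lt0n fact_gt0.
have f2 : (n - k)`!%:R != 0 :> R by rewrite pnatr_eq0 -lt0n fact_gt0.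
by field; rewrite G1 f1 f2.
Qed.

Lemma zernike_radialE L q (r : R) : zernike_radial L q r =
  \sum_(s < q.+1) radial_coef L q s * (r ^+ L * (r ^+ 2) ^+ (q - s)).
Proof.
rewrite /zernike_radial mulr_sumr; apply: eq_bigr => s _.
have sq : (s <= q)%N by rewrite -ltnS.
have g : gbinomial (L%:R + 2 * q%:R - s%:R + 2^-1) q =
    \prod_(i < q) (L%:R + q%:R + 3 / 2 + i%:R - s%:R) / q`!%:R :> R.
  have -> : L%:R + 2 * q%:R - s%:R + 2^-1 = (L%:R + q%:R - s%:R + 3 / 2) + q%:R - 1 :> R by field.
  rewrite (@gbinomialE _ (L%:R + q%:R - s%:R + 3 / 2)); last first.
    exists (2 * (L + (q - s)) + 1)%N.
    have := natrB R sq; move: (q - s)%N => d e.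
    by rewrite -[q%:R](subrK s%:R) -e; field.
  by congr (_ / _); apply: eq_bigr => i _; ring.
rewrite /radial_coef gbinomial_nat// g.
have -> : (L + 2 * q - 2 * s = L + 2 * (q - s))%N by lia.
by rewrite exprD exprM !mulrA.
Qed.

(** The first product on the right vanishes exactly when s <= k < q + s, which is where the
    triangular shape of the recovery formula comes from. *)
Lemma radial_moment (l k q s : nat) :
  \sum_(j < q.+1) radial_coef (l + 2 * s) q j /
    (2 * (q - j) + (l + 2 * s) + (l + 2 * k + 2) + 1)%:R =
  Num.sqrt (2 * l%:R + 4 * q%:R + 4 * s%:R + 3) / 2 *
  (\prod_(i < q) (k%:R - s%:R - i%:R) / \prod_(i < q.+1) (l%:R + k%:R + s%:R + 3 / 2 + i%:R)) :> R.
Proof.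
(* Chosen so that the denominator of index j is 2 (a - j); with the [b] below, b i - a = s - k + i
   no longer involves l or q. *)
pose a : R := q%:R + l%:R + s%:R + k%:R + 3 / 2.
pose b (i : nat) : R := (l + 2 * s)%:R + q%:R + 3 / 2 + i%:R.
have ha i : (i <= q)%N -> a - i%:R != 0.
  move=> iq; have : (i%:R : R) <= q%:R by rewrite ler_nat.
  have := ler0n R l; have := ler0n R s; have := ler0n R k.
  by rewrite /a => h1 h2 h3 h4; rewrite gt_eqF//; lra.
have f0 : q`!%:R != 0 :> R by rewrite pnatr_eq0 -lt0n fact_gt0.
set S := Num.sqrt (2 * l%:R + 4 * q%:R + 4 * s%:R + 3).
transitivity (S / 2 / q`!%:R * altsum q (fun j => \prod_(i < q) (b i - j%:R) / (a - j%:R))).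
  rewrite /altsum mulr_sumr; apply: eq_bigr => j _.
  have jq : (j <= q)%N by rewrite -ltnS.
  have -> : (2 * (q - j) + (l + 2 * s) + (l + 2 * k + 2) + 1)%:R = 2 * (a - j%:R) :> R.
    by have := natrB R jq; rewrite /a; move: (q - j)%N => d e; rewrite -[q%:R](subrK j%:R) -e; field.
  rewrite /radial_coef /b.
  have -> : 2 * (l + 2 * s)%:R + 4 * q%:R + 3 = 2 * l%:R + 4 * q%:R + 4 * s%:R + 3 :> R.
    by ring.
  rewrite -/S; have := ha j jq; move: (\prod_(i < q) _) ((-1) ^+ j) => P e nz.
  by field; rewrite nz f0.
rewrite altsum_partial_fractions//.
have -> : \prod_(i < q) (b i - a) = (-1) ^+ q * \prod_(i < q) (k%:R - s%:R - i%:R).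
  have -> : (-1) ^+ q = \prod_(i < q) (-1) :> R by rewrite prodr_const card_ord.
  rewrite -big_split/=; apply: eq_bigr => i _.
  by rewrite /a /b; field.
have -> : \prod_(i < q.+1) (a - i%:R) = \prod_(i < q.+1) (l%:R + k%:R + s%:R + 3 / 2 + i%:R).
  rewrite (reindex_inj rev_ord_inj)/=; apply: eq_bigr => i _.
  rewrite subSS natrB; last by rewrite -ltnS.
  by rewrite /a; ring.
have e2 : (-1) ^+ q * (-1) ^+ q = 1 :> R by rewrite -expr2 sqrr_sign.
have p0 : \prod_(i < q.+1) (l%:R + k%:R + s%:R + 3 / 2 + i%:R) != 0 :> R.
  apply/prodf_neq0 => i _.
  have := ler0n R l; have := ler0n R s; have := ler0n R k; have := ler0n R i => h1 h2 h3 h4.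
  by rewrite gt_eqF//; lra.
move: (\prod_(i < q.+1) _) p0 (\prod_(i < q) _) => P p0 P'.
transitivity (((-1) ^+ q * (-1) ^+ q) * (S / 2 * (P' / P))); last by rewrite e2 mul1r.
by move: ((-1) ^+ q) => e; field; rewrite f0 p0.
Qed.

End radial.

(** * The coefficients Q *)

Section pairing.
Context {R : realType}.
Local Notation B := (@ball3 R).
Local Notation S := (@sphere R).
Opaque grad.

Lemma harm_cst_neq0 l m : harm_cst l m != 0 :> R.
Proof.
rewrite /harm_cst !mulf_neq0//.
- by case: ifP => _; rewrite ?signr_eq0 ?oner_eq0.
- rewrite gt_eqF// sqrtr_gt0 mulr_gt0//.
    by rewrite divr_gt0// ?mulr_gt0 ?pi_gt0// ltr_wpDl// mulr_ge0.
Qed.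

Lemma size_thetaM K L a : (a <= L)%N ->
  size (theta R K 0 * theta R L a) = (K + (L - a)).+1.
Proof.
move=> aL; have s1 := size_theta R 0 K; have s2 := size_theta R a (L - a).
rewrite subnKC// add0n in s1 s2.
by rewrite size_mul ?s1 ?s2 -?size_poly_gt0 ?s1 ?s2//; lia.
Qed.

Section triples.
Variables (K n L : nat) (m : int).
Hypotheses (mn : (`|m| <= n)%N) (mL : (`|m| <= L)%N).

Lemma triple_low : (K + L < n)%N -> triple K n L m m = 0 :> R[i].
Proof.
move=> h; rewrite tripleE// eqxx gegen_small ?mulr0 ?mul0r//.
by rewrite size_thetaM//; lia.
Qed.

(** The two harmonics of order m play symmetric roles in [gegen], so the degree argument can be run
    with L in place of n. *)
Lemma triple_high : (K + n < L)%N -> triple K n L m m = 0 :> R[i].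
Proof.
move=> h; rewrite tripleE// eqxx.
have -> : gegen n `|m| (theta R K 0 * theta R L `|m|) =
    gegen L `|m| (theta R K 0 * theta R n `|m|) :> R.
  by rewrite /gegen; congr zonal; ring.
rewrite gegen_small ?mulr0 ?mul0r//.
by rewrite size_thetaM//; lia.
Qed.

Lemma triple_odd : odd (n + K + L) -> triple K n L m m = 0 :> R[i].
Proof. by move=> h; rewrite tripleE// eqxx gegen_odd// mulr0 mul0r. Qed.

Lemma triple_neq0 : n = (K + L)%N -> triple K n L m m != 0 :> R[i].
Proof.
move=> h; rewrite tripleE// eqxx.
rewrite (_ : 0 = 0%:C)// (inj_eq (@complexI R)).
have p0 : 2 * pi != 0 :> R by rewrite gt_eqF// mulr_gt0// pi_gt0.
have g0 : gegen n `|m| (theta R K 0 * theta R L `|m|) != 0.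
  by apply: gegen_neq0 => //; rewrite size_thetaM//; lia.
have := harm_cst_neq0 L m; have := harm_cst_neq0 n m; have := harm_cst_neq0 K 0.
move: (harm_cst K 0) (harm_cst n m) (harm_cst L m) p0 g0 => a b c p0 g0 a0 b0 c0.
by rewrite mulf_neq0// mulf_neq0// mulf_neq0// mulf_neq0.
Qed.

End triples.

Lemma triple_offdiag K n L m m' : (`|m| <= n)%N -> (`|m'| <= L)%N -> m' != m ->
  triple K n L m m' = 0 :> R[i].
Proof. by move=> mn mL h; rewrite tripleE// (negbTE h). Qed.

Lemma gauntE K n L m : (`|m| <= n)%N -> (`|m| <= L)%N ->
  gaunt R K n L 0 (- m) m = ((-1) ^+ `|m|)%:C * triple K n L m m.
Proof.
move=> mn mL.
have Ys l j (x : pt R) : (`|j| <= l)%N -> S x -> Y l j x = harm l j x.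
  by move=> jl; rewrite /sphere/= => e; rewrite -Y_harm// e expr1n mul1r.
rewrite /triple -cintZ; [|exact: measurable_sphere|]; last first.
  apply: cpoly_sphere; apply: cpolyM; first exact: cpoly_harm.
  by apply: cpolyM; [exact: cpoly_harm|apply: cpoly_conj; exact: cpoly_harm].
apply: eq_cint => x Sx; rewrite Y_conj// !Ys//.
move: (harm L m x) (harm K 0 x) ((harm n m x)^*%R) => a b c.
by ring.
Qed.

Definition zernike_poly (q L : nat) (m : int) (x : pt R) : R[i] :=
  \sum_(j < q.+1) (radial_coef L q j)%:C * (r2 x ^+ (q - j) * harm L m x).

Lemma zernikeE q L m (x : pt R) : (`|m| <= L)%N -> zernike q L m x = zernike_poly q L m x.
Proof.
move=> mL; rewrite /zernike zernike_radialE rmorph_sum/= mulr_suml.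
apply: eq_bigr => j _; rewrite -(Y_harm x mL) enorm_sqr -/(nrm2 x) r2E.
rewrite !(rmorphM (real_complex R))/= -!rmorphXn/= -!mulrA; congr (_ * _).
by ring.
Qed.

Lemma cpoly_zernike q L m : cpoly (zernike_poly q L m).
Proof.
apply: cpoly_sum => j; apply: cpolyM; first exact: cpoly_cst.
by apply: cpolyM; [apply: cpolyX; exact: cpoly_r2|exact: cpoly_harm].
Qed.

Fact real_div_natM (c : R) (d : nat) (z : R[i]) : (0 < d)%N ->
  c%:C * z = (c / d%:R)%:C * (d%:R * z).
Proof.
move=> d0; have d1 : d%:R != 0 :> R by rewrite pnatr_eq0 -lt0n.
have -> : (d%:R : R[i]) = (d%:R : R)%:C by exact: (esym (rmorph_nat (real_complex R) d)).
by rewrite mulrA -(rmorphM (real_complex R))/= divfK.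
Qed.

Lemma cint_zernike_lap q L m N (w : pt R -> R[i]) : (`|m| <= L)%N -> cpoly w -> euler N w ->
  cint (leb3 R) B (fun x => zernike_poly q L m x * lap w x) =
  (\sum_(j < q.+1) radial_coef L q j / (2 * (q - j) + L + N + 1)%:R)%:C *
  ((N%:R - L%:R) * (N + L + 1)%:R * cint (dS R) S (fun x => harm L m x * w x)).
Proof.
move=> mL pw ew.
have plw : cpoly (lap w).
  by apply: cpoly_sum => i; apply: cpoly_grad; exact: cpoly_grad.
have pj j : cpoly (fun x => r2 x ^+ j * (harm L m x * lap w x)).
  apply: cpolyM; first by apply: cpolyX; exact: cpoly_r2.
  by apply: cpolyM => //; exact: cpoly_harm.
have ih j := cpoly_ball (pj j).
transitivity (cint (leb3 R) B (fun x => \sum_(j < q.+1) (radial_coef L q j)%:C *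
    (r2 x ^+ (q - j) * (harm L m x * lap w x)))).
  apply: eq_cint => x _; rewrite mulr_suml; apply: eq_bigr => j _.
  by rewrite -mulrA; congr (_ * _); exact: esym (mulrA _ _ _).
etransitivity.
  apply: cint_sum; first exact: measurable_ball3.
  by move=> j; apply: cintegrableZ; [exact: measurable_ball3|exact: ih].
rewrite rmorph_sum/= mulr_suml; apply: eq_bigr => j _.
etransitivity; first by apply: cintZ; [exact: measurable_ball3|exact: ih].
have := green_moment (q - j) (@cpoly_harm R L m) pw (euler_harm mL) ew (@lap_harm R L m).
set I := cint _ _ _; set J := cint _ _ _; set d := (_ + _ + _ + 1)%N => e.
rewrite -e; apply: real_div_natM.
by rewrite /d addn1.
Qed.

Section weight.
Variables (K n : nat) (m : int).
Hypotheses (K0 : (0 < K)%N) (mn : (`|m| <= n)%N) (n0 : (0 < n)%N).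

Definition uf (x : pt R) : R[i] := K%:R^-1 * harm K 0 x.
Definition ug (x : pt R) : R[i] := n%:R^-1 * harm n m x.
Definition hprod (x : pt R) : R[i] := harm K 0 x * (harm n m x)^*.
Definition weight (x : pt R) : R[i] := \sum_(i < 3) grad uf i x * (grad ug i x)^*.

Lemma cpoly_uf : cpoly uf.
Proof. by apply: cpolyM; [exact: cpoly_cst|exact: cpoly_harm]. Qed.

Lemma cpoly_ug : cpoly ug.
Proof. by apply: cpolyM; [exact: cpoly_cst|exact: cpoly_harm]. Qed.

Lemma cpoly_hprod : cpoly hprod.
Proof. by apply: cpolyM; [exact: cpoly_harm|apply: cpoly_conj; exact: cpoly_harm]. Qed.

Lemma cpoly_weight : cpoly weight.
Proof.
apply: cpoly_sum => i; apply: cpolyM; first by apply: cpoly_grad; exact: cpoly_uf.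
by apply: cpoly_conj; apply: cpoly_grad; exact: cpoly_ug.
Qed.

Lemma euler_hprod : euler (K + n) hprod.
Proof.
apply: eulerM; [exact: cpoly_harm|by apply: cpoly_conj; exact: cpoly_harm| |].
  exact: euler_harm.
by apply: euler_conj; [exact: cpoly_harm|exact: euler_harm].
Qed.

(** Both factors are harmonic, so only the cross term of [lapM] survives; K n undoes the division by
    the degrees. *)
Lemma lap_hprod x : lap hprod x = 2 * (K%:R * n%:R) * weight x.
Proof.
have p1 := @cpoly_harm R K 0; have p2 := @cpoly_harm R n m.
etransitivity; first exact: (lapM x p1 (cpoly_conj p2)).
have -> : lap (fun x => (harm n m x)^*) x = 0.
  by etransitivity; [exact: (lap_conj x p2)|rewrite lap_harm; exact: conjc0].
rewrite lap_harm mul0r mulr0 addr0 add0r -mulrA; congr (_ * _).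
rewrite /weight mulr_sumr; apply: eq_bigr => i _.
have -> : grad uf i x = K%:R^-1 * grad (harm K 0) i x.
  exact: (gradZ _ i x (cpoly_C1c p1)).
have -> : grad ug i x = n%:R^-1 * grad (harm n m) i x.
  exact: (gradZ _ i x (cpoly_C1c p2)).
have -> : grad (fun x => (harm n m x)^*) i x = (grad (harm n m) i x)^*%R.
  exact: (grad_conj i x (cpoly_C1c p2)).
have -> : (n%:R^-1 * grad (harm n m) i x)^*%R = n%:R^-1 * (grad (harm n m) i x)^*%R.
  by rewrite rmorphM/= fmorphV rmorph_nat.
move: (grad (harm K 0) i x) ((grad (harm n m) i x)^*%R) => a b.
have K1 : K%:R != 0 :> R[i] by rewrite pnatr_eq0 -lt0n.
have n1 : n%:R != 0 :> R[i] by rewrite pnatr_eq0 -lt0n.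
by field; rewrite K1 n1.
Qed.

Lemma cint_zernike_weight q L m' : (`|m'| <= L)%N ->
  cint (leb3 R) B (fun x => zernike_poly q L m' x * weight x) =
  (2 * (K%:R * n%:R))^-1 *
  ((\sum_(j < q.+1) radial_coef L q j / (2 * (q - j) + L + (K + n) + 1)%:R)%:C *
  (((K + n)%:R - L%:R) * (K + n + L + 1)%:R * triple K n L m m')).
Proof.
move=> mL; rewrite -(cint_zernike_lap q mL cpoly_hprod euler_hprod).
have k0 : 2 * (K%:R * n%:R) != 0 :> R[i].
  by rewrite !mulf_neq0// pnatr_eq0 -lt0n.
apply: (mulfI k0); rewrite [RHS]mulrA mulfV// mul1r.
rewrite -cintZ; [|exact: measurable_ball3|]; last first.
  by apply: cpoly_ball; apply: cpolyM; [exact: cpoly_zernike|exact: cpoly_weight].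
by apply: eq_cint => x _; rewrite lap_hprod mulrCA.
Qed.

End weight.

Lemma half_integer_nat (n : nat) : half_integer (n%:R + 1 : R).
Proof. by exists (2 * n)%N; rewrite natrM; field. Qed.

Lemma half_integer_half (n : nat) : half_integer (n%:R + 5 / 2 : R).
Proof. by exists (2 * n + 3)%N; rewrite natrD natrM; field. Qed.

Fact weight_coef_real (K n N L M : nat) (c : R) (z : R[i]) :
  (2 * (K%:R * n%:R))^-1 * (c%:C * ((N%:R - L%:R) * M%:R * z)) =
  ((2 * (K%:R * n%:R))^-1 * (c * ((N%:R - L%:R) * M%:R)))%:C * z.
Proof.
have e (d : nat) : (d%:R : R[i]) = (d%:R : R)%:C by exact: (esym (rmorph_nat (real_complex R) d)).
rewrite !e -!(rmorphM (real_complex R)) -(rmorphB (real_complex R)) -!(rmorphM (real_complex R))/=.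
rewrite -(fmorphV (real_complex R)) !(rmorphM (real_complex R))/=.
by rewrite -!mulrA.
Qed.

Lemma prod_falling (x : R) q :
  \prod_(i < q) (x - q%:R + 1 + i%:R) = \prod_(i < q) (x - i%:R).
Proof.
rewrite (reindex_inj rev_ord_inj)/=; apply: eq_bigr => i _.
by rewrite natrB// -natr1; ring.
Qed.

(** With N = l + 2k + 2 and L = l + 2s, (N - L)(N + L + 1) = 4 (k - s + 1)(l + k + s + 3/2). The
    last factor cancels the first one of the product in [radial_moment], and the Pochhammer symbol
    of [Qcoef] starts at 5/2 instead of 3/2. *)
Fact weight_coef_identity (S k s l P1 P3 : R) :
  k + 1 != 0 -> l + k + 1 != 0 -> P3 != 0 -> (l + k + s) * 2 + 3 != 0 ->
  (2 * ((k + 1) * (l + k + 1)))^-1 * (S / 2 * (P1 / ((l + k + s + 3 / 2) * P3)) *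
   (((l + 2 * k + 2) - (l + 2 * s)) * ((l + 2 * k + 2) + (l + 2 * s) + 1))) =
  S * (k - s + 1) * P1 / ((k + 1) * (l + k + 1) * P3).
Proof. by move=> h1 h2 h3 h4; field; rewrite h1 h2 h3 h4. Qed.

Lemma zernike_weight_coef (k l q s : nat) (m : int) : (`|m| <= l)%N -> (q + s <= k)%N ->
  cint (leb3 R) B (fun x => zernike_poly q (l + 2 * s) m x * weight (k + 1) (l + k + 1) m x) =
  - Qcoef R l s k m q.
Proof.
move=> ml qs; rewrite cint_zernike_weight; try lia.
rewrite /Qcoef gauntE; try lia.
have -> : (k + 1 + (l + k + 1) = l + 2 * k + 2)%N by lia.
rewrite radial_moment weight_coef_real.
move: (triple _ _ _ _ _) => T.
have qk : (q%:R : R) + s%:R <= k%:R by rewrite -natrD ler_nat.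
have q0 := ler0n R q; have s0 := ler0n R s; have l0 := ler0n R l; have k0 := ler0n R k.
rewrite [pochhammer (k%:R - _ - _ + 1) q]pochhammerE; last first.
  have -> : k%:R - q%:R - s%:R = (k - q - s)%:R :> R by rewrite !natrB//; lia.
  exact: half_integer_nat.
rewrite [pochhammer (l%:R + _ + _ + _) q]pochhammerE; last first.
  by rewrite -!natrD; exact: half_integer_half.
have -> : \prod_(i < q) (k%:R - q%:R - s%:R + 1 + i%:R) = \prod_(i < q) (k%:R - s%:R - i%:R) :> R.
  by rewrite -prod_falling; apply: eq_bigr => i _; ring.
have -> : \prod_(i < q.+1) (l%:R + k%:R + s%:R + 3 / 2 + i%:R) =
    (l%:R + k%:R + s%:R + 3 / 2) * \prod_(i < q) (l%:R + k%:R + s%:R + 5 / 2 + i%:R) :> R.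
  rewrite big_ord_recl/= addr0; congr (_ * _); apply: eq_bigr => i _.
  by rewrite /bump/= add1n -natr1; field.
have p3 : \prod_(i < q) (l%:R + k%:R + s%:R + 5 / 2 + i%:R) != 0 :> R.
  by apply/prodf_neq0 => i _; have := ler0n R i => i0; rewrite gt_eqF//; lra.
move: (\prod_(i < q) (k%:R - s%:R - i%:R)) (\prod_(i < q) _) p3 => P1 P3 p3.
(* The sign (-1)^m of [Qcoef] cancels that of [gauntE]; the remaining -1 is the sign in front of
   [Qcoef]. *)
rewrite expfzDr ?oppr_eq0 ?oner_eq0// expr1z expN1r.
set S := Num.sqrt _.
have := @weight_coef_identity S k%:R s%:R l%:R P1 P3.
have -> : (l + 2 * k + 2)%:R = l%:R + 2 * k%:R + 2 :> R by ring.
have -> : (l + 2 * s)%:R = l%:R + 2 * s%:R :> R by ring.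
have -> : (k + 1)%:R = k%:R + 1 :> R by rewrite natrD.
have -> : (l + k + 1)%:R = l%:R + k%:R + 1 :> R by rewrite !natrD.
have -> : (l + 2 * k + 2 + (l + 2 * s) + 1)%:R = l%:R + 2 * k%:R + 2 + (l%:R + 2 * s%:R) + 1 :> R by ring.
move=> ->; [|by rewrite gt_eqF//; lra|by rewrite gt_eqF//; lra|by []|by rewrite gt_eqF//; lra].
have e2 : (-1) ^+ `|m| * (-1) ^+ `|m| = 1 :> R by rewrite -expr2 sqrr_sign.
rewrite [_%:C * (_ * _)]mulrA -(rmorphM (real_complex R))/= -mulNr -(rmorphN (real_complex R))/=.
congr (_%:C * _); move: e2; move: ((-1) ^+ `|m|) => e e2.
move: (_ * P3)^-1 => y.
transitivity ((e * e) * (S * (k%:R - s%:R + 1) * P1 * y)); first by rewrite e2 mul1r.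
by ring.
Qed.

Lemma zernike_weight_eq0 (k l q s : nat) (m : int) : (`|m| <= l)%N -> (k < q + s)%N ->
  cint (leb3 R) B (fun x => zernike_poly q (l + 2 * s) m x * weight (k + 1) (l + k + 1) m x) = 0.
Proof.
move=> ml qs; rewrite cint_zernike_weight; try lia.
have [sk|sk] := ltnP k.+1 s.
  by rewrite triple_high ?mulr0//; lia.
have [->|sk1] := eqVneq s k.+1.
  have -> : (k + 1 + (l + k + 1) = l + 2 * k.+1)%N by lia.
  by rewrite subrr !mul0r !mulr0.
have -> : (k + 1 + (l + k + 1) = l + 2 * k + 2)%N by lia.
rewrite radial_moment (_ : \prod_(i < q) _ = 0) ?mul0r ?mulr0 ?mul0r ?mulr0//.
(* Here s <= k, and the factor of index k - s in the product is zero. *)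
have kq : (k - s < q)%N by lia.
rewrite (bigD1 (Ordinal kq))//= natrB; last by lia.
by rewrite subrr mul0r.
Qed.

End pairing.

(** * Termwise pairing with the Zernike expansion *)

Section expansion.
Context {R : realType}.
Local Notation B := (@ball3 R).
Local Notation S := (@sphere R).
Opaque grad.

Lemma sum_truncate (V : zmodType) (a b : nat) (F : nat -> V) : (a <= b)%N ->
  (forall i, (a <= i)%N -> F i = 0) -> \sum_(i < b) F i = \sum_(i < a) F i.
Proof.
move=> ab F0; rewrite -(subnKC ab) big_split_ord/= [X in _ + X]big1 ?addr0// => i _.
by apply: F0; rewrite leq_addr.
Qed.

(** A range of length l + 2 T is taken so that the degrees surviving the selection rules are exactly
    l + 2 s with s < T. *)
Lemma sum_even_shift (V : zmodType) (l T : nat) (F : nat -> V) :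
  (forall i, (i < l)%N -> F i = 0) -> (forall s, F (l + 2 * s).+1 = 0) ->
  \sum_(i < l + 2 * T) F i = \sum_(s < T) F (l + 2 * s)%N.
Proof.
move=> Fl Fo; elim: T => [|T IH].
  by rewrite muln0 addn0 big_ord0 big1// => i _; exact: Fl.
have -> : (l + 2 * T.+1 = (l + 2 * T).+2)%N by lia.
by rewrite !big_ord_recr/= IH Fo addr0.
Qed.

Lemma sum_orders (V : zmodType) (L : nat) (m : int) (F : int -> V) :
  (forall j, (`|j| <= L)%N -> j != m -> F j = 0) ->
  \sum_(j < (2 * L).+1) F (j%:Z - L%:Z) = if (`|m| <= L)%N then F m else 0.
Proof.
move=> F0; case: ifP => mL.
  have h : (absz (m + L%:Z)%R < (2 * L).+1)%N by lia.
  rewrite (bigD1 (Ordinal h))//= big1 ?addr0 => [|j].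
    by congr F; lia.
  rewrite -val_eqE/= => jm; apply: F0; last by apply: contraNneq jm => e; apply/eqP; lia.
  by have := ltn_ord j; lia.
rewrite big1// => j _; have jL := ltn_ord j.
have jm : (`|j%:Z - L%:Z| <= L)%N by lia.
by apply: F0 => //; apply: contraFneq mL => <-.
Qed.

(* Unlike [zernike_sum], whose terms involve angles, this is manifestly a
   polynomial function. *)
Definition zernike_poly_sum (c : nat -> nat -> int -> R[i]) N (x : pt R) : R[i] :=
  \sum_(q < N) \sum_(L < N) \sum_(j < (2 * L).+1)
    c q L (j%:Z - L%:Z) * zernike_poly q L (j%:Z - L%:Z) x.

Lemma zernike_sumE c N (x : pt R) : zernike_sum c N x = zernike_poly_sum c N x.
Proof.
apply: eq_bigr => q _; apply: eq_bigr => L _; apply: eq_bigr => j _.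
by rewrite zernikeE//; have := ltn_ord j; lia.
Qed.

Lemma cpoly_zernike_sum c N : cpoly (zernike_poly_sum c N).
Proof.
apply: cpoly_sum => q; apply: cpoly_sum => L; apply: cpoly_sum => j.
by apply: cpolyM; [exact: cpoly_cst|exact: cpoly_zernike].
Qed.

Section projection.
Variables (k l : nat) (m : int).
Hypothesis ml : (`|m| <= l)%N.
Local Notation W := (@weight R (k + 1) (l + k + 1) m).
Local Notation P q L m' := (cint (leb3 R) B (fun x => zernike_poly q L m' x * W x)).

Let mn : (`|m| <= l + k + 1)%N. Proof. lia. Qed.
Let K0 : (0 < k + 1)%N. Proof. lia. Qed.
Let n0 : (0 < l + k + 1)%N. Proof. lia. Qed.

Lemma projection_offdiag q L m' : (`|m'| <= L)%N -> m' != m -> P q L m' = 0.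
Proof. by move=> mL h; rewrite cint_zernike_weight// triple_offdiag// !mulr0. Qed.

Lemma projection_low q L : (`|m| <= L)%N -> (L < l)%N -> P q L m = 0.
Proof. by move=> mL h; rewrite cint_zernike_weight// triple_low ?mulr0//; lia. Qed.

Lemma projection_odd q s : P q (l + 2 * s).+1 m = 0.
Proof. by rewrite cint_zernike_weight; try lia; rewrite triple_odd ?mulr0//; lia. Qed.

(** The right side is free of T: the pairing with the partial sums is eventually constant, so the
    limit is a finite sum. *)
Lemma cint_zernike_sum (c : nat -> nat -> int -> R[i]) T : (k < T)%N ->
  cint (leb3 R) B (fun x => zernike_poly_sum c (l + 2 * T) x * W x) =
  - \sum_(q < k.+1) \sum_(s < (k - q).+1) Qcoef R l s k m q * c q (l + 2 * s)%N m.
Proof.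
move=> kT.
have pW := @cpoly_weight R (k + 1) (l + k + 1) m.
have i3 q L m' a : cintegrable (leb3 R) B (fun x => a * (zernike_poly q L m' x * W x)).
  apply: cpoly_ball; apply: cpolyM; first exact: cpoly_cst.
  by apply: cpolyM => //; exact: cpoly_zernike.
have mB := @measurable_ball3 R.
transitivity (\sum_(q < l + 2 * T) \sum_(L < l + 2 * T) \sum_(j < (2 * L).+1)
    c q L (j%:Z - L%:Z) * P q L (j%:Z - L%:Z)).
  transitivity (cint (leb3 R) B (fun x => \sum_(q < l + 2 * T) \sum_(L < l + 2 * T)
      \sum_(j < (2 * L).+1) c q L (j%:Z - L%:Z) * (zernike_poly q L (j%:Z - L%:Z) x * W x))).
    apply: eq_cint => x _; rewrite mulr_suml; apply: eq_bigr => q _; rewrite mulr_suml.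
    apply: eq_bigr => L _; rewrite mulr_suml; apply: eq_bigr => j _.
    exact: esym (mulrA _ _ _).
  etransitivity.
    apply: cint_sum => // q; apply: cintegrable_sum => // L; apply: cintegrable_sum => // j.
  apply: eq_bigr => q _; etransitivity.
    by apply: cint_sum => // L; apply: cintegrable_sum => // j.
  apply: eq_bigr => L _; etransitivity.
    by apply: cint_sum => // j.
  apply: eq_bigr => j _; apply: cintZ => //.
  by apply: cpoly_ball; apply: cpolyM => //; exact: cpoly_zernike.
transitivity (\sum_(q < l + 2 * T) \sum_(s < T) c q (l + 2 * s)%N m * P q (l + 2 * s)%N m).
  apply: eq_bigr => q _.
  pose F L := if (`|m| <= L)%N then c q L m * P q L m else 0.
  transitivity (\sum_(L < l + 2 * T) F L).
    apply: eq_bigr => L _.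
    apply: (@sum_orders _ L m (fun j => c q L j * P q L j)) => j jL jm.
    by rewrite projection_offdiag// mulr0.
  rewrite sum_even_shift => [|L Ll|s].
  - by apply: eq_bigr => s _; rewrite /F ifT//; lia.
  - by rewrite /F; case: ifP => // mL; rewrite projection_low// mulr0.
  - by rewrite /F; case: ifP => // _; rewrite projection_odd mulr0.
rewrite (@sum_truncate _ k.+1 _ (fun q => \sum_(s < T) c q (l + 2 * s)%N m * P q (l + 2 * s)%N m)); last 2 first.
- by lia.
- by move=> q kq; rewrite big1// => s _; rewrite zernike_weight_eq0 ?mulr0//; lia.
rewrite -sumrN; apply: eq_bigr => q _; have qk := ltn_ord q.
rewrite (@sum_truncate _ (k - q).+1 _ (fun s => c q (l + 2 * s)%N m * P q (l + 2 * s)%N m)); last 2 first.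
- by lia.
- by move=> s ks; rewrite zernike_weight_eq0 ?mulr0//; lia.
rewrite -sumrN; apply: eq_bigr => s _; have sk := ltn_ord s.
by rewrite zernike_weight_coef//; [rewrite mulrN mulrC|lia].
Qed.

Lemma cint_eta_weight (eta : pt R -> R[i]) (c : nat -> nat -> int -> R[i]) :
  cmeasurable B eta -> zernike_expansion eta c ->
  cint (leb3 R) B (fun x => eta x * W x) =
  - \sum_(q < k.+1) \sum_(s < (k - q).+1) Qcoef R l s k m q * c q (l + 2 * s)%N m.
Proof.
move=> [mRe mIm] [_ cvg]; set C := RHS.
have pW := @cpoly_weight R (k + 1) (l + k + 1) m.
have cW := C1c_ccont (cpoly_C1c pW).
have [M MP] := ccont_bounded_cube cW.
pose g N x := eta x - zernike_sum c N x.
have gE N : g N = fun x => eta x - zernike_poly_sum c N x.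
  by apply/funext => x; rewrite /g zernike_sumE.
have mg N : cmeasurable B (g N).
  have [h1 h2] := ccont_cmeasurable B (C1c_ccont (cpoly_C1c (cpoly_zernike_sum c N))).
  rewrite gE; split.
    by under eq_fun do rewrite ReDi ReNi; exact: measurable_funB.
  by under eq_fun do rewrite ImDi ImNi; exact: measurable_funB.
apply/eqP; rewrite -subr_eq0; apply/eqP; apply: small_eq0 => e e0.
have := @cint_L2M_small _ _ _ (leb3 R) B (@measurable_ball3 R) (@leb3_ball_fin R) W M
  (ccont_cmeasurable B cW) (fun x Bx => MP x (ball3_cube Bx)) g mg cvg e e0.
case=> N0 _ NP.
(* T exceeds k, so the partial sum already has its final pairing, and l + 2 T exceeds [N0], so the
   remainder is small. *)
pose T := (k.+1 + N0)%N.
have [] := NP (l + 2 * T)%N; first by rewrite /= /T; lia.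
set N := (l + 2 * T)%N => ig.
have ipz : cintegrable (leb3 R) B (fun x => zernike_poly_sum c N x * W x).
  by apply: cpoly_ball; apply: cpolyM => //; exact: cpoly_zernike_sum.
have -> : cint (leb3 R) B (fun x => eta x * W x) =
    cint (leb3 R) B (fun x => g N x * W x) + C.
  rewrite /C -(@cint_zernike_sum c T); last by rewrite /T; lia.
  rewrite -cintD//; last exact: measurable_ball3.
  by apply: eq_cint => x _; rewrite gE -mulrDl subrK.
by rewrite addrK => h1 h2; split.
Qed.

End projection.

Lemma L2_diamond_Y l m : (0 < l)%N -> (`|m| <= l)%N -> L2_diamond (@Y R l m).
Proof.
move=> l0 ml.
have Ys (x : pt R) : S x -> Y l m x = harm l m x.
  by rewrite /sphere/= => e; rewrite -Y_harm// e expr1n mul1r.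
have ph := @cpoly_harm R l m.
split; last first.
  transitivity (cint (dS R) S (harm l m)); first by apply: eq_cint => x; exact: Ys.
  (* Green's identity with h = 1: the Laplacian vanishes, so l (l + 1) times the integral over the
     sphere is 0. *)
  have := green_moment 0 (cpoly_cst 1) ph (euler_cst 1) (euler_harm ml) (lap_cst 1).
  have -> : cint (leb3 R) B (fun x => r2 x ^+ 0 * (1 * lap (harm l m) x)) = 0.
    rewrite -[RHS](cint0 (leb3 R) B); apply: eq_cint => x _.
    by rewrite lap_harm !mulr0.
  rewrite mulr0 subr0 => /esym/eqP; rewrite !mulf_eq0 !pnatr_eq0 addn0 addn1 (gtn_eqF l0)/= => /eqP h.
  by rewrite -[RHS]h; apply: eq_cint => x _; rewrite mul1r.
have [m1 m2 m3] := ccont_mem_L2_sphere (C1c_ccont (cpoly_C1c ph)).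
split.
- by apply: eq_measurable_fun m1 => x; rewrite inE => Sx; rewrite Ys.
- by apply: eq_measurable_fun m2 => x; rewrite inE => Sx; rewrite Ys.
rewrite /norm_Lp (_ : _ \_ S = (fun x => (Normc.normc (harm l m x))%:E) \_ S)//.
apply/funext => x; rewrite !patchE; case: ifP => //; rewrite inE => Sx.
by rewrite Ys.
Qed.

Lemma neumann_Y l m : (0 < l)%N -> (`|m| <= l)%N ->
  neumann_solution (@Y R l m) (fun x => l%:R^-1 * harm l m x).
Proof.
move=> l0 ml; have ph := @cpoly_harm R l m.
apply: (@neumann_poly _ _ _ l) => //.
- by apply: cpolyM => //; exact: cpoly_cst.
- by move=> x; etransitivity; [exact: lapZ|rewrite lap_harm mulr0].
- by apply: eulerZ => //; exact: euler_harm.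
move=> x Sx; rewrite mulrA divff ?pnatr_eq0 -?lt0n// mul1r.
by move: Sx; rewrite /sphere/= => e; rewrite -Y_harm// e expr1n mul1r.
Qed.

Lemma Qcoef_neq0 k l m : (`|m| <= l)%N -> Qcoef R l 0 k m k != 0.
Proof.
move=> ml; rewrite /Qcoef gauntE; try lia.
have t0 : triple (k + 1) (l + k + 1) (l + 2 * 0) m m != 0 :> R[i].
  by apply: triple_neq0; lia.
have e (x : R) : x != 0 -> x%:C != 0 :> R[i].
  by rewrite (_ : 0 = 0%:C)// (inj_eq (@complexI R)).
have l0 := ler0n R l; have k0 := ler0n R k.
have p1 : pochhammer (k%:R - k%:R - 0 + 1 : R) k != 0.
  have h : half_integer (k%:R - k%:R - 0 + 1 : R).
    by rewrite subrr subr0; exact: (half_integer_nat 0).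
  by rewrite /pochhammer mulf_neq0 ?invr_eq0// gt_eqF// Gamma_gt0//; exact: half_integerD.
have p2 : pochhammer (l%:R + k%:R + 0 + 5 / 2 : R) k != 0.
  have h : half_integer (l%:R + k%:R + 0 + 5 / 2 : R).
    by rewrite addr0 -natrD; exact: half_integer_half.
  by rewrite /pochhammer mulf_neq0 ?invr_eq0// gt_eqF// Gamma_gt0//; exact: half_integerD.
have s0 : Num.sqrt (2 * l%:R + 4 * k%:R + 4 * 0%:R + 3) != 0 :> R.
  by rewrite gt_eqF// sqrtr_gt0 mulr0; lra.
have k1 : k%:R - 0%:R + 1 != 0 :> R by rewrite subr0 gt_eqF//; lra.
have k2 : k%:R + 1 != 0 :> R by rewrite gt_eqF//; lra.
have k3 : l%:R + k%:R + 1 != 0 :> R by rewrite gt_eqF//; lra.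
have m1 : (-1) ^ (m + 1) != 0 :> R by rewrite expfz_neq0// oppr_eq0 oner_eq0.
have m2 : (-1) ^+ `|m| != 0 :> R by rewrite signr_eq0.
move: p1 p2 s0 k1 k2 k3 m1 m2 t0.
move: (pochhammer (k%:R - k%:R - 0 + 1) k) (pochhammer (l%:R + k%:R + 0 + 5 / 2) k).
move: (Num.sqrt _) (k%:R - 0%:R + 1) (k%:R + 1) (l%:R + k%:R + 1) ((-1) ^ (m + 1)) ((-1) ^+ `|m|).
move: (triple _ _ _ _ _) => T a1 a2 a3 a4 a5 a6 a7 a8 h7 h8 h1 h2 h3 h4 h5 h6 t0.
apply: mulf_neq0; last by apply: mulf_neq0 => //; exact: e.
by apply: e; rewrite !mulf_neq0// invr_eq0 !mulf_neq0.
Qed.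

End expansion.

Theorem theorem1p1 (R : realType)
    (F : (pt R -> R[i]) -> (pt R -> R[i]) -> (pt R -> R[i]))
    (hF : linearised_data F)
    (eta : pt R -> R[i]) (heta : L3_ball eta)
    (c : nat -> nat -> int -> R[i]) (hc : zernike_expansion eta c)
    (k l : nat) (m : int) (hm : `|m| <= l%:Z) :
  Qcoef R l 0 k m k <> 0 /\
  c k l m =
    (Qcoef R l 0 k m k)^-1 *
    (inner_L2 (dS R) (@sphere R) (F eta (Y (k + 1) 0)) (Y (l + k + 1) m) -
     \sum_(q < k) \sum_(s < (k - q).+1)
        Qcoef R l s k m q * c q (l + 2 * s)%N m).
Proof.
have ml : (`|m| <= l)%N by move: hm; rewrite -abszE lez_nat.
have Q0 := @Qcoef_neq0 R k l m ml; split; first exact/eqP.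
have K0 : (0 < k + 1)%N by lia.
have n0 : (0 < l + k + 1)%N by lia.
have mn : (`|m| <= l + k + 1)%N by lia.
have [m1 m2 _] := heta.
rewrite (F_inner hF heta (@L2_diamond_Y R _ 0 K0 isT) (@L2_diamond_Y R _ m n0 mn)
  (@neumann_Y R _ 0 K0 isT) (@neumann_Y R _ m n0 mn)).
have := @cint_eta_weight R k l m ml eta c (conj m1 m2) hc.
rewrite /weight /uf /ug => ->.
(* The minus sign of [F_inner] cancels that of the pairing. The last index q = k admits only s = 0,
   and its single term is the one solved for. *)
rewrite opprK big_ord_recr/= subnn big_ord1 addrC addrK muln0 addn0.
by rewrite mulrA mulVf// mul1r.
Qed.
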